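(* Let $F$ be an $\mathcal F_T$-measurable real random variable such that $E[e^{p\alpha F^+}]<\infty$ and $E[e^{\varepsilon F^-}]<\infty$ for some integer $p>1$ and some $\varepsilon>0$, and let $(Y,Z)$ be the unique solution of BSDE$(F,f)$. Let $q^\star$ be any predictable process with $q_t^\star\in\partial f_z(t,Z_t)$, and let $L_t^{q^\star}=\mathcal E_t(\int_0^\cdot(q_u^\star)^{tr}dB_u)$, $t\in[0,T]$. Then $L_T^{q^\star}$ has finite entropy, i.e. $E[L_T^{q^\star}\ln L_T^{q^\star}]<\infty$. Hence $L^{q^\star}$ is in Class (D) and, therefore, it is a uniformly integrable martingale.
   Context: Fix $T>0$, integers $1\le d\le m$ and $\alpha>0$. $B$ is a standard $m$-dimensional Brownian motion on a complete probability space $(\Omega,\mathcal F,\mathbb P)$ with augmented natural filtration $(\mathcal F_t)$; predictability is with respect to this filtration, $E$ is expectation under $\mathbb P$, $A^{tr}$ is the transpose of $A$, and $\mathcal E$ is the stochastic exponential. The processes $b$ ($\mathbb R^d$-valued) and $\sigma$ ($\mathbb R^{d\times m}$-valued) are predictable and bounded, $\sigma_t\sigma_t^{tr}$ is invertible, and $\theta_t=\sigma_t^{tr}(\sigma_t\sigma_t^{tr})^{-1}b_t$ is bounded. $\mathcal C\subset\mathbb R^d$ is closed and convex with $0\in\mathcal C$; $\sigma_t^{tr}\mathcal C=\{\sigma_t^{tr}\pi:\pi\in\mathcal C\}$; $\mathrm{dist}_K$ is the Euclidean distance to $K$. The generator $$f(t,z)=\frac{\alpha}{2}\mathrm{dist}^2_{\sigma_t^{tr}\mathcal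 C}\left(z+\frac1\alpha\theta_t\right)-z^{tr}\theta_t-\frac{1}{2\alpha}|\theta_t|^2,\quad z\in\mathbb R^m,$$ is convex in $z$, with subdifferential $\partial f_z(t,z)=\{q\in\mathbb R^m:f(t,\bar z)-f(t,z)\ge q^{tr}(\bar z-z)\ \forall\bar z\in\mathbb R^m\}$. A solution of BSDE$(F,f)$ is a pair of predictable processes $(Y,Z)$ with values in $\mathbb R\times\mathbb R^m$, $Y$ continuous, $\int_0^T|Z_t|^2dt<\infty$ and $\int_0^T|f(t,Z_t)|dt<\infty$ a.s., and $Y_t=F+\int_t^Tf(s,Z_s)ds-\int_t^TZ_s^{tr}dB_s$, $t\in[0,T]$; the ''unique solution'' is unique in the class $E[e^{p\alpha Y^+_\star}+e^{\varepsilon Y^-_\star}+\int_0^T|Z_s|^2ds]<\infty$, $Y^\pm_\star=\sup_{t\le T}Y_t^\pm$, $y^+=\max\{y,0\}$, $y^-=\max\{-y,0\}$. A process $L$ is in Class (D) if $\{L_\tau:\tau\text{ a stopping time with values in }[0,T]\}$ is uniformly integrable. *)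

(* Defs.v *)
From Stdlib Require List.
From mathcomp Require Import all_boot all_order all_algebra.
From mathcomp Require Import all_classical all_reals all_analysis.
Set Implicit Arguments.
Unset Strict Implicit.
Unset Printing Implicit Defensive.
Import Order.TTheory GRing.Theory Num.Theory.
Import numFieldNormedType.Exports.
Local Open Scope classical_set_scope.
Local Open Scope ring_scope.

Section euclidean.
Variables (R : realType) (n : nat).
Implicit Types u v x : 'cV[R]_n.

Definition dotv u v : R := (u^T *m v) 0 0.

(* The library norm on matrices is the sup norm, hence this definition. *)
Definition enorm u : R := Num.sqrt (dotv u u).

Definition dist_set (K : set 'cV[R]_n) x : R := inf [set enorm (x - y) | y in K].

Definition subdifferential (g : 'cV[R]_n -> R) z : set 'cV[R]_n :=
  [set q | forall z', dotv q (z' - z) <= g z' - g z].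

End euclidean.

Section coefficients.
Variables (R : realType) (d m : nat).

Definition market_price (b : 'cV[R]_d) (s : 'M[R]_(d, m)) : 'cV[R]_m :=
  s^T *m invmx (s *m s^T) *m b.

Definition generator (alpha : R) (C : set 'cV[R]_d) (b : 'cV[R]_d)
    (s : 'M[R]_(d, m)) (z : 'cV[R]_m) : R :=
  let theta := market_price b s in
  alpha / 2 * dist_set [set s^T *m c | c in C] (z + alpha^-1 *: theta) ^+ 2
  - dotv z theta - (2 * alpha)^-1 * enorm theta ^+ 2.

End coefficients.

Section processes.
Context {disp : measure_display} {Omega : measurableType disp} {R : realType}.
Variables (P : probability Omega R) (T : R).

(* The time set is [0, T]: values of a process at other times are irrelevant. *)

Definition sigma_measurable (G : set (set Omega)) (X : Omega -> R) : Prop :=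
  forall A : set R, measurable A -> G (X @^-1` A).

Definition adapted (Ft : R -> set (set Omega)) (X : R -> Omega -> R) : Prop :=
  forall t : R, 0 <= t <= T -> sigma_measurable (Ft t) (X t).

Definition predictable_sigma (Ft : R -> set (set Omega)) :
    set (set (R * Omega)) :=
  <<s `[0, T] `*` setT,
      [set E | (exists2 A, Ft 0 A & E = [set 0] `*` A) \/
               (exists (s t : R) A, [/\ 0 <= s, s < t, t <= T, Ft s A &
                                  E = `]s, t] `*` A])] >>.

Definition predictable (Ft : R -> set (set Omega)) (X : R -> Omega -> R) : Prop :=
  forall A : set R, measurable A ->
    predictable_sigma Ft [set x | 0 <= x.1 <= T /\ A (X x.1 x.2)].

Definition predictable_mx k l (Ft : R -> set (set Omega))
    (X : R -> Omega -> 'M[R]_(k, l)) : Prop :=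
  forall i j, predictable Ft (fun t w => X t w i j).

Definition ae_dtdP (Q : R -> Omega -> Prop) : Prop :=
  {ae (lebesgue_measure \x P)%E, forall x : R * Omega,
     0 <= x.1 <= T -> Q x.1 x.2}.

Definition bounded_mx k l (X : R -> Omega -> 'M[R]_(k, l)) : Prop :=
  exists K : R, ae_dtdP (fun t w => forall i j, `|X t w i j| <= K).

Definition as_continuous (X : R -> Omega -> R) : Prop :=
  {ae P, forall w, {within `[0, T], continuous (X ^~ w)}}.

Definition cvg_in_prob0 (X : nat -> Omega -> \bar R) : Prop :=
  forall e : R, 0 < e ->
    P [set w | (e%:E < X n w)%E] @[n --> \oo] --> 0%E.

Section brownian.
Variables (m : nat) (B : R -> Omega -> 'cV[R]_m).

Definition natural_sigma (t : R) : set (set Omega) :=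
  <<s [set E | exists (u : R) i (A : set R), [/\ 0 <= u <= t, measurable A &
                 E = (fun w => B u w i 0) @^-1` A]] >>.

Definition augmented_filtration (t : R) : set (set Omega) :=
  <<s natural_sigma t `|` [set N | P.-negligible N] >>.

Definition box_increment (s t : R) (A : 'I_m -> set R) : set Omega :=
  [set w | forall i, A i ((B t w - B s w) i 0)].

(* Boxes form a pi-system generating the Borel sets, so the last two clauses
   say that B_t - B_s has law N(0, (t - s) I_m) and is independent of the past.
   The second parameter of normal_prob is the standard deviation. *)
Definition brownian_motion : Prop :=
  [/\ forall t : R, 0 <= t <= T -> forall i,
        measurable_fun setT (fun w => B t w i 0),
      {ae P, forall w, B 0 w = 0},
      forall i, as_continuous (fun t w => B t w i 0),
      forall s t : R, 0 <= s -> s < t -> t <= T ->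
        forall A : 'I_m -> set R, (forall i, measurable (A i)) ->
        P (box_increment s t A)
          = (\prod_(i < m) normal_prob 0%R (Num.sqrt (t - s)) (A i))%E &
      forall s t : R, 0 <= s -> s < t -> t <= T ->
        forall A : 'I_m -> set R, (forall i, measurable (A i)) ->
        forall E, natural_sigma s E ->
        P (E `&` box_increment s t A) = (P E * P (box_increment s t A))%E].

Local Notation Ft := augmented_filtration.

(* A triple (s, t, xi) stands for the integrand xi 1_{]s, t]}. *)
Definition simple_integrand := seq (R * R * (Omega -> 'cV[R]_m)).

Definition simple_wf (S : simple_integrand) : Prop :=
  forall s t xi, List.In (s, t, xi) S ->
    [/\ 0 <= s, s <= t, t <= T,
        forall i, sigma_measurable (Ft s) (fun w => xi w i 0) &
        exists K : R, forall w, enorm (xi w) <= K].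

Definition simple_val (S : simple_integrand) (u : R) (w : Omega) : 'cV[R]_m :=
  \sum_(p <- S) (if p.1.1 < u <= p.1.2 then p.2 w else 0).

Definition simple_int (S : simple_integrand) (u : R) (w : Omega) : R :=
  \sum_(p <- S)
    dotv (p.2 w) (B (Num.min p.1.2 u) w - B (Num.min p.1.1 u) w).

(* The process I is (a version of) the Ito integral of H against B: the limit,
   uniformly on [0, T] in probability, of the integrals of simple integrands S n
   such that int_0^T |S n - H|^2 dt tends to 0 in probability. Such S n exist
   exactly when the predictable H satisfies int_0^T |H|^2 dt < oo a.s., and I is
   then unique up to indistinguishability. *)
Definition ito_integral (H : R -> Omega -> 'cV[R]_m) (I : R -> Omega -> R) : Prop :=
  [/\ predictable_mx Ft H, adapted Ft I, as_continuous I &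
    exists S : nat -> simple_integrand,
      [/\ forall n, simple_wf (S n),
          cvg_in_prob0 (fun n w =>
            (\int[lebesgue_measure]_(t in `[0%R, T])
               (enorm (simple_val (S n) t w - H t w) ^+ 2)%:E)%E) &
          cvg_in_prob0 (fun n w =>
            ereal_sup [set `|simple_int (S n) t w - I t w|%:E
                      | t in `[0, T]])]].

(* Doleans-Dade exponential of the continuous local martingale I = int q dB,
   whose bracket is int |q|^2 dt. *)
Definition stochastic_exponential (q : R -> Omega -> 'cV[R]_m)
    (I : R -> Omega -> R) (t : R) (w : Omega) : R :=
  expR (I t w - 2^-1 *
    (\int[lebesgue_measure]_(u in `[0, t]) (enorm (q u w) ^+ 2))%R).

Definition bsde_solution (F : Omega -> R) (f : R -> Omega -> 'cV[R]_m -> R)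
    (Y : R -> Omega -> R) (Z : R -> Omega -> 'cV[R]_m) : Prop :=
  [/\ predictable Ft Y /\ predictable_mx Ft Z,
      as_continuous Y,
      {ae P, forall w, (\int[lebesgue_measure]_(t in `[0%R, T])
                          (enorm (Z t w) ^+ 2)%:E < +oo)%E},
      {ae P, forall w, (\int[lebesgue_measure]_(t in `[0%R, T])
                          `|f t w (Z t w)|%:E < +oo)%E} &
      exists2 I, ito_integral Z I &
        {ae P, forall w, forall t : R, 0 <= t <= T ->
           Y t w = F w
             + (\int[lebesgue_measure]_(s in `[t, T]) f s w (Z s w))%R
             - (I T w - I t w)}].

(* The uniqueness class of the equation. *)
Definition in_solution_class (alpha eps : R) (p : nat)
    (Y : R -> Omega -> R) (Z : R -> Omega -> 'cV[R]_m) : Prop :=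
  let Ypos w := ereal_sup [set (Num.max (Y t w) 0)%:E | t in `[0, T]] in
  let Yneg w := ereal_sup [set (Num.max (- Y t w) 0)%:E | t in `[0, T]] in
  (\int[P]_w (expeR ((p%:R * alpha)%:E * Ypos w) + expeR (eps%:E * Yneg w)
     + \int[lebesgue_measure]_(t in `[0%R, T]) (enorm (Z t w) ^+ 2)%:E)
   < +oo)%E.

End brownian.

Definition uniformly_integrable (X : set (Omega -> R)) : Prop :=
  (forall x, X x -> measurable_fun setT x) /\
  forall e : R, 0 < e -> exists c : R, forall x, X x ->
    (\int[P]_(w in [set w | c < `|x w|%R]%R) `|x w|%:E <= e%:E)%E.

Definition stopping_time (Ft : R -> set (set Omega)) (tau : Omega -> R) : Prop :=
  (forall w, 0 <= tau w <= T) /\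
  (forall t : R, 0 <= t <= T -> Ft t [set w | tau w <= t]).

Definition class_D (Ft : R -> set (set Omega)) (L : R -> Omega -> R) : Prop :=
  uniformly_integrable
    [set x | exists2 tau, stopping_time Ft tau & x = (fun w => L (tau w) w)].

(* The last clause reads E[L_t | Ft s] = L_s. *)
Definition martingale (Ft : R -> set (set Omega)) (L : R -> Omega -> R) : Prop :=
  [/\ adapted Ft L,
      forall t : R, 0 <= t <= T -> P.-integrable setT (EFin \o L t) &
      forall s t : R, 0 <= s -> s <= t -> t <= T -> forall A, Ft s A ->
        (\int[P]_(w in A) (L t w)%:E = \int[P]_(w in A) (L s w)%:E)%E].

Definition ui_martingale (Ft : R -> set (set Omega)) (L : R -> Omega -> R) : Prop :=
  martingale Ft L /\
  uniformly_integrable [set x | exists2 t : R, 0 <= t <= T & x = L t].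

End processes.

(* Main.v *)
(* The driver satisfies [f(t, z) <= alpha / 2 |z|^2] because [0] lies in [C], and
   testing the subgradient inequality at [z' = q / alpha] gives
   [f(t, Z) <= q.Z - |q|^2 / (2 alpha)] for [q] in the subdifferential at [Z].
   Insert this in the equation for [Y], write [U := I - <q> / 2] for the logarithm
   of [L], and let [U2] be the log-exponential of [(1 + lam) q - lam alpha Z]. For
   every [lam > 0],
   [lam (U_t - alpha (Y_t - Y_0)) <= U2_t - U_t + lam^2 / 2 <q - alpha Z>_t].
   Up to a stopping time [rho] at which the brackets of [q] and [Z] are at most [n],
   take [lam] of order [1 / n], so that the last term is at most [lam / 2].
   Multiplying by [L_rho = e^U] and using [e^U (U2 - U) <= e^U2 - e^U] with
   [E e^U = E e^U2 = 1] at [rho], the singular factor [1 / lam] cancels. Young's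
   inequality [e^u y <= e^u u - e^u + e^y] absorbs [alpha Y^+ e^U] and there remains
   a bound of [E[U e^U]] by exponential moments of [Y], independent of [n] and [rho].
   Fatou's lemma removes the localization. Hence the values of [L] at all stopping
   times have bounded entropy and are uniformly integrable, so that the martingale
   property of the localized exponential passes to the limit.

   The only stochastic calculus needed is that stopped exponentials of
   Ito integrals with bounded bracket have constant expectation. For simple integrands
   this is the Gaussian exponential moment, one grid step at a time; the grid
   product is frozen when its bracket reaches the bound, which makes it bounded in
   [L^2] and allows the passage to the limit. *)
From Stdlib Require List.
Require Import Defs.
From mathcomp Require Import all_boot all_order all_algebra.
From mathcomp Require Import all_classical all_reals all_analysis.
From mathcomp Require Import measurable_realfun ring lra.
Set Implicit Arguments.
Unset Strict Implicit.
Unset Printing Implicit Defensive.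
Import Order.TTheory GRing.Theory Num.Theory.
Import numFieldNormedType.Exports.
Local Open Scope classical_set_scope.
Local Open Scope ring_scope.

(** * Gaussian increments *)

(** The tilt replaces a change of measure. With [J] the Ito integral of [Z] and [h = q - alpha Z],
    the equation and the bound of the driver give [U - alpha (Y - Y_0) <= N] for
    [N := I - alpha J - int q.h dt]. By Girsanov's theorem [N] is a local martingale under the
    measure with density [e^U], so [E[e^U N]] should vanish. Here [U2] is the log-exponential of
    [q + lam h], that is [U2 - U = lam N - lam^2 / 2 <h>]: the quotient [(e^U2 - e^U) / lam] has
    mean zero for every [lam], and its limit at [lam = 0] is [e^U N]. Convexity of the exponential
    compares the two at positive [lam], and the error is the second-order term in [<h>]; this forces
    [lam] to be small against the bound on the brackets. Two points shape the details. [Y_0] is only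
    known to be measurable for the initial sigma-algebra, hence the weights [W] at time 0 in the
    unit-mean statement. The path of the driver along [Z] is integrated without knowing that it is
    measurable, hence the detour through lower integrals. *)

Section normal_moment.
Context {R : realType}.
Local Notation mu := (@lebesgue_measure R).
Import HBNNSimple.

(** [normal_prob] of a set is by definition the integral of the density over it, so indicators are
    immediate; linearity gives simple functions and monotone convergence on both sides gives [f]. *)
Lemma integral_normal_prob (s : R) (f : R -> \bar R) :
  (forall x, 0 <= f x)%E -> measurable_fun setT f ->
  (\int[normal_prob 0%R s]_x f x =
   \int[mu]_x (f x * (normal_pdf 0%R s x)%:E))%E.
Proof.
move=> f0 mf.
pose g := nnsfun_approx measurableT mf.
have pdf0 x : (0 <= (normal_pdf 0 s x)%:E)%E by rewrite lee_fin normal_pdf_ge0.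
have mpdf : measurable_fun setT (fun x : R => (normal_pdf 0 s x)%:E).
  by apply/measurable_EFinP; exact: measurable_normal_pdf.
have mgn n : measurable_fun setT (fun x => (g n x)%:E) by exact/measurable_EFinP.
have gn0 n x : (0 <= (g n x)%:E)%E by rewrite lee_fin; exact: fun_ge0.
have gnd x : {homo (fun n => (g n x)%:E) : a b / (a <= b)%N >-> (a <= b)%E}.
  by move=> a b ab; rewrite lee_fin; exact/lefP/nd_nnsfun_approx.
have fE x : f x = limn (fun n => (g n x)%:E).
  by apply/esym/cvg_lim => //; exact: cvg_nnsfun_approx.
transitivity (limn (fun n => (\int[normal_prob 0%R s]_x (g n x)%:E)%E)).
  rewrite -monotone_convergence//.
  by apply: eq_integral => x _; exact: fE.
transitivity (limn (fun n => (\int[mu]_x ((g n x)%:E * (normal_pdf 0%R s x)%:E))%E)); last first.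
  rewrite -monotone_convergence//; last 3 first.
  - by move=> n; apply: emeasurable_funM; [exact: mgn|exact: mpdf].
  - by move=> n x _; apply: mule_ge0; [exact: gn0|exact: pdf0].
  - by move=> x _ a b ab; apply: lee_wpmul2r; [exact: pdf0|exact: gnd].
  apply: eq_integral => x _; rewrite fE.
  under [in LHS]eq_fun do rewrite muleC.
  rewrite limeMl//; first by rewrite muleC.
  by apply: ereal_nondecreasing_is_cvgn; exact: gnd.
congr (limn _); apply/funext => n.
under eq_integral do rewrite fimfunE -fsumEFin//.
under [RHS]eq_integral.
  move=> x _; rewrite fimfunE -fsumEFin// ge0_mule_fsuml; last first.
    by move=> r; rewrite EFinM nnfun_muleindic_ge0.
  over.
have mind r : measurable_fun [set: R]
    (fun x : R => (r * \1_(g n @^-1` [set r]) x)%:E).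
  apply/measurable_EFinP/measurable_funM => //; apply: measurable_indic.
rewrite ge0_integral_fsum//; last first.
  by move=> r x _; rewrite EFinM nnfun_muleindic_ge0.
rewrite [RHS]ge0_integral_fsum//; last 2 first.
- by move=> r; apply: emeasurable_funM; [exact: mind|exact: mpdf].
- by move=> r x _; apply: mule_ge0 => //; rewrite EFinM nnfun_muleindic_ge0.
apply: eq_fsbigr => r /set_mem [x _ gx].
have r0 : 0 <= r by rewrite -gx; exact: fun_ge0.
have mA : measurable (g n @^-1` [set r]).
  by have := measurable_funP (g n) measurableT _ (measurable_set1 r); rewrite setTI.
under eq_integral do rewrite EFinM.
rewrite ge0_integralZl//; last exact/measurable_EFinP/measurable_indic.
rewrite integral_indic// setIT.
under [RHS]eq_integral do rewrite EFinM -muleA.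
rewrite ge0_integralZl//; last 2 first.
- by apply: emeasurable_funM => //; exact/measurable_EFinP/measurable_indic.
- by move=> y _; apply: mule_ge0 => //; rewrite lee_fin.
congr (_ * _)%E; rewrite /normal_prob [LHS]integral_mkcond.
apply: eq_integral => y _; rewrite patchE indicE.
by case: ifP => _; rewrite ?mul1e ?mul0e.
Qed.

(** Completing the square: the integrand times the density of [N(0, s^2)] is the density of
    [N(c s^2, s^2)]. *)
Lemma normal_exponential_moment (s c : R) : 0 < s ->
  (\int[normal_prob 0%R s]_x (expR (c * x - 2^-1 * (c ^+ 2 * s ^+ 2)))%:E = 1)%E.
Proof.
move=> s0; rewrite integral_normal_prob; last 2 first.
- by move=> x; rewrite lee_fin expR_ge0.
- apply/measurable_EFinP/measurableT_comp => //.
  by apply: measurable_funB => //; apply: measurable_funM.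
rewrite -(integral_normal_pdf (c * s ^+ 2) s); apply: eq_integral => x _.
have sn0 := lt0r_neq0 s0.
rewrite -EFinM !normal_pdfE//; congr EFin.
rewrite mulrCA; congr (_ * _); rewrite /normal_fun -expRD; congr expR.
by field.
Qed.
End normal_moment.

Section independence.
Context d (T : measurableType d) (R : realType) (P : probability T R).
Variables (G : set (set T)) (Gm : G `<=` measurable).
Local Notation TG := (g_sigma_algebraType G).

Lemma measurable_id_gsigma : measurable_fun setT (fun w : T => w : TG).
Proof.
move=> _ A mA; rewrite setTI.
by move: A mA; apply: smallest_sub => //; exact: sigma_algebra_measurable.
Qed.

(** Freezing lemma. The first factor carries only the sigma-algebra generated by [G], so [h] sees
    [w] through the past alone. By independence the law of [(w, X w)] agrees on rectangles with the
    product of [P] on [<<s G>>] and [gamma], hence everywhere, and Tonelli gives the iterated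
    integral. *)
Lemma integral_independent d' (U : measurableType d') (gamma : probability U R)
    (X : T -> U) (mX : measurable_fun setT X)
    (indep : forall E A, <<s G >> E -> measurable A ->
       P (E `&` X @^-1` A) = (P E * gamma A)%E)
    (h : TG * U -> \bar R) :
  measurable_fun setT h -> (forall x, 0 <= h x)%E ->
  (\int[P]_w h (w, X w) = \int[P]_w \int[gamma]_x h (w, x))%E.
Proof.
move=> mh h0.
pose phi0 (w : T) : TG * U := (w, X w).
have mphi : measurable_fun setT phi0.
  by apply: measurable_fun_pair => //; exact: measurable_id_gsigma.
pose phi : {mfun T >-> (TG * U)%type} := mfun_Sub (mem_set mphi).
pose iG : {mfun T >-> TG} := mfun_Sub (mem_set measurable_id_gsigma).
transitivity (\int[distribution P phi]_x h x)%E.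
  by rewrite ge0_integral_pushforward// => x _; exact: h0.
transitivity (\int[distribution P iG \x gamma]_x h x)%E.
  have Eq A : measurable A -> A `<=` setT ->
      distribution P phi A = (distribution P iG \x gamma)%E A.
    move=> mA _; apply/esym.
    apply: product_measure_unique => // E B mE mB.
  exact: (eq_measure_integral _ Eq).
rewrite fubini_tonelli1//= ge0_integral_pushforward//.
- exact: measurable_fun_fubini_tonelli_F.
- by move=> w _; apply: integral_ge0.
Qed.

End independence.

Section one_step.
Context d (T : measurableType d) (R : realType) (P : probability T R).
Variables (G : set (set T)) (Gm : G `<=` measurable).
Local Notation TG := (g_sigma_algebraType G).
Variables (X : T -> R) (mX : measurable_fun setT X) (s : R).
Hypothesis indep : forall E A, <<s G >> E -> measurable A ->
  P (E `&` X @^-1` A) = (P E * normal_prob 0%R s A)%E.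

Lemma expectation_exponential_step (W c : T -> R) : 0 < s ->
  measurable_fun setT (W : TG -> R) -> measurable_fun setT (c : TG -> R) ->
  (forall w, 0 <= W w) ->
  (\int[P]_w (W w * expR (c w * X w - 2^-1 * (c w ^+ 2 * s ^+ 2)))%:E =
   \int[P]_w (W w)%:E)%E.
Proof.
move=> s0 mW mc W0.
pose h (x : TG * measurableTypeR R) : \bar R :=
  (W x.1 * expR (c x.1 * x.2 - 2^-1 * (c x.1 ^+ 2 * s ^+ 2)))%:E.
have h0 x : (0 <= h x)%E by rewrite lee_fin mulr_ge0// expR_ge0.
have mW1 : measurable_fun setT (fun x : TG * measurableTypeR R => W x.1).
  exact: (measurableT_comp mW measurable_fst).
have mc1 : measurable_fun setT (fun x : TG * measurableTypeR R => c x.1).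
  exact: (measurableT_comp mc measurable_fst).
have mh : measurable_fun setT h.
  apply/measurable_EFinP; apply: measurable_funM => //.
  apply: measurableT_comp => //; apply: measurable_funB.
    by apply: measurable_funM => //; exact: measurable_snd.
  by do 2 apply: measurable_funM => //; apply: measurable_funX.
rewrite (integral_independent Gm (gamma := normal_prob 0 s) mX indep mh h0).
apply: eq_integral => w _; rewrite /h/=.
under eq_integral do rewrite EFinM.
rewrite ge0_integralZl//=.
- by rewrite normal_exponential_moment// mule1.
- apply/measurable_EFinP/measurableT_comp => //.
  by apply: measurable_funB => //; apply: measurable_funM.
- by rewrite lee_fin.
Qed.

End one_step.

Section complete_probability.
Context d (T : measurableType d) (R : realType) (P : probability T R).

Lemma eq_measure_negligible (A B : set T) : measurable A -> measurable B ->
  P.-negligible (A `\` B) -> P.-negligible (B `\` A) -> P A = P B.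
Proof.
move=> mA mB AB BA.
have le (C D : set T) : measurable C -> measurable D ->
    P.-negligible (C `\` D) -> (P C <= P D)%E.
  move=> mC mD CD; have mCD := measurableD mC mD.
  rewrite -[leRHS]adde0 -(measure_negligible mCD CD).
  apply: (le_trans _ (measureU2 P mD mCD)) => //.
  apply: le_measure; rewrite ?inE//; first exact: measurableU.
  by rewrite setUDr setDv setD0; exact: subsetUr.
by apply/eqP; rewrite eq_le !le.
Qed.

End complete_probability.

(** * Brownian increments and the augmented filtration *)

Section filtration.
Context d (Omega : measurableType d) (R : realType) (P : probability Omega R).
Hypothesis P_complete : measure_is_complete P.
Context (m : nat) (T : R) (B : R -> Omega -> 'cV[R]_m).
Hypothesis B_bm : brownian_motion P T B.

Local Notation Ft := (augmented_filtration P B).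
Local Notation Fgen t :=
  (natural_sigma B t `|` [set N | P.-negligible N]).

Lemma natural_sigma_sub t : t <= T -> natural_sigma B t `<=` measurable.
Proof.
move=> tT; apply: smallest_sub; first exact: sigma_algebra_measurable.
move=> E [u [i [A [/andP[u0 ut] mA ->]]]].
have [mB _ _ _ _] := B_bm.
have := mB u; rewrite u0 (le_trans ut tT) => /(_ isT) => /(_ i measurableT _ mA).
by rewrite setTI.
Qed.

Lemma augmented_gen_sub t : t <= T -> Fgen t `<=` measurable.
Proof.
by move=> tT E [/(natural_sigma_sub tT)//|]; exact: P_complete.
Qed.

Lemma augmented_sub t : t <= T -> Ft t `<=` measurable.
Proof.
move=> tT; apply: smallest_sub; first exact: sigma_algebra_measurable.
exact: augmented_gen_sub.
Qed.

Lemma augmented_le s t : s <= t -> Ft s `<=` Ft t.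
Proof.
move=> st; apply: sub_sigma_algebra2; apply: setSU.
apply: sub_sigma_algebra2 => E [u [i [A [/andP[u0 us] mA ->]]]].
by exists u, i, A; rewrite u0 (le_trans us st).
Qed.

Lemma augmented_negligible t N : P.-negligible N -> Ft t N.
Proof. by move=> NN; apply: sub_sigma_algebra; right. Qed.

Lemma sigma_measurable_le s t (X : Omega -> R) : s <= t ->
  sigma_measurable (Ft s) X -> sigma_measurable (Ft t) X.
Proof. by move=> st mX A mA; apply: (augmented_le st); exact: mX. Qed.

Lemma sigma_measurableW t (X : Omega -> R) : t <= T ->
  sigma_measurable (Ft t) X -> measurable_fun setT X.
Proof.
by move=> tT mX _ A mA; rewrite setTI; apply: (augmented_sub tT); exact: mX.
Qed.

(** The events equal to a natural one up to null sets form a sigma-algebra that contains the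
    generators. This carries the independence of increments from the natural to the augmented
    filtration. *)
Lemma augmented_natural t E : Ft t E -> exists E',
  [/\ natural_sigma B t E', P.-negligible (E `\` E')
    & P.-negligible (E' `\` E)].
Proof.
pose Q := [set E | exists E', [/\ natural_sigma B t E',
  P.-negligible (E `\` E') & P.-negligible (E' `\` E)]].
suff : Ft t `<=` Q by move=> H /H.
have sN : sigma_algebra setT (natural_sigma B t).
  exact: smallest_sigma_algebra.
apply: smallest_sub.
- split.
  + exists set0; split; rewrite ?setD0; [by case: sN|exact: negligible_set0..].
  + move=> A [E' [nE' AE EA]]; exists (setT `\` E'); split.
    * by case: sN => _ + _; exact.
    * by rewrite !setTD setDE setCK setIC -setDE.
    * by rewrite !setTD setDE setCK setIC -setDE.
  + move=> A /choice[E' HE']; exists (\bigcup_n E' n); split.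
    * by case: sN => _ _; apply => n; have [] := HE' n.
    * apply: (@negligibleS _ _ _ _ (\bigcup_n (A n `\` E' n))).
        move=> w [[n _ An] nE]; exists n => //; split=> // En.
        by apply: nE; exists n.
      by apply: negligible_bigcup => n; have [] := HE' n.
    * apply: (@negligibleS _ _ _ _ (\bigcup_n (E' n `\` A n))).
        move=> w [[n _ En] nA]; exists n => //; split=> // An.
        by apply: nA; exists n.
      by apply: negligible_bigcup => n; have [] := HE' n.
- move=> A [nA|NA].
    by exists A; rewrite setDv; split=> //; exact: negligible_set0.
  exists set0; rewrite setD0 set0D; split=> //; last exact: negligible_set0.
  by case: sN.
Qed.

Lemma measurable_increment s t i : 0 <= s -> s <= t -> t <= T ->
  measurable_fun setT (fun w => (B t w - B s w) i 0).
Proof.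
move=> s0 st tT; have [mB _ _ _ _] := B_bm.
rewrite (_ : (fun w => _) = (fun w => B t w i 0) \- (fun w => B s w i 0)).
  apply: measurable_funB; apply: mB.
    by rewrite (le_trans s0 st).
  by rewrite s0 (le_trans st tT).
by apply/funext => w; rewrite !mxE.
Qed.

Lemma measurable_box s t (A : 'I_m -> set R) : 0 <= s -> s <= t -> t <= T ->
  (forall i, measurable (A i)) -> measurable (box_increment B s t A).
Proof.
move=> s0 st tT mA.
rewrite (_ : box_increment _ _ _ _ =
    \bigcap_(i in [set: 'I_m]) ((fun w => (B t w - B s w) i 0) @^-1` A i)).
  apply: fin_bigcap_measurable => // i _.
  by have := measurable_increment i s0 st tT measurableT (mA i); rewrite setTI.
by apply/seteqP; split => [w Hw i _|w Hw i]; exact: Hw.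
Qed.

Lemma augmented_independent s t (A : 'I_m -> set R) E :
  0 <= s -> s < t -> t <= T -> (forall i, measurable (A i)) -> Ft s E ->
  P (E `&` box_increment B s t A)
    = (P E * \prod_(i < m) normal_prob 0%R (Num.sqrt (t - s)) (A i))%E.
Proof.
move=> s0 st tT mA FE; have [_ _ _ blaw bind] := B_bm.
have sT : s <= T by rewrite (le_trans (ltW st)).
have [E' [nE' EE E'E]] := augmented_natural FE.
have mE := augmented_sub sT FE; have mE' := natural_sigma_sub sT nE'.
have mb := measurable_box s0 (ltW st) tT mA.
rewrite (eq_measure_negligible mE mE')// -blaw// -bind//.
apply: eq_measure_negligible; [exact: measurableI|exact: measurableI| |].
- by apply: negligibleS EE => w [[Ew bw] n]; split=> // Ew'; exact: n.
- by apply: negligibleS E'E => w [[Ew bw] n]; split=> // Ew'; exact: n.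
Qed.

Section exponential_step.
Variables (s t : R) (s0 : 0 <= s) (st : s < t) (tT : t <= T).
Let dB (i : 'I_m) (w : Omega) : R := (B t w - B s w) i 0.

(* A pi-system generating the past of [s] and the first [j] coordinates of
   the increment. *)
Let gen (j : nat) : set (set Omega) := [set D | exists E (A : 'I_m -> set R),
  [/\ Ft s E, forall i, measurable (A i) &
      D = E `&` [set w | forall i : 'I_m, (i < j)%N -> A i (dB i w)]]].

Let sub_box j (A : 'I_m -> set R) :
  [set w | forall i : 'I_m, (i < j)%N -> A i (dB i w)] =
  box_increment B s t (fun i => if (i < j)%N then A i else setT).
Proof.
apply/seteqP; split=> w Hw i.
  by case: ifPn => // ij; exact: Hw.
by move=> ij; have := Hw i; rewrite ij.
Qed.

Let gen_sub j : gen j `<=` measurable.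
Proof.
move=> D [E [A [FE mA ->]]]; apply: measurableI.
  by apply: (augmented_sub _ FE); rewrite (le_trans (ltW st)).
rewrite sub_box; apply: measurable_box => //; first exact: ltW.
by move=> i; case: ifP.
Qed.

Let gen_augmented j : Ft s `<=` <<s gen j >>.
Proof.
move=> E FE; apply: sub_sigma_algebra.
exists E, (fun=> setT); split=> //.
by apply/seteqP; split=> [w Ew|w []//]; split.
Qed.

Let gen_increment j (i : 'I_m) : (i < j)%N ->
  measurable_fun setT (dB i : g_sigma_algebraType (gen j) -> R).
Proof.
move=> ij _ A mA; rewrite setTI; apply: sub_sigma_algebra.
exists setT, (fun k => if k == i then A else setT); split.
- by case: (@smallest_sigma_algebra _ setT (Fgen s)) => h0 hC _;
    rewrite -[setT]setD0; exact: hC.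
- by move=> k; case: ifP.
- apply/seteqP; split=> w /=.
    by move=> Aw; split=> // k kj; case: eqP => // ->.
  by case=> _ /(_ i ij); rewrite eqxx.
Qed.

(** For fixed [A] both sides are finite measures in [E]. They agree on the pi-system [gen j], where
    the event is again a box and the Gaussian law factorizes, hence on the sigma-algebra it
    generates. *)
Let gen_independent (j : 'I_m) E A : <<s gen j >> E -> measurable A ->
  P (E `&` dB j @^-1` A)
    = (P E * normal_prob 0%R (Num.sqrt (t - s)) A)%E.
Proof.
move=> gE mA.
have mX : measurable (dB j @^-1` A).
  have := measurable_increment j s0 (ltW st) tT measurableT mA.
  by rewrite setTI.
have nf : normal_prob 0%R (Num.sqrt (t - s)) A \is a fin_num.
  exact: fin_num_measure.
have r0 : 0 <= fine (normal_prob 0%R (Num.sqrt (t - s)) A) by exact: fine_ge0.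
pose r := NngNum r0.
suff : mrestr P mX E = mscale r P E.
  by rewrite /mrestr /mscale/= => ->; rewrite fineK// muleC.
apply: (g_sigma_algebra_measure_unique (gen j) _ (fun=> setT)) => //.
- move=> _; exists setT, (fun=> setT); split=> //.
    by case: (@smallest_sigma_algebra _ setT (Fgen s)) => h0 hC _;
      rewrite -[setT]setD0; exact: hC.
  by apply/seteqP; split=> [w Ew|w []//]; split.
- by rewrite bigcup_const//; exists 0%N.
- move=> _ _ [E1 [A1 [FE1 mA1 ->]]] [E2 [A2 [FE2 mA2 ->]]].
  exists (E1 `&` E2), (fun i => A1 i `&` A2 i); split.
  + exact: (@measurableI _ (g_sigma_algebraType (Fgen s))).
  + by move=> i; exact: measurableI.
  + apply/seteqP; split=> w /=.
      by move=> [[e1 h1] [e2 h2]]; split=> // i ij; split; [exact: h1|exact: h2].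
    by move=> [[e1 e2] h]; split; split=> // i ij; have [] := h i ij.
- move=> _ [E1 [A1 [FE1 mA1 ->]]]; 
  change (P (E1 `&` [set w | forall i : 'I_m, (i < j)%N -> A1 i (dB i w)]
      `&` dB j @^-1` A) = (fine (normal_prob 0%R (Num.sqrt (t - s)) A))%:E *
    P (E1 `&` [set w | forall i : 'I_m, (i < j)%N -> A1 i (dB i w)]))%E.
  rewrite fineK// sub_box.
  rewrite augmented_independent//; last by move=> i; case: ifP.
  rewrite -setIA.
  rewrite (_ : box_increment _ _ _ _ `&` _ = box_increment B s t
     (fun i => if (i < j)%N then A1 i else if i == j then A else setT)); last first.
    apply/seteqP; split=> w.
      move=> [Hw Aw] i; have := Hw i; case: ifPn => // ij _.
      by case: eqP => // ->.
    move=> Hw; split.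
      by move=> i; have := Hw i; case: ifP.
    by have := Hw j; rewrite ltnn eqxx.
  rewrite augmented_independent//; last first.
    by move=> i; case: ifP => // _; case: ifP.
  rewrite (bigD1 j)//= ltnn eqxx muleCA; congr (_ * (_ * _))%E.
  rewrite [RHS](bigD1 j)//= ltnn probability_setT mul1e.
  by apply: eq_bigr => i /negPf ->.
- move=> _; change (P (setT `&` dB j @^-1` A) < +oo)%E.
  by rewrite setTI (le_lt_trans (probability_le1 _ _))// ltry.
Qed.

(** The exponential is a product over the coordinates of the increment. [V j] keeps the first [j]
    factors, and the one-dimensional step removes the last of them, conditionally on the past and on
    the earlier coordinates. *)
Lemma expectation_exponential_increment (W : Omega -> R)
    (c : Omega -> 'cV[R]_m) :
  sigma_measurable (Ft s) W -> (forall w, 0 <= W w) ->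
  (forall i, sigma_measurable (Ft s) (fun w => c w i 0)) ->
  (\int[P]_w (W w * expR (dotv (c w) (B t w - B s w)
       - 2^-1 * (dotv (c w) (c w) * (t - s))))%:E = \int[P]_w (W w)%:E)%E.
Proof.
move=> mW W0 mc.
pose sg := Num.sqrt (t - s).
have sg2 : sg ^+ 2 = t - s by rewrite sqr_sqrtr// subr_ge0 ltW.
pose a (i : 'I_m) w := c w i 0 * dB i w - 2^-1 * (c w i 0 ^+ 2 * sg ^+ 2).
pose V (j : nat) w := W w * expR (\sum_(i < m) if (i < j)%N then a i w else 0).
have gW j : measurable_fun setT (W : g_sigma_algebraType (gen j) -> R).
  by move=> _ A mA; rewrite setTI; apply: gen_augmented; exact: mW.
have gc j i : measurable_fun setT
    ((fun w => c w i 0) : g_sigma_algebraType (gen j) -> R).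
  by move=> _ A mA; rewrite setTI; apply: gen_augmented; exact: mc.
have mV j : measurable_fun setT (V j : g_sigma_algebraType (gen j) -> R).
  apply: measurable_funM => //; apply: measurableT_comp => //.
  apply: measurable_sum => i; case: (boolP (i < j)%N) => ij; last exact: measurable_cst.
  apply: measurable_funB; first by apply: measurable_funM => //; exact: gen_increment.
  by do 2 apply: measurable_funM => //; exact: measurable_funX.
have V0 j w : 0 <= V j w by rewrite mulr_ge0// expR_ge0.
have EV j : (j <= m)%N -> (\int[P]_w (V j w)%:E = \int[P]_w (W w)%:E)%E.
  elim: j => [_|j IH jm].
    apply: eq_integral => w _; rewrite /V big1 ?expR0 ?mulr1//.
  apply: etrans (IH (ltnW jm)).
  pose j' := Ordinal jm.
  apply: etrans (@expectation_exponential_step _ _ _ P (gen j) (@gen_sub j) (dB j') _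
    sg _ (V j) (fun w => c w j' 0) _ (mV j) (gc j j') (V0 j)).
  + apply: eq_integral => w _; congr EFin; rewrite /V -mulrA -expRD.
    congr (_ * expR _).
    rewrite (bigD1 j')//= ltnSn addrC; congr (_ + _).
    rewrite [RHS](bigD1 j')//= ltnn add0r; apply: eq_bigr => i ij.
    by rewrite ltnS leq_eqVlt; move: ij; rewrite -val_eqE/= => /negPf ->.
  + exact: measurable_increment (ltW st) tT.
  + by move=> E A gE mA; exact: (@gen_independent j').
  + by rewrite sqrtr_gt0 subr_gt0.
apply: etrans (EV m (leqnn m)); apply: eq_integral => w _; congr (EFin (_ * expR _)).
under [RHS]eq_bigr do rewrite ltn_ord.
rewrite big_split/= sumrN -mulr_sumr -mulr_suml /dotv !mxE; congr (_ - _ * _).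
  by apply: eq_bigr => i _; rewrite mxE.
rewrite sg2; congr (_ * _); apply: eq_bigr => i _.
by rewrite mxE expr2.
Qed.

End exponential_step.

(** Sorted grids may repeat points, so steps of length zero have to be covered. *)
Lemma expectation_exponential_increment_le (s t : R) (W : Omega -> R)
    (c : Omega -> 'cV[R]_m) : 0 <= s -> s <= t -> t <= T ->
  sigma_measurable (Ft s) W -> (forall w, 0 <= W w) ->
  (forall i, sigma_measurable (Ft s) (fun w => c w i 0)) ->
  (\int[P]_w (W w * expR (dotv (c w) (B t w - B s w)
       - 2^-1 * (dotv (c w) (c w) * (t - s))))%:E = \int[P]_w (W w)%:E)%E.
Proof.
move=> s0; rewrite le_eqVlt => /predU1P[<- _ _ _ _|st tT mW W0 mc]; last first.
  exact: expectation_exponential_increment.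
apply: eq_integral => w _.
by rewrite !subrr !mulr0 subr0 /dotv mulmx0 mxE expR0 mulr1.
Qed.

End filtration.

(** * Uniform integrability and entropy *)

Section cvg_lattice.
Context {R : realType}.
Implicit Types (u v : nat -> R) (a b : R).

Lemma cvgn_max u v a b : u @ \oo --> a -> v @ \oo --> b ->
  (fun n => Num.max (u n) (v n)) @ \oo --> Num.max a b.
Proof.
move=> ua vb; under eq_fun do rewrite maxr_absE; rewrite maxr_absE.
apply: cvgM; last exact: cvg_cst.
apply: cvgD; first exact: cvgD.
by apply: cvg_norm; exact: cvgB.
Qed.

Lemma cvgn_min u v a b : u @ \oo --> a -> v @ \oo --> b ->
  (fun n => Num.min (u n) (v n)) @ \oo --> Num.min a b.
Proof.
move=> ua vb; under eq_fun do rewrite minr_absE; rewrite minr_absE.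
apply: cvgM; last exact: cvg_cst.
apply: cvgB; first exact: cvgD.
by apply: cvg_norm; exact: cvgB.
Qed.

End cvg_lattice.

Section uniform_integrability.
Context d (T : measurableType d) (R : realType) (P : probability T R).
Implicit Types X W : T -> R.

Lemma le_integral_ae_cvg (X_ : nat -> T -> R) X (M : \bar R) :
  (forall n, measurable_fun setT (X_ n)) -> measurable_fun setT X ->
  (forall n w, 0 <= X_ n w) -> (forall w, 0 <= X w) ->
  {ae P, forall w, X_ ^~ w @ \oo --> X w} ->
  (forall n, \int[P]_w (X_ n w)%:E <= M)%E ->
  (\int[P]_w (X w)%:E <= M)%E.
Proof.
move=> mX_ mX X_0 X0 cX leM.
have mE n : measurable_fun setT (fun w => (X_ n w)%:E) by exact/measurable_EFinP.
have E0 n w : setT w -> (0 <= (X_ n w)%:E)%E by rewrite lee_fin.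
have -> : (\int[P]_w (X w)%:E = \int[P]_w limn_einf (fun n => (X_ n w)%:E))%E.
  apply: ae_eq_integral => //; first exact/measurable_EFinP.
    rewrite (_ : (fun w => _) = (fun w => - limn_esup (fun n => (- X_ n w)%:E))%E)//.
    apply: measurableT_comp => //; apply: measurable_fun_limn_esup => n.
    by apply/measurable_EFinP; exact: measurableT_comp.
  apply: filterS cX => w cXw _; apply/esym.
  have cE : (fun n => (X_ n w)%:E) @ \oo --> (X w)%:E.
    by apply: cvg_EFin => //; exact: nearW.
  by have [] := cvg_limn_einf_sup cE.
apply: le_trans (fatou P measurableT mE E0) _.
rewrite limn_einf_lim; apply: lime_le.
  exact: is_cvg_einfs.
apply: nearW => n; apply: le_trans (leM n).
by apply: ereal_inf_lbound; exists n => /=.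
Qed.

Lemma integrable_bounded X (K : R) : measurable_fun setT X ->
  (forall w, `|X w| <= K) -> P.-integrable setT (EFin \o X).
Proof.
move=> mX XK; apply: measurable_bounded_integrable => //.
  by rewrite (le_lt_trans (probability_le1 _ _))// ltry.
exists K; split; first exact: num_real.
by move=> x Kx w _ /=; rewrite (le_trans (XK w))// ltW.
Qed.

Lemma integrable_ge0 X (K : R) : measurable_fun setT X ->
  (forall w, 0 <= X w) -> (\int[P]_w (X w)%:E <= K%:E)%E ->
  P.-integrable setT (EFin \o X) /\ \int[P]_w X w <= K.
Proof.
move=> mX X0 XK; have iX : P.-integrable setT (EFin \o X).
  apply/integrableP; split; first exact/measurable_EFinP.
  under eq_integral do rewrite /= ger0_norm//.
  by rewrite (le_lt_trans XK)// ltry.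
split=> //; rewrite -lee_fin /Rintegral fineK//.
exact: integrable_fin_num.
Qed.

Lemma min_maxB (x c : R) : x = Num.min x c + Num.max (x - c) 0.
Proof.
have [xc|cx] := leP x c.
  by rewrite max_r ?subr_le0// addr0.
by rewrite max_l ?subr_ge0 ?(ltW cx)// subrKC.
Qed.

(** Uniform integrability of nonnegative variables, with [(x - c)^+] in place of the tail restricted
    to [x > c]: this is continuous in [x], so the bound survives almost sure limits, and it
    complements [min(x, c)]. *)
Definition asymptotically_uniform (X_ : nat -> T -> R) := forall e : R, 0 < e ->
  exists2 c : R, 0 < c & forall n,
    (\int[P]_w (Num.max (X_ n w - c) 0)%:E <= e%:E)%E.

(** Vitali's theorem with a bounded weight. Split each variable into [min(x, c)], to which dominated
    convergence applies, and [(x - c)^+], which is uniformly small. *)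
Lemma cvg_expectation (X_ : nat -> T -> R) X :
  (forall n, measurable_fun setT (X_ n)) -> measurable_fun setT X ->
  (forall n w, 0 <= X_ n w) -> (forall w, 0 <= X w) ->
  {ae P, forall w, X_ ^~ w @ \oo --> X w} -> asymptotically_uniform X_ ->
  P.-integrable setT (EFin \o X) /\
  forall W C, measurable_fun setT W -> (forall w, 0 <= W w <= C) ->
    (fun n => \int[P]_w (W w * X_ n w)) @ \oo --> \int[P]_w (W w * X w).
Proof.
move=> mX_ mX X_0 X0 cX uX.
have mmax (Z : T -> R) c : measurable_fun setT Z ->
    measurable_fun setT (fun w => Num.max (Z w - c) 0).
  move=> mZ; apply: (@measurable_maxr _ _ _ _ (fun w => Z w - c) (cst 0)) => //.
  exact: measurable_funB.
have mmin (Z : T -> R) c : measurable_fun setT Z ->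
    measurable_fun setT (fun w => Num.min (Z w) c).
  by move=> mZ; apply: (@measurable_minr _ _ _ _ Z (cst c)).
have max0 (x : R) : 0 <= Num.max x 0 by rewrite le_max lexx orbT.
(* By Fatou the limit inherits the tail bound with the same [c] and [e]. *)
have maxlim e c : 0 < c -> (forall n,
    (\int[P]_w (Num.max (X_ n w - c) 0)%:E <= e%:E)%E) ->
    (\int[P]_w (Num.max (X w - c) 0)%:E <= e%:E)%E.
  move=> c0 He; apply: (@le_integral_ae_cvg (fun n w => Num.max (X_ n w - c) 0)) => //.
  - by move=> n; exact: mmax.
  - exact: mmax.
  - apply: filterS cX => w cw.
    apply: cvgn_max; last exact: cvg_cst.
    by apply: cvgB => //; exact: cvg_cst.
have minb (c x : R) : 0 < c -> 0 <= x -> `|Num.min x c| <= c.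
  move=> c0 x0; have h : 0 <= Num.min x c by rewrite le_min x0 ltW.
  by rewrite ger0_norm// ge_min lexx orbT.
have imin (Z : T -> R) c : 0 < c -> measurable_fun setT Z -> (forall w, 0 <= Z w) ->
    P.-integrable setT (EFin \o (fun w => Num.min (Z w) c)).
  move=> c0 mZ Z0; apply: (@integrable_bounded _ c); first exact: mmin.
  by move=> w; exact: minb.
have split_int (Z : T -> R) c e : 0 < c -> measurable_fun setT Z -> (forall w, 0 <= Z w) ->
    (\int[P]_w (Num.max (Z w - c) 0)%:E <= e%:E)%E ->
    P.-integrable setT (EFin \o Z) /\ forall W C, measurable_fun setT W ->
      (forall w, 0 <= W w <= C) ->
      `| \int[P]_w (W w * Z w) - \int[P]_w (W w * Num.min (Z w) c)| <= C * e.
  move=> c0 mZ Z0 Ze.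
  have [imax lemax] := integrable_ge0 (mmax _ c mZ) (fun w => max0 _) Ze.
  split.
    rewrite (_ : EFin \o Z = ((EFin \o (fun w => Num.min (Z w) c)) \+
        (EFin \o (fun w => Num.max (Z w - c) 0)%R))%E).
      by apply: integrableD => //; exact: imin.
    by apply/funext => w /=; rewrite -EFinD -min_maxB.
  move=> W C mW WC.
  have C0 : 0 <= C by have /andP[h1 h2] := WC point; exact: le_trans h1 h2.
  have iWmin : P.-integrable setT (EFin \o (fun w => W w * Num.min (Z w) c)).
    apply: (@integrable_bounded _ (C * c)).
      by apply: measurable_funM => //; exact: mmin.
    move=> w; have /andP[h1 h2] := WC w; rewrite normrM ler_pM//.
      by rewrite ger0_norm.
    exact: minb.
  have iWmax : P.-integrable setT (EFin \o (fun w => W w * Num.max (Z w - c) 0)).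
    apply: (@le_integrable _ _ _ P setT measurableT _
        (fun w => C%:E * (EFin \o (fun w => Num.max (Z w - c) 0)%R) w)%E).
    - by apply/measurable_EFinP; apply: measurable_funM => //; exact: mmax.
    - move=> w _ /=; rewrite lee_fin !normrM.
      have /andP[h1 h2] := WC w; rewrite (ger0_norm h1) (ger0_norm C0).
      by apply: ler_wpM2r.
    - exact: integrableZl.
  have -> : \int[P]_w (W w * Z w) =
      \int[P]_w (W w * Num.min (Z w) c) + \int[P]_w (W w * Num.max (Z w - c) 0).
    rewrite -RintegralD//; apply: eq_Rintegral => w _.
    by rewrite -mulrDr -min_maxB.
  rewrite addrAC subrr add0r ger0_norm; last first.
    apply: Rintegral_ge0 => w _; have /andP[h1 h2] := WC w; exact: mulr_ge0.
  apply: (@le_trans _ _ (\int[P]_w (C * Num.max (Z w - c) 0))).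
    apply: le_Rintegral => //; first exact: (integrableZl measurableT C imax).
    by move=> w _; have /andP[h1 h2] := WC w; exact: ler_wpM2r.
  by rewrite RintegralZl//; exact: ler_wpM2l.
have [iX _] : P.-integrable setT (EFin \o X) /\ True.
  have [c c0 Hc] := uX 1 ltr01.
  by have [] := split_int X c 1 c0 mX X0 (maxlim _ _ c0 Hc).
split=> // W C mW WC.
have C0 : 0 <= C by have /andP[h1 h2] := WC point; exact: le_trans h1 h2.
apply/cvgrPdist_le => e e0.
(* A third of [e] for each tail and one for the truncated part; the weight multiplies a tail by at
   most [C], and [C + 1] avoids a division by zero. *)
have e10 : 0 < e / 3 / (C + 1).
  by rewrite !divr_gt0// ltr_wpDl.
have [c c0 Hc] := uX _ e10.
have Ce : C * (e / 3 / (C + 1)) <= e / 3.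
  rewrite mulrCA ler_piMr ?divr_ge0 ?(ltW e0)//.
  by rewrite ler_pdivrMr ?mul1r ?lerDl// ltr_wpDl.
have [_ HX] := split_int X c _ c0 mX X0 (maxlim _ _ c0 Hc).
have {HX} HX := le_trans (HX W C mW WC) Ce.
have dom : (fun n => \int[P]_w (W w * Num.min (X_ n w) c)) @ \oo -->
    \int[P]_w (W w * Num.min (X w) c).
  have mWm (Z : T -> R) : measurable_fun setT Z ->
      measurable_fun setT (EFin \o (fun w => W w * Num.min (Z w) c)).
    by move=> mZ; apply/measurable_EFinP/measurable_funM => //; exact: mmin.
  have h1 : {ae P, forall w, setT w ->
      (fun n => (EFin \o (fun w => W w * Num.min (X_ n w) c)) w) @ \oo -->
      (EFin \o (fun w => W w * Num.min (X w) c)) w}.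
    apply: filterS cX => w cw _; apply: cvg_EFin; first exact: nearW.
    apply: cvgM; first exact: cvg_cst.
    by apply: cvgn_min => //; exact: cvg_cst.
  have h2 : P.-integrable setT (fun=> (C * c)%:E).
    exact: finite_measure_integrable_cst.
  have h3 : {ae P, forall w n, setT w ->
      (`|(EFin \o (fun w => W w * Num.min (X_ n w) c)%R) w| <= (C * c)%:E)%E}.
    apply: aeW => w n _ /=; have /andP[? ?] := WC w.
    rewrite lee_fin normrM ler_pM//; first by rewrite ger0_norm.
    exact: minb.
  have [iL _ cL] := dominated_convergence measurableT
    (fun n => mWm _ (mX_ n)) (mWm _ mX) h1 h2 h3.
  by apply: fine_cvg; rewrite fineK//; exact: integrable_fin_num.
have e30 : 0 < e / 3 by rewrite divr_gt0.
move/cvgrPdist_le : dom => /(_ _ e30); apply: filterS => n Hn.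
have [_ HXn] := split_int (X_ n) c _ c0 (mX_ n) (X_0 n) (Hc n).
have {HXn} HXn := le_trans (HXn W C mW WC) Ce.
rewrite distrC in HXn.
set a := \int[P]_w (W w * X w) in HX *; set b := \int[P]_w (W w * X_ n w) in HXn *.
move: HX Hn HXn; rewrite !ler_norml => /andP[? ?] /andP[? ?] /andP[? ?].
by apply/andP; split; lra.
Qed.

(** Here [(x - c)^+ <= x^2 / c], so [c] of order [M / e] suffices; the absolute value and the added
    1 make [c] positive whatever the sign of [M]. *)
Lemma asymptotically_uniform_sqr (X_ : nat -> T -> R) (M : R) :
  (forall n, measurable_fun setT (X_ n)) -> (forall n w, 0 <= X_ n w) ->
  (forall n, \int[P]_w (X_ n w ^+ 2)%:E <= M%:E)%E -> asymptotically_uniform X_.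
Proof.
move=> mX X0 XM e e0; pose c := `|M| / e + 1.
have c0 : 0 < c by rewrite ltr_wpDl// divr_ge0// ltW.
exists c => // n.
have mX2 : measurable_fun setT (fun w => (X_ n w ^+ 2)%:E).
  by apply/measurable_EFinP; exact: measurable_funX.
apply: (@le_trans _ _ (\int[P]_w ((c^-1)%:E * (X_ n w ^+ 2)%:E))%E).
  apply: ge0_le_integral => //.
  - by move=> w _; rewrite lee_fin le_max lexx orbT.
  - apply/measurable_EFinP.
    apply: (@measurable_maxr _ _ _ _ (fun w => X_ n w - c) (cst 0)) => //.
    exact: measurable_funB.
  - by apply: measurable_funeM.
  - move=> w _; rewrite -EFinM lee_fin ge_max mulr_ge0 ?sqr_ge0 ?invr_ge0 ?(ltW c0)// andbT.
    rewrite -subr_ge0 -(pmulr_rge0 _ c0) mulrBr mulVKf ?gt_eqF//.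
    have := X0 n w; nra.
rewrite ge0_integralZl//.
- apply: (@le_trans _ _ ((c^-1)%:E * M%:E)%E).
    by apply: lee_wpmul2l => //; rewrite lee_fin invr_ge0 ltW.
  rewrite -EFinM lee_fin ler_pdivrMl// mulrC.
  apply: (le_trans (ler_norm M)); rewrite /c mulrDr mulr1 mulrC divfK ?gt_eqF//.
  by rewrite lerDl ltW.
- by move=> w _; rewrite lee_fin sqr_ge0.
- by rewrite lee_fin invr_ge0 ltW.
Qed.

Lemma entropy_ge (u : R) : expR u - 1 <= expR u * u.
Proof.
have := expR_ge1Dx (- u); rewrite -(ler_pM2l (expR_gt0 u)) expRN.
by rewrite mulfV ?gt_eqF ?expR_gt0// => h; lra.
Qed.

(** This is [1 + (y - u) <= e^(y - u)] multiplied by [e^u]. *)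
Lemma entropy_young (u y : R) : expR u * y <= expR u * u - expR u + expR y.
Proof.
have := expR_ge1Dx (y - u); rewrite -(ler_pM2l (expR_gt0 u)) -expRD.
by rewrite subrKC => h; lra.
Qed.

(** The shift by 1 makes the entropy density nonnegative, so that its extended integral is monotone
    and Fatou applies; every entropy bound below is stated for the shifted density. *)
Lemma entropy1_ge0 (u : R) : 0 <= expR u * u + 1.
Proof. by have := entropy_ge u; have := expR_ge0 u; lra. Qed.

Lemma expR_le_entropy (k u : R) : 0 < k -> k <= u ->
  expR u <= k^-1 * (expR u * u + 1).
Proof.
move=> k0 ku; rewrite -subr_ge0 -(pmulr_rge0 _ k0) mulrBr mulVKf ?gt_eqF//.
have := expR_ge0 u; nra.
Qed.

(** [k] is the level above which [e^u <= (u e^u + 1) / k]; this lemma is the common right-hand side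
    of the two uniform integrability criteria that follow. *)
Lemma integral_entropy_tail (U : T -> R) (M e : R) (k := `|M| / e + 1) :
  0 < e -> measurable_fun setT U ->
  (\int[P]_w (expR (U w) * U w + 1)%:E <= M%:E)%E ->
  (\int[P]_w (k^-1 * (expR (U w) * U w + 1))%:E <= e%:E)%E.
Proof.
move=> e0 mU UM.
have k0 : 0 < k by rewrite ltr_wpDl// divr_ge0// ltW.
under eq_integral do rewrite EFinM.
rewrite ge0_integralZl//.
- apply: (@le_trans _ _ ((k^-1)%:E * M%:E)%E).
    by apply: lee_wpmul2l => //; rewrite lee_fin invr_ge0 ltW.
  rewrite -EFinM lee_fin ler_pdivrMl// mulrC.
  apply: (le_trans (ler_norm M)); rewrite /k mulrDr mulr1 mulrC divfK ?gt_eqF//.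
  by rewrite lerDl ltW.
- apply/measurable_EFinP/measurable_funD => //.
  by apply: measurable_funM => //; exact: measurableT_comp.
- by move=> w _; rewrite lee_fin entropy1_ge0.
- by rewrite lee_fin invr_ge0 ltW.
Qed.

Lemma asymptotically_uniform_entropy (U : nat -> T -> R) (M : R) :
  (forall n, measurable_fun setT (U n)) ->
  (forall n, \int[P]_w (expR (U n w) * U n w + 1)%:E <= M%:E)%E ->
  asymptotically_uniform (fun n w => expR (U n w)).
Proof.
move=> mU UM e e0; have k0 : 0 < `|M| / e + 1.
  by rewrite ltr_wpDl// divr_ge0// ltW.
exists (expR (`|M| / e + 1)); first exact: expR_gt0.
move=> n; apply: le_trans (integral_entropy_tail e0 (mU n) (UM n)).
have mE : measurable_fun setT (fun w => expR (U n w)) by exact: measurableT_comp.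
apply: ge0_le_integral => //.
- apply/measurable_EFinP.
  apply: (@measurable_maxr _ _ _ _ (fun w => expR (U n w) - _) (cst 0)) => //.
  exact: measurable_funB.
- apply/measurable_EFinP/measurable_funM => //; apply: measurable_funD => //.
  exact: measurable_funM.
- move=> w _; rewrite lee_fin ge_max mulr_ge0 ?invr_ge0 ?(ltW k0) ?entropy1_ge0// andbT.
  have [uk|ku] := leP (U n w) (`|M| / e + 1).
    apply: (@le_trans _ _ 0); first by rewrite subr_le0 ler_expR.
    by rewrite mulr_ge0 ?invr_ge0 ?(ltW k0) ?entropy1_ge0.
  apply: le_trans (expR_le_entropy k0 (ltW ku)).
  by rewrite gerBl expR_ge0.
Qed.

(** De la Vallee-Poussin's criterion for the function [x ln x]. *)
Lemma uniformly_integrable_entropy (S : set (T -> R)) (M : R) :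
  (forall x, S x -> exists U, [/\ x = (fun w => expR (U w)),
     measurable_fun setT U &
     (\int[P]_w (expR (U w) * U w + 1)%:E <= M%:E)%E]) ->
  uniformly_integrable P S.
Proof.
move=> SU; split=> [x /SU[U [-> mU _]]|e e0]; first exact: measurableT_comp.
have k0 : 0 < `|M| / e + 1 by rewrite ltr_wpDl// divr_ge0// ltW.
exists (expR (`|M| / e + 1)) => _ /SU[U [-> mU UM]].
apply: le_trans (integral_entropy_tail e0 mU UM).
have mE : measurable_fun setT (fun w => expR (U w)) by exact: measurableT_comp.
have mA : measurable [set w | expR (`|M| / e + 1) < `|expR (U w)|].
  rewrite (_ : [set w | _] = (fun w => expR (U w)) @^-1` `]expR (`|M| / e + 1), +oo[).
    by rewrite -[X in measurable X]setTI; exact: mE.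
  by apply/seteqP; split=> w /=; rewrite in_itv/= andbT (ger0_norm (expR_ge0 _)).
have mr : measurable_fun setT (fun w => (`|M| / e + 1)^-1 * (expR (U w) * U w + 1)).
  by apply: measurable_funM => //; apply: measurable_funD => //; exact: measurable_funM.
rewrite integral_mkcond; apply: ge0_le_integral => //.
- by move=> w _; rewrite patchE; case: ifP.
- apply/(measurable_restrictT _ _).1 => //.
  apply: measurable_funTS; apply/measurable_EFinP; exact: measurableT_comp.
- exact/measurable_EFinP.
- move=> w _; rewrite patchE; case: ifPn; last first.
    by rewrite lee_fin mulr_ge0 ?invr_ge0 ?(ltW k0) ?entropy1_ge0.
  rewrite inE/= (ger0_norm (expR_ge0 _)) ltr_expR => ku.
  by rewrite lee_fin expR_le_entropy// ltW.
Qed.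

End uniform_integrability.

Section euclidean_facts.
Context {R : realType} {n : nat}.
Implicit Types u v w : 'cV[R]_n.

Lemma dotvE u v : dotv u v = \sum_i u i 0 * v i 0.
Proof. by rewrite /dotv !mxE; apply: eq_bigr => i _; rewrite mxE. Qed.

Lemma dotvC u v : dotv u v = dotv v u.
Proof. by rewrite !dotvE; apply: eq_bigr => i _; rewrite mulrC. Qed.

Lemma dotvDl u v w : dotv (u + v) w = dotv u w + dotv v w.
Proof.
by rewrite !dotvE -big_split/=; apply: eq_bigr => i _; rewrite mxE mulrDl.
Qed.

Lemma dotvDr u v w : dotv w (u + v) = dotv w u + dotv w v.
Proof. by rewrite dotvC dotvDl !(dotvC w). Qed.

Lemma dotvZl a u v : dotv (a *: u) v = a * dotv u v.
Proof.
by rewrite !dotvE mulr_sumr; apply: eq_bigr => i _; rewrite mxE mulrA.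
Qed.

Lemma dotvZr a u v : dotv u (a *: v) = a * dotv u v.
Proof. by rewrite dotvC dotvZl dotvC. Qed.

Lemma dotvNl u v : dotv (- u) v = - dotv u v.
Proof. by rewrite -scaleN1r dotvZl mulN1r. Qed.

Lemma dotvBl u v w : dotv (u - v) w = dotv u w - dotv v w.
Proof. by rewrite dotvDl dotvNl. Qed.

Lemma dotvBr u v w : dotv w (u - v) = dotv w u - dotv w v.
Proof. by rewrite dotvC dotvBl !(dotvC w). Qed.

Lemma dotv0l v : dotv 0 v = 0.
Proof. by rewrite dotvE big1// => i _; rewrite mxE mul0r. Qed.

Lemma dotv0r v : dotv v 0 = 0.
Proof. by rewrite dotvC dotv0l. Qed.

Lemma dotv_ge0 u : 0 <= dotv u u.
Proof. by rewrite dotvE sumr_ge0// => i _; rewrite -expr2 sqr_ge0. Qed.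

Lemma enorm_sqr u : enorm u ^+ 2 = dotv u u.
Proof. by rewrite /enorm sqr_sqrtr// dotv_ge0. Qed.

Lemma enorm_ge0 u : 0 <= enorm u.
Proof. exact: sqrtr_ge0. Qed.

(** Expand [|u - e v|^2 >= 0] and divide by [e]. A small [e] keeps the factor of [v] close to 1, as
    comparing brackets of nearby integrands requires. *)
Lemma dotv_young (e : R) u v : 0 < e ->
  dotv (u + v) (u + v) <= (1 + e^-1) * dotv u u + (1 + e) * dotv v v.
Proof.
move=> e0; have := dotv_ge0 (u - e *: v).
rewrite !(dotvBl, dotvBr) !(dotvZl, dotvZr) !(dotvDl, dotvDr) (dotvC v u) => h.
rewrite -subr_ge0 -(pmulr_rge0 _ e0).
have -> : e * ((1 + e^-1) * dotv u u + (1 + e) * dotv v v -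
  (dotv u u + dotv u v + (dotv u v + dotv v v))) =
  dotv u u - e * dotv u v - e * (dotv u v - e * dotv v v).
  by field; rewrite gt_eqF.
by lra.
Qed.

Lemma dotv_young2 u v :
  dotv (u + v) (u + v) <= 2 * dotv u u + 2 * dotv v v.
Proof. by have := dotv_young u v ltr01; rewrite invr1. Qed.

End euclidean_facts.

Section sigma_measurable_algebra.
Context {d} {Omega : measurableType d} {R : realType}.
Variable G : set (set Omega).
Local Notation sm X := (sigma_measurable <<s G>> X).
Local Notation GT := (g_sigma_algebraType G).
Implicit Types X Y : Omega -> R.

Lemma gsigma_measurableP X : sm X <-> measurable_fun setT (X : GT -> R).
Proof.
split=> mX; first by move=> _ A mA; rewrite setTI; exact: mX.
by move=> A mA; have := mX measurableT A mA; rewrite setTI.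
Qed.

Lemma eq_sigma_measurable Y X : X =1 Y -> sm Y -> sm X.
Proof. by move=> /funext ->. Qed.

Lemma sigma_measurable_cst (c : R) : sm (fun=> c).
Proof. by apply/gsigma_measurableP; exact: measurable_cst. Qed.

Lemma sigma_measurable_comp (f : R -> R) X : measurable_fun setT f -> sm X ->
  sm (fun w => f (X w)).
Proof.
by move=> mf /gsigma_measurableP mX; apply/gsigma_measurableP; exact: measurableT_comp.
Qed.

Lemma sigma_measurableD X Y : sm X -> sm Y -> sm (fun w => X w + Y w).
Proof.
move=> /gsigma_measurableP mX /gsigma_measurableP mY.
by apply/gsigma_measurableP; exact: measurable_funD.
Qed.

Lemma sigma_measurableB X Y : sm X -> sm Y -> sm (fun w => X w - Y w).
Proof.
move=> /gsigma_measurableP mX /gsigma_measurableP mY.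
by apply/gsigma_measurableP; exact: measurable_funB.
Qed.

Lemma sigma_measurableM X Y : sm X -> sm Y -> sm (fun w => X w * Y w).
Proof.
move=> /gsigma_measurableP mX /gsigma_measurableP mY.
by apply/gsigma_measurableP; exact: measurable_funM.
Qed.

Lemma sigma_measurable_sum (I : Type) (r : seq I) (F : I -> Omega -> R) :
  (forall i, sm (F i)) -> sm (fun w => \sum_(i <- r) F i w).
Proof.
move=> mF; apply/gsigma_measurableP; apply: measurable_sum => i.
exact/gsigma_measurableP.
Qed.

Lemma sigma_measurable_indic E : <<s G>> E -> sm (\1_E : Omega -> R).
Proof.
move=> GE; apply/gsigma_measurableP.
exact: (@measurable_indic _ GT).
Qed.

Lemma sigma_measurable_dotv n (u v : Omega -> 'cV[R]_n) :
  (forall j, sm (fun w => u w j 0)) -> (forall j, sm (fun w => v w j 0)) ->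
  sm (fun w => dotv (u w) (v w)).
Proof.
move=> mu mv.
apply: (@eq_sigma_measurable (fun w => \sum_j u w j 0 * v w j 0)).
  by move=> w; rewrite dotvE.
by apply: sigma_measurable_sum => j; exact: sigma_measurableM.
Qed.

End sigma_measurable_algebra.

(** * Exponential martingales along a deterministic grid *)

Section grid_martingale.
Context d (Omega : measurableType d) (R : realType) (P : probability Omega R).
Hypothesis P_complete : measure_is_complete P.
Context (m : nat) (T : R) (B : R -> Omega -> 'cV[R]_m).
Hypothesis B_bm : brownian_motion P T B.
Local Notation Ft := (augmented_filtration P B).
Local Notation Fgen t :=
  (natural_sigma B t `|` [set N | P.-negligible N]).

Lemma sigma_measurable_path t u i : 0 <= u -> u <= t ->
  sigma_measurable (Ft t) (fun w => B u w i 0).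
Proof.
move=> u0 ut A mA; apply: sub_sigma_algebra; left; apply: sub_sigma_algebra.
by exists u, i, A; rewrite u0 ut.
Qed.

Variables (ts : nat -> R) (ts_nd : {homo ts : i j / (i <= j)%N >-> i <= j}).
Hypothesis ts_itv : forall i, 0 <= ts i <= T.

Definition grid_log (eta : nat -> Omega -> 'cV[R]_m) (n : nat) (w : Omega) : R :=
  \sum_(i < n) (dotv (eta i w) (B (ts i.+1) w - B (ts i) w)
    - 2^-1 * (dotv (eta i w) (eta i w) * (ts i.+1 - ts i))).

Variable eta : nat -> Omega -> 'cV[R]_m.
Hypothesis eta_meas : forall i j,
  sigma_measurable (Ft (ts i)) (fun w => eta i w j 0).

Lemma sigma_measurable_grid_log n k : (n <= k)%N ->
  sigma_measurable (Ft (ts k)) (grid_log eta n).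
Proof.
move=> nk; apply: sigma_measurable_sum => i.
have ik : (i < k)%N by exact: leq_trans (ltn_ord i) nk.
have meta j : sigma_measurable (Ft (ts k)) (fun w => eta i w j 0).
  apply: (@sigma_measurable_le _ _ _ P _ B (ts i)) => //; exact/ts_nd/ltnW.
have mB l j : (l <= k)%N -> sigma_measurable (Ft (ts k)) (fun w => B (ts l) w j 0).
  by move=> lk; apply: sigma_measurable_path; [have /andP[] := ts_itv l|exact: ts_nd].
apply: sigma_measurableB; last first.
  apply: sigma_measurableM; first exact: sigma_measurable_cst.
  apply: sigma_measurableM; last exact: sigma_measurable_cst.
  exact: sigma_measurable_dotv.
apply: sigma_measurable_dotv => // j.
apply: (@eq_sigma_measurable _ _ _ _ (fun w => B (ts i.+1) w j 0 - B (ts i) w j 0)).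
  by move=> w; rewrite !mxE.
by apply: sigma_measurableB; apply: mB => //; exact: ltnW.
Qed.

(** Martingale property in weak form: every factor after index [k] has conditional mean 1, and the
    factors are removed from the last one backwards. *)
Lemma expectation_grid_exp (W : Omega -> R) k n : (k <= n)%N ->
  sigma_measurable (Ft (ts k)) W -> (forall w, 0 <= W w) ->
  (\int[P]_w (W w * expR (grid_log eta n w))%:E =
   \int[P]_w (W w * expR (grid_log eta k w))%:E)%E.
Proof.
move=> kn mW W0; elim: n kn => [|n IH]; first by rewrite leqn0 => /eqP ->.
rewrite leq_eqVlt => /predU1P[-> //|kn]; apply: etrans (IH kn).
have /andP[t0 tT] := ts_itv n; have /andP[t0' tT'] := ts_itv n.+1.
have mWn : sigma_measurable (Ft (ts n)) (fun w => W w * expR (grid_log eta n w)).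
  apply: sigma_measurableM.
    by apply: (@sigma_measurable_le _ _ _ P _ B (ts k)) => //; exact: ts_nd.
  apply: sigma_measurable_comp; first exact: measurable_expR.
  exact: sigma_measurable_grid_log.
rewrite -(expectation_exponential_increment_le P_complete B_bm t0
  (ts_nd (leqnSn n)) tT' mWn _ (@eta_meas n)); last first.
  by move=> w; rewrite mulr_ge0// expR_ge0.
apply: eq_integral => w _; congr EFin.
by rewrite -mulrA -expRD /grid_log big_ord_recr.
Qed.

End grid_martingale.

Section grid_martingale_L2.
Context d (Omega : measurableType d) (R : realType) (P : probability Omega R).
Hypothesis P_complete : measure_is_complete P.
Context (m : nat) (T : R) (B : R -> Omega -> 'cV[R]_m).
Hypothesis B_bm : brownian_motion P T B.
Local Notation Ft := (augmented_filtration P B).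
Variables (ts : nat -> R) (ts_nd : {homo ts : i j / (i <= j)%N >-> i <= j}).
Hypothesis ts_itv : forall i, 0 <= ts i <= T.
Variable eta : nat -> Omega -> 'cV[R]_m.
Hypothesis eta_meas : forall i j,
  sigma_measurable (Ft (ts i)) (fun w => eta i w j 0).

(** The square of the exponential of [eta] is the exponential of [2 eta], of mean 1, times the
    exponential of the bracket of [eta], which is at most [e^M]. *)
Lemma expectation_grid_exp_sqr n (M : R) :
  (forall w, \sum_(i < n) dotv (eta i w) (eta i w) * (ts i.+1 - ts i) <= M) ->
  (\int[P]_w (expR (grid_log B ts eta n w) ^+ 2)%:E <= (expR M)%:E)%E.
Proof.
move=> leM; pose eta2 i w := 2 *: eta i w.
have meta2 i j : sigma_measurable (Ft (ts i)) (fun w => eta2 i w j 0).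
  apply: (@eq_sigma_measurable _ _ _ _ (fun w => 2 * eta i w j 0)).
    by move=> w; rewrite mxE.
  apply: (@sigma_measurableM _ _ _ _ (fun=> 2) (fun w => eta i w j 0)).
    exact: sigma_measurable_cst.
  exact: eta_meas.
have E2 : (\int[P]_w (expR (grid_log B ts eta2 n w))%:E = 1)%E.
  have := @expectation_grid_exp _ _ _ P P_complete _ T _ B_bm ts ts_nd ts_itv
    eta2 meta2 (cst 1) 0 n (leq0n n).
  under eq_integral do rewrite mul1r.
  move=> -> //; last exact: sigma_measurable_cst.
  under eq_integral do rewrite /grid_log big_ord0 expR0 mul1r.
  rewrite integral_cst// mul1e; exact: probability_setT.
have mlog : measurable_fun setT (grid_log B ts eta2 n).
  apply: (sigma_measurableW P_complete B_bm (t := ts n)).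
    by have /andP[] := ts_itv n.
  exact: (sigma_measurable_grid_log ts_nd ts_itv meta2).
have mlog1 : measurable_fun setT (grid_log B ts eta n).
  apply: (sigma_measurableW P_complete B_bm (t := ts n)).
    by have /andP[] := ts_itv n.
  exact: (sigma_measurable_grid_log ts_nd ts_itv eta_meas).
apply: (@le_trans _ _ (\int[P]_w ((expR M)%:E * (expR (grid_log B ts eta2 n w))%:E))%E).
  apply: ge0_le_integral => //.
  - by apply/measurable_EFinP/measurable_funX; exact: measurableT_comp.
  - by apply: measurable_funeM; apply/measurable_EFinP; exact: measurableT_comp.
  - move=> w _; rewrite -EFinM lee_fin -expRM_natl -expRD ler_expR.
    apply: le_trans (lerD (leM w) (lexx _)).
    rewrite /grid_log mulr_sumr -big_split/=; apply: ler_sum => i _.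
    rewrite /eta2 !(dotvZl, dotvZr); lra.
rewrite ge0_integralZl//.
- by rewrite E2 mule1.
- by apply/measurable_EFinP; exact: measurableT_comp.
Qed.

End grid_martingale_L2.

(** * Simple integrands on a grid *)

Section measurable_vectors.
Context {R : realType} {n : nat}.

Lemma measurable_dotv d (T : measurableType d) (D : set T) (f g : T -> 'cV[R]_n) :
  (forall i, measurable_fun D (fun x => f x i 0)) ->
  (forall i, measurable_fun D (fun x => g x i 0)) ->
  measurable_fun D (fun x => dotv (f x) (g x)).
Proof.
move=> mf mg; rewrite (_ : (fun x => _) = fun x => \sum_i f x i 0 * g x i 0).
  by apply: measurable_sum => i; exact: measurable_funM.
by apply/funext => x; rewrite dotvE.
Qed.

Lemma measurable_enorm_sqr d (T : measurableType d) (D : set T) (f : T -> 'cV[R]_n) :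
  (forall i, measurable_fun D (fun x => f x i 0)) ->
  measurable_fun D (fun x => enorm (f x) ^+ 2).
Proof.
move=> mf; rewrite (_ : (fun x => _) = fun x => dotv (f x) (f x)).
  exact: measurable_dotv.
by apply/funext => x; rewrite enorm_sqr.
Qed.

Lemma measurable_simple_val d (Omega : measurableType d)
    (S : @simple_integrand _ Omega R n) w i :
  measurable_fun setT (fun u : R => simple_val S u w i 0).
Proof.
elim: S => [|p S IH].
  rewrite (_ : (fun u => _) = cst 0); first exact: measurable_cst.
  by apply/funext => u; rewrite /simple_val big_nil mxE.
rewrite (_ : (fun u => _) = (fun u => \1_(`]p.1.1, p.1.2]) u * p.2 w i 0) \+
    (fun u => simple_val S u w i 0)).
  apply: measurable_funD => //; apply: measurable_funM => //.
apply/funext => u /=; rewrite /simple_val big_cons mxE; congr (_ + _).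
rewrite indicE mem_setE in_itv/=; case: ifP => _; first by rewrite mul1r.
by rewrite mxE mul0r.
Qed.

End measurable_vectors.

Section grid.
Context {R : realType}.

(** Sort the points together with 0; the default value [T] of [nth] continues the list as a
    constant, so the infinite sequence remains nondecreasing and inside the interval. *)
Lemma grid_exists (T : R) (l : seq R) : 0 <= T ->
  (forall x, x \in l -> 0 <= x <= T) ->
  exists ts : nat -> R, [/\ {homo ts : i j / (i <= j)%N >-> i <= j},
    forall i, 0 <= ts i <= T, ts 0%N = 0 &
    forall x, x \in l -> exists j, ts j = x].
Proof.
move=> T0 lT; pose g := sort <=%R (0 :: l).
have gT x : x \in g -> 0 <= x <= T.
  by rewrite mem_sort inE => /predU1P[->|/lT//]; rewrite lexx.
have sg : sorted <=%R g by exact: sort_le_sorted.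
have szg : size g = (size l).+1 by rewrite size_sort.
have itv i : 0 <= nth T g i <= T.
  have [ig|gi] := ltnP i (size g); first by apply: gT; exact: mem_nth.
  by rewrite nth_default// T0 lexx.
have nd : {homo nth T g : i j / (i <= j)%N >-> i <= j}.
  move=> i j ij; have [jg|gj] := ltnP j (size g).
    apply: (sorted_leq_nth le_trans lexx T sg) => //.
    by rewrite inE (leq_ltn_trans ij).
  by rewrite (nth_default _ gj); have /andP[] := itv i.
exists (nth T g); split=> //.
  apply/le_anti/andP; split; last by have /andP[] := itv 0%N.
  have g0 : 0 \in g by rewrite mem_sort inE eqxx.
  by rewrite -(nth_index T g0); exact: nd.
move=> x xl; have xg : x \in g by rewrite mem_sort inE xl orbT.
by exists (index x g); rewrite nth_index.
Qed.

Variables (ts : nat -> R) (ts_nd : {homo ts : i j / (i <= j)%N >-> i <= j}).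

(** No grid point lies strictly inside a cell. This makes a simple integrand with endpoints on the
    grid constant on each cell. *)
Lemma grid_gap x i : (exists j, ts j = x) -> x <= ts i \/ ts i.+1 <= x.
Proof.
move=> [j <-]; have [ji|ij] := leqP j i; first by left; exact: ts_nd.
by right; exact: ts_nd.
Qed.

Context {d} {Omega : measurableType d} {m : nat}.
Implicit Type S : @simple_integrand _ Omega R m.

(** The constant value of [S] on the cell []ts i, ts i.+1]] once the grid contains its endpoints; it
    only involves variables known at [ts i]. *)
Definition step_coef S (i : nat) (w : Omega) : 'cV[R]_m :=
  \sum_(p <- S) if (p.1.1 <= ts i) && (ts i.+1 <= p.1.2) then p.2 w else 0.

Definition covers S := forall p, List.In p S ->
  [/\ 0 <= p.1.1, p.1.1 <= p.1.2,
      exists j, ts j = p.1.1 & exists j, ts j = p.1.2].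

Lemma simple_val_grid S i u w : covers S -> ts i < u <= ts i.+1 ->
  simple_val S u w = step_coef S i w.
Proof.
move=> + /andP[iu ui]; rewrite /simple_val /step_coef; elim: S => [|p S IH] cS.
  by rewrite !big_nil.
rewrite !big_cons IH; last by move=> p' H; apply: cS; right.
congr (_ + _); have [_ _ c1 c2] := cS p (or_introl erefl).
have -> : (p.1.1 < u) = (p.1.1 <= ts i).
  apply/idP/idP => [h|h]; last exact: le_lt_trans iu.
  by case: (grid_gap i c1) => // /(lt_le_trans (lt_le_trans h ui)); rewrite ltxx.
have -> // : (u <= p.1.2) = (ts i.+1 <= p.1.2).
apply/idP/idP => [h|h]; last exact: le_trans h.
by case: (grid_gap i c2) => // /(lt_le_trans (lt_le_trans iu h)); rewrite ltxx.
Qed.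

(** For one triple the increments over the cells inside its interval telescope to the increment over
    that interval cut at [ts j]; empty cells contribute nothing and are treated apart. *)
Lemma simple_int_grid (B : R -> Omega -> 'cV[R]_m) S j w : covers S -> ts 0%N = 0 ->
  simple_int B S (ts j) w =
  \sum_(i < j) dotv (step_coef S i w) (B (ts i.+1) w - B (ts i) w).
Proof.
move=> + ts0; rewrite /simple_int /step_coef; elim: S => [|p S IH] cS.
  by rewrite big_nil big1// => i _; rewrite big_nil dotv0l.
under [RHS]eq_bigr do rewrite big_cons dotvDl.
rewrite big_cons IH; last by move=> p' H; apply: cS; right.
rewrite big_split/=; congr (_ + _).
have [p0 pp c1 c2] := cS p (or_introl erefl).
elim: j {IH} => [|j IHj].
  rewrite big_ord0 ts0 !min_r// ?subrr ?dotv0r//; exact: le_trans pp.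
rewrite big_ord_recr/= -IHj.
have : ts j <= ts j.+1 by exact: ts_nd.
rewrite le_eqVlt => /predU1P[<-|tj].
  by rewrite subrr dotv0r addr0.
case: (grid_gap j c2) => h2.
  have h2' := le_trans h2 (ltW tj); have h1 := le_trans pp h2.
  have h1' := le_trans h1 (ltW tj).
  by rewrite !min_l// (lt_geF (le_lt_trans h2 tj)) andbF dotv0l addr0.
have h2' := le_trans (ltW tj) h2.
rewrite (min_r h2) (min_r h2') h2 andbT.
case: (grid_gap j c1) => h1.
  have h1' := le_trans h1 (ltW tj).
  by rewrite h1 (min_l h1) (min_l h1') -dotvDr [in RHS]addrC addrA subrK.
have h1' := le_trans (ltW tj) h1.
by rewrite (min_r h1) (min_r h1') (lt_geF (lt_le_trans tj h1)) !subrr dotv0r dotv0l addr0.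
Qed.

Lemma simple_bracket_grid S j w : covers S -> ts 0%N = 0 ->
  (\int[lebesgue_measure]_(u in `[0%R, ts j]) (enorm (simple_val S u w) ^+ 2)%:E =
   (\sum_(i < j) dotv (step_coef S i w) (step_coef S i w)
      * (ts i.+1 - ts i))%:E)%E.
Proof.
move=> cS ts0; elim: j => [|j IH].
  by rewrite big_ord0 ts0 set_itv1 integral_set1.
have t0 i : 0 <= ts i by rewrite -ts0; exact: ts_nd.
have tj : ts j <= ts j.+1 by exact: ts_nd.
have E : {in `]ts j, ts j.+1]%classic, forall u, (enorm (simple_val S u w) ^+ 2)%:E
    = (dotv (step_coef S j w) (step_coef S j w))%:E}.
  move=> u /set_mem /=; rewrite in_itv/= => uj.
  by rewrite (simple_val_grid _ cS uj) enorm_sqr.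
have mS D : measurable_fun D (fun u => (enorm (simple_val S u w) ^+ 2)%:E).
  apply/measurable_EFinP; apply: measurable_funTS.
  by apply: measurable_enorm_sqr => i; exact: measurable_simple_val.
rewrite big_ord_recr/= EFinD -IH.
have -> : `[0%R, ts j.+1]%classic = `[0, ts j] `|` `]ts j, ts j.+1].
  by rewrite -itv_bndbnd_setU// bnd_simp.
rewrite ge0_integral_setU//=.
- congr (_ + _)%E; rewrite (eq_integral (fun=> (dotv (step_coef S j w) (step_coef S j w))%:E))//.
  rewrite integral_cst//= lebesgue_measure_itv/= lte_fin.
  case: ifPn => [_|]; first by rewrite -EFinD -EFinM.
  rewrite -leNgt => /(conj tj)/andP/le_anti ->.
  by rewrite subrr mulr0 mule0.
- exact: mS.
- by move=> u _; rewrite lee_fin sqr_ge0.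
- rewrite disj_set2E; apply/eqP/seteqP; split=> // u [/=].
  by rewrite !in_itv/= => /andP[_ h1] /andP[/(le_lt_trans h1)]; rewrite ltxx.
Qed.

End grid.

(** * Continuous paths and brackets *)

Section path_continuity.
Context {R : realType}.
Implicit Types (T : R) (g : R -> R).

Definition seq_continuous T g := forall (v : nat -> R) x,
  (forall k, 0 <= v k <= T) -> 0 <= x <= T -> v @ \oo --> x ->
  (fun k => g (v k)) @ \oo --> g x.

Lemma within_seq_continuous T g :
  {within `[0, T], continuous g} -> seq_continuous T g.
Proof.
move=> /subspace_continuousP cg v x vT xT vx.
have xA : [set` `[0, T]] x by rewrite /= in_itv.
apply: (cvg_comp _ _ _ (cg x xA)).
move=> Q HQ; have := vx _ HQ; rewrite /nbhs/=; apply: filterS => k; apply.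
by rewrite /= in_itv/= vT.
Qed.

End path_continuity.

Section bracket.
Context {R : realType} {n : nat}.
Implicit Types (T t : R) (f g h : R -> 'cV[R]_n).
Local Notation mu := (@lebesgue_measure R).

Definition bracket h t : R :=
  (\int[mu]_(u in `[0, t]) (enorm (h u) ^+ 2))%R.

(** The extended value is monotone in [t] without any finiteness, whereas [bracket] is the default 0
    when the integral is infinite. *)
Definition ebracket h t : \bar R :=
  (\int[mu]_(u in `[0%R, t]) (enorm (h u) ^+ 2)%:E)%E.

Lemma bracketE h t : bracket h t = fine (ebracket h t).
Proof. by []. Qed.

Definition path_measurable T h :=
  forall i, measurable_fun `[0, T] (fun u => h u i 0).

Lemma path_measurableD T f g : path_measurable T f -> path_measurable T g ->
  path_measurable T (fun u => f u + g u).
Proof.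
move=> mf mg i; rewrite (_ : (fun u => _) = (fun u => f u i 0) \+ (fun u => g u i 0)).
  exact: measurable_funD.
by apply/funext => u; rewrite mxE.
Qed.

Lemma path_measurableZ T a f : path_measurable T f ->
  path_measurable T (fun u => a *: f u).
Proof.
move=> mf i; rewrite (_ : (fun u => _) = (fun u => a * f u i 0)).
  exact: measurable_funM.
by apply/funext => u; rewrite mxE.
Qed.

Lemma path_measurableB T f g : path_measurable T f -> path_measurable T g ->
  path_measurable T (fun u => f u - g u).
Proof.
move=> mf mg; rewrite (_ : (fun u => _) = (fun u => f u + (-1) *: g u)).
  by apply: path_measurableD => //; exact: path_measurableZ.
by apply/funext => u; rewrite scaleN1r.
Qed.

Lemma measurable_sqr_path T t h : t <= T -> path_measurable T h ->
  measurable_fun `[0, t] (fun u => (enorm (h u) ^+ 2)%:E).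
Proof.
move=> tT mh; apply/measurable_EFinP/measurable_enorm_sqr => i.
apply: measurable_funS (mh i) => // u /=; rewrite !in_itv/= => /andP[-> ut].
exact: le_trans tT.
Qed.

Lemma ebracket_ge0 h t : (0 <= ebracket h t)%E.
Proof. by apply: integral_ge0 => u _; rewrite lee_fin sqr_ge0. Qed.

Lemma le_ebracket T h s t : path_measurable T h -> s <= t -> t <= T ->
  (ebracket h s <= ebracket h t)%E.
Proof.
move=> mh st tT; apply: ge0_subset_integral => //.
- exact: measurable_sqr_path mh.
- by move=> u _; rewrite lee_fin sqr_ge0.
- by move=> u /=; rewrite !in_itv/= => /andP[-> us]; exact: le_trans st.
Qed.

Lemma ebracket_fin T h t : path_measurable T h -> t <= T ->
  (ebracket h T < +oo)%E -> ebracket h t = (bracket h t)%:E.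
Proof.
move=> mh tT hT; rewrite bracketE fineK// ge0_fin_numE ?ebracket_ge0//.
by apply: le_lt_trans hT; exact: le_ebracket mh tT (lexx T).
Qed.

Lemma le_bracket T h s t : path_measurable T h -> s <= t -> t <= T ->
  (ebracket h T < +oo)%E -> bracket h s <= bracket h t.
Proof.
move=> mh st tT hT; rewrite -lee_fin -!(@ebracket_fin T)//; last exact: le_trans tT.
exact: le_ebracket mh st tT.
Qed.

Lemma bracket_ge0 h t : 0 <= bracket h t.
Proof. by rewrite bracketE fine_ge0// ebracket_ge0. Qed.

Lemma bracket0 h : bracket h 0 = 0.
Proof. by rewrite /bracket set_itv1 Rintegral_set1. Qed.

Lemma integrable_sqr_path T h : path_measurable T h -> (ebracket h T < +oo)%E ->
  mu.-integrable `[0, T] (fun u => (enorm (h u) ^+ 2)%:E).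
Proof.
move=> mh hT; apply/integrableP; split; first exact: measurable_sqr_path mh.
by under eq_integral do rewrite gee0_abs ?lee_fin ?sqr_ge0//.
Qed.

Lemma bracket_continuous T h : 0 <= T -> path_measurable T h ->
  (ebracket h T < +oo)%E -> seq_continuous T (bracket h).
Proof.
move=> T0 mh hT; apply: within_seq_continuous.
apply: parameterized_integral_continuous => //.
exact: integrable_sqr_path.
Qed.

Lemma ebracket_young T f g t (e : R) : 0 < e -> t <= T ->
  path_measurable T f -> path_measurable T g ->
  (ebracket f t <= (1 + e^-1)%:E * ebracket (fun u => (f u - g u)%R) T
     + (1 + e)%:E * ebracket g t)%E.
Proof.
move=> e0 tT mf mg; have mfg := path_measurableB mf mg.
have c1 : 0 <= 1 + e^-1 by rewrite addr_ge0// invr_ge0 ltW.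
have c2 : 0 <= 1 + e by rewrite addr_ge0// ltW.
apply: (@le_trans _ _ ((1 + e^-1)%:E * ebracket (fun u => (f u - g u)%R) t
     + (1 + e)%:E * ebracket g t)%E); last first.
  apply: leeD => //; apply: lee_wpmul2l; first by rewrite lee_fin.
  exact: le_ebracket mfg tT (lexx T).
rewrite -!ge0_integralZl//; try by [move=> u _; rewrite lee_fin sqr_ge0
  | exact: measurable_sqr_path mfg | exact: measurable_sqr_path mg].
rewrite -ge0_integralD//; last 4 first.
- by move=> u _; rewrite mule_ge0// lee_fin// sqr_ge0.
- by apply: measurable_funeM; exact: measurable_sqr_path mfg.
- by move=> u _; rewrite mule_ge0// lee_fin// sqr_ge0.
- by apply: measurable_funeM; exact: measurable_sqr_path mg.
apply: ge0_le_integral => //.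
- by move=> u _; rewrite lee_fin sqr_ge0.
- exact: measurable_sqr_path mf.
- by apply: emeasurable_funD; apply: measurable_funeM;
    [exact: measurable_sqr_path mfg | exact: measurable_sqr_path mg].
- move=> u _; rewrite -!EFinM -EFinD lee_fin !enorm_sqr.
  by have := dotv_young (f u - g u) (g u) e0; rewrite subrK.
Qed.

Lemma ebracketBC f g t :
  ebracket (fun u => f u - g u) t = ebracket (fun u => g u - f u) t.
Proof.
apply: eq_integral => u _; congr EFin; rewrite !enorm_sqr.
by rewrite !(dotvBl, dotvBr); ring.
Qed.

(** Young's inequality in both directions bounds each bracket by [1 + c] times the other plus
    [1 + c^-1] times the squared distance up to [T]. The distance is independent of [t], hence the
    uniformity. *)
Lemma bracket_cvg T (s : nat -> R -> 'cV[R]_n) h : 0 <= T ->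
  (forall k, path_measurable T (s k)) -> path_measurable T h ->
  (forall k, ebracket (s k) T < +oo)%E ->
  (fun k => ebracket (fun u => s k u - h u) T) @ \oo --> 0%E ->
  (ebracket h T < +oo)%E /\
  forall e, 0 < e -> \forall k \near \oo, forall t, 0 <= t <= T ->
    `|bracket (s k) t - bracket h t| <= e.
Proof.
move=> T0 ms mh sT cvg0.
have finD : \forall k \near \oo,
    ebracket (fun u => s k u - h u) T = (bracket (fun u => s k u - h u) T)%:E.
  move/fine_cvgP : cvg0 => [+ _]; apply: filterS => k fk.
  by rewrite bracketE fineK.
have hfin : (ebracket h T < +oo)%E.
  have [k fk] := filter_ex finD.
  apply: le_lt_trans (ebracket_young ltr01 (lexx T) mh (ms k)) _.
  rewrite ebracketBC fk -EFinM lte_add_pinfty ?ltry//.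
  by rewrite lte_mul_pinfty// lee_fin.
split=> // e e0.
pose A := bracket h T; have A0 : 0 <= A by exact: bracket_ge0.
(* [c] makes the excess [c A] of the factor [1 + c] at most [e / 8]; then [dl] makes the distance
   term at most [e / 8]. The bound of [c] times [bracket (s k) t] consumes three such terms. *)
pose c := Num.min 1 (e / (8 * (A + 1))).
have den : 0 < 8 * (A + 1) by rewrite mulr_gt0// ltr_wpDl.
have c0 : 0 < c by rewrite lt_min ltr01 divr_gt0.
have c1 : c <= 1 by rewrite ge_min lexx.
have cA : c * A <= e / 8.
  apply: (@le_trans _ _ (e / (8 * (A + 1)) * A)).
    by rewrite ler_wpM2r// ge_min lexx orbT.
  rewrite invfM mulrA -mulrA ler_piMr ?divr_ge0// ?(ltW e0)//.
  by rewrite mulrC ler_pdivrMr ?mul1r ?lerDl// ltr_wpDl.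
pose dl := e / (8 * (1 + c^-1)).
have d1 : 0 < 1 + c^-1 by rewrite addr_gt0// invr_gt0.
have dl0 : 0 < dl by rewrite divr_gt0// mulr_gt0.
have dle : (1 + c^-1) * dl = e / 8.
  have Hz (z : R) : 0 < z -> z * (e / (8 * z)) = e / 8.
    by move=> z0; field; rewrite gt_eqF.
  exact: Hz.
have smallD : \forall k \near \oo, bracket (fun u => s k u - h u) T <= dl.
  move/fine_cvgP : cvg0 => [_ /cvgrPdist_le/(_ _ dl0)]; apply: filterS => k /=.
  by rewrite sub0r normrN => H; exact: le_trans (ler_norm _) H.
near=> k => t /andP[t0 tT].
have fD : ebracket (fun u => s k u - h u) T = (bracket (fun u => s k u - h u) T)%:E.
  by near: k.
have lD : bracket (fun u => s k u - h u) T <= dl by near: k.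
have := ebracket_young c0 tT (ms k) mh; have := ebracket_young c0 tT mh (ms k).
rewrite (ebracketBC h) fD !(ebracket_fin _ tT)// -!EFinM -!EFinD !lee_fin => h1 h2.
have lA : bracket h t <= A by exact: le_bracket hfin.
have ht0 := bracket_ge0 h t; have st0 := bracket_ge0 (s k) t.
have HD : (1 + c^-1) * bracket (fun u => s k u - h u) T <= e / 8.
  by rewrite -dle ler_pM2l.
have cb : c * bracket h t <= e / 8 by apply: le_trans cA; rewrite ler_pM2l.
have cs : c * bracket (s k) t <= c * ((1 + c^-1) * bracket (fun u => s k u - h u) T +
    (1 + c) * bracket h t) by rewrite ler_pM2l.
move: cs HD cb h1 h2.
set X := (1 + c^-1) * _; set x := bracket (s k) t; set y := bracket h t => cs HD cb h1 h2.
have cX : c * X <= e / 8.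
  apply: le_trans HD; rewrite ler_piMl//.
  by rewrite mulr_ge0 ?bracket_ge0// ltW.
have ccy : c * (c * y) <= e / 8.
  by apply: le_trans cb; rewrite ler_piMl// mulr_ge0// ltW.
rewrite ler_norml; apply/andP; split; lra.
Unshelve. all: by end_near. Qed.

End bracket.

Section ae_limits.
Context d (T : measurableType d) (R : realType) (P : probability T R).

(** The set where convergence fails is null and thus belongs to the sigma-algebra: off it the limit
    is pointwise, and on it every subset is measurable. *)
Lemma sigma_measurable_ae_cvg (G : set (set T)) (X_ : nat -> T -> R) (X : T -> R) :
  (forall N, P.-negligible N -> <<s G>> N) ->
  (forall n, sigma_measurable <<s G>> (X_ n)) ->
  {ae P, forall w, X_ ^~ w @ \oo --> X w} -> sigma_measurable <<s G>> X.
Proof.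
move=> Gnull mX_ cX.
pose N := [set w | ~ (X_ ^~ w @ \oo --> X w)].
have NN : P.-negligible N by [].
have sG : sigma_algebra setT <<s G>> by exact: smallest_sigma_algebra.
have GN : <<s G>> (~` N) by rewrite -setTD; case: sG => _ + _; apply; exact: Gnull.
pose Y_ n w := X_ n w * \1_(~` N) w; pose Y w := X w * \1_(~` N) w.
have mY : sigma_measurable <<s G>> Y.
  apply/gsigma_measurableP.
  apply: (@measurable_fun_cvg _ (g_sigma_algebraType G) _ setT Y_).
    move=> n; apply/gsigma_measurableP; apply: sigma_measurableM => //.
    exact: sigma_measurable_indic.
  move=> w _; rewrite /Y_ /Y indicE; case: (boolP (w \in ~` N)) => wN.
    under eq_fun do rewrite mulr1; rewrite mulr1.
    by move: wN; rewrite inE /N/= => /contrapT.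
  under eq_fun do rewrite mulr0; rewrite mulr0; exact: cvg_cst.
move=> A mA.
have -> : X @^-1` A = (Y @^-1` A `&` ~` N) `|` (X @^-1` A `&` N).
  apply/seteqP; split=> w /=.
    move=> XA; have [wN|wN] := pselect (N w); [by right|left; split=> //].
    by rewrite /Y indicE mem_set// mulr1.
  by move=> [[YA wN]|[]//]; move: YA; rewrite /Y indicE mem_set// mulr1.
apply: (@measurableU _ (g_sigma_algebraType G)).
  by apply: (@measurableI _ (g_sigma_algebraType G)) => //; exact: mY.
by apply: Gnull; apply: negligibleS NN => w [].
Qed.

Lemma measurable_ae_cvg (X_ : nat -> T -> R) (X : T -> R) :
  measure_is_complete P -> (forall n, measurable_fun setT (X_ n)) ->
  {ae P, forall w, X_ ^~ w @ \oo --> X w} -> measurable_fun setT X.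
Proof.
move=> Pc mX_ cX.
have E : <<s @measurable _ T>> = @measurable _ T.
  by rewrite sigma_algebra_id//; exact: sigma_algebra_measurable.
have mX : sigma_measurable <<s @measurable _ T>> X.
  apply: sigma_measurable_ae_cvg cX.
    by move=> N /Pc mN; rewrite E.
  by move=> n A mA; rewrite E -[X in measurable X]setTI; exact: mX_.
by move=> _ A mA; rewrite setTI -E; exact: mX.
Qed.

End ae_limits.

Section stopped_simple.
Context d (Omega : measurableType d) (R : realType) (P : probability Omega R).
Hypothesis P_complete : measure_is_complete P.
Context (m : nat) (T : R) (B : R -> Omega -> 'cV[R]_m).
Hypothesis B_bm : brownian_motion P T B.
Hypothesis T_gt0 : 0 < T.
Local Notation Ft := (augmented_filtration P B).
Implicit Type S : @simple_integrand _ Omega R m.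

Lemma sigma_measurable_step_coef S (ts : nat -> R) i j : simple_wf P T B S ->
  sigma_measurable (Ft (ts i)) (fun w => step_coef ts S i w j 0).
Proof.
elim: S => [|p S IH] wf.
  apply: (@eq_sigma_measurable _ _ _ _ (fun=> 0)) => [w|].
    by rewrite /step_coef big_nil mxE.
  exact: sigma_measurable_cst.
apply: (@eq_sigma_measurable _ _ _ _ (fun w =>
   (if (p.1.1 <= ts i) && (ts i.+1 <= p.1.2) then p.2 w j 0 else 0)
   + step_coef ts S i w j 0)) => [w|].
  by rewrite /step_coef big_cons mxE; case: ifP => // _; rewrite mxE.
apply: sigma_measurableD; last first.
  by apply: IH => s t xi H; apply: wf; right.
case: (boolP ((p.1.1 <= ts i) && (ts i.+1 <= p.1.2))) => [/andP[pi _]|_]; last first.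
  exact: sigma_measurable_cst.
case: p wf pi => [[s t] xi] wf/= pi.
have [_ _ _ mxi _] := wf s t xi (or_introl erefl).
exact: (sigma_measurable_le pi (mxi j)).
Qed.

Lemma simple_wf_endpoints S : simple_wf P T B S -> exists l : seq R,
  (forall x, x \in l -> 0 <= x <= T) /\
  forall p, List.In p S -> [/\ 0 <= p.1.1, p.1.1 <= p.1.2, p.1.1 \in l & p.1.2 \in l].
Proof.
elim: S => [|[[s t] xi] S IH] wf; first by exists [::].
have [|l [lT Sl]] := IH; first by move=> s' t' xi' H; apply: wf; right.
have [s0 st tT _ _] := wf s t xi (or_introl erefl).
exists (s :: t :: l); split.
  move=> x; rewrite !inE => /predU1P[->|/predU1P[->|/lT//]].
    by rewrite s0 (le_trans st).
  by rewrite tT (le_trans s0).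
move=> p /= [<-|/Sl[? ? pl pl']]/=; first by rewrite !inE !eqxx orbT.
by split=> //; rewrite !inE ?pl ?pl' !orbT.
Qed.

(** Take the least multiple of the mesh that is at least [x]; its predecessor lies below [x], and
    index [k.+1] gives [T] itself. *)
Lemma grid_approx (k : nat) (x : R) : 0 <= x <= T -> exists2 l : nat,
  (l <= k.+1)%N & x <= l%:R * (T / k.+1%:R) <= x + T / k.+1%:R.
Proof.
move=> /andP[x0 xT]; pose dl := T / k.+1%:R.
have dl0 : 0 < dl by rewrite divr_gt0// ltr0n.
have Tdl : k.+1%:R * dl = T by rewrite mulrC divfK// pnatr_eq0.
have ex : exists l, x <= l%:R * dl by exists k.+1; rewrite Tdl.
case: (ex_minnP ex) => l xl lmin; exists l; first by apply: lmin; rewrite Tdl.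
rewrite xl/=; case: l xl lmin => [|l] xl lmin.
  by rewrite mul0r addr_ge0// ltW.
rewrite -natr1 mulrDl mul1r lerD2r leNgt; apply/negP => h.
by have := lmin l (ltW h); rewrite ltnn.
Qed.

(** [X r] is the log-exponential of [S], switched off at the first grid point [v] past
    [min(tau, r)], and also wherever its bracket would exceed [K]. The second device bounds the
    bracket everywhere, hence the bound in [L^2]; the true stopped exponent is recovered only where
    the bracket at [v] is at most [K]. The values at [u] and [T] are read on one grid, so that the
    grid martingale compares them. *)
Lemma stopped_simple S (tau : Omega -> R) (K u : R) (k : nat) :
  simple_wf P T B S -> stopping_time T Ft tau -> 0 <= K -> 0 <= u <= T ->
  exists X : R -> Omega -> R, [/\
    forall W, sigma_measurable (Ft u) W -> (forall w, 0 <= W w) ->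
      (\int[P]_w (W w * expR (X T w))%:E = \int[P]_w (W w * expR (X u w))%:E)%E,
    forall r, r = u \/ r = T -> measurable_fun setT (X r),
    forall r, r = u \/ r = T -> (\int[P]_w (expR (X r w) ^+ 2)%:E <= (expR K)%:E)%E
  & forall r, r = u \/ r = T -> forall w, exists v, [/\ 0 <= v <= T,
      Num.min (tau w) r <= v <= Num.min (tau w) r + T / k.+1%:R &
      (bracket (simple_val S ^~ w) v <= K -> X r w = simple_int B S v w -
         2^-1 * bracket (simple_val S ^~ w) v)]].
Proof.
move=> wf [tauT mtau] K0 uT.
have [l [lT Sl]] := simple_wf_endpoints wf.
(* The endpoints of [S] make it constant on cells, [u] and [T] are the times to be compared, and the
   uniform subdivision bounds the delay of [v] after [min(tau, r)]. *)
pose l' := u :: T :: l ++ [seq i%:R * (T / k.+1%:R) | i <- iota 0 k.+2].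
have T0 := ltW T_gt0.
have l'T x : x \in l' -> 0 <= x <= T.
  rewrite !inE mem_cat => /or4P[/eqP->//|/eqP->|/lT//|]; first by rewrite T0 lexx.
  move=> /mapP[i]; rewrite mem_iota add0n => /andP[_ ik] ->.
  rewrite mulr_ge0 ?divr_ge0//= mulrA ler_pdivrMr ?ltr0n// mulrC ler_pM2l//.
  by rewrite ler_nat -ltnS.
have [ts [ts_nd ts_itv ts0 ts_l]] := grid_exists T0 l'T.
have cS : covers ts S.
  move=> p /Sl[p0 pp pl pl']; split=> //; apply: ts_l.
    by rewrite !inE mem_cat pl !orbT.
  by rewrite !inE mem_cat pl' !orbT.
pose a i w := step_coef ts S i w.
pose A n w := \sum_(i < n) dotv (a i w) (a i w) * (ts i.+1 - ts i).
have ma i j : sigma_measurable (Ft (ts i)) (fun w => a i w j 0).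
  exact: sigma_measurable_step_coef.
(* The coefficient of a cell is known at its left end, so the bracket through cell [i] is already
   known at [ts i]. The switch on this cell may thus look at [A i.+1]. *)
have mA n k' : (n <= k'.+1)%N -> sigma_measurable (Ft (ts k')) (A n).
  move=> nk; apply: sigma_measurable_sum => i.
  have ik : (i <= k')%N by rewrite -ltnS; exact: leq_trans (ltn_ord i) nk.
  apply: sigma_measurableM; last exact: sigma_measurable_cst.
  apply: sigma_measurable_dotv => j;
    by apply: (@sigma_measurable_le _ _ _ P _ B (ts i)) => //; exact: ts_nd.
have And n n' w : (n <= n')%N -> A n w <= A n' w.
  move=> nn'; rewrite /A (big_ord_widen _ (fun i => dotv (a i w) (a i w) * (ts i.+1 - ts i)) nn').
  rewrite big_mkcond/=; apply: ler_sum => i _; case: ifP => // _.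
  by rewrite mulr_ge0 ?dotv_ge0// subr_ge0 ts_nd.
(* The integrand is killed after [tau] and as soon as its bracket would exceed [K]. *)
pose c i w : R := \1_[set w | ts i < tau w] w * \1_[set w | A i.+1 w <= K] w.
pose eta i w := c i w *: a i w.
have meta i j : sigma_measurable (Ft (ts i)) (fun w => eta i w j 0).
  apply: (@eq_sigma_measurable _ _ _ _ (fun w => c i w * a i w j 0)) => [w|].
    by rewrite mxE.
  apply: (@sigma_measurableM _ _ _ _ (c i) (fun w => a i w j 0)); last exact: ma.
  apply: (@sigma_measurableM _ _ _ _ (\1_[set w | ts i < tau w])
    (\1_[set w | A i.+1 w <= K])).
    apply: sigma_measurable_indic.
    rewrite (_ : [set w | _] = ~` [set w | tau w <= ts i]); last first.
      by apply/seteqP; split=> w /=; rewrite ltNge => /negP.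
    apply: sigma_algebraC; exact: mtau.
  apply: sigma_measurable_indic.
  rewrite (_ : [set w | _] = A i.+1 @^-1` `]-oo, K]); last first.
    by apply/seteqP; split=> w /=; rewrite in_itv.
  exact: (mA i.+1 i (leqnn _)).
have cE i w : c i w = ((ts i < tau w) && (A i.+1 w <= K))%:R.
  have E (Q : Omega -> bool) : \1_[set w' | Q w'] w = (Q w)%:R :> R.
    rewrite indicE; suff -> : (w \in [set w' | Q w']) = Q w by [].
    by apply/idP/idP => [/set_mem//|h]; exact/mem_set.
  by rewrite /c !E -natrM mulnb.
have etaK n w : \sum_(i < n) dotv (eta i w) (eta i w) * (ts i.+1 - ts i) <= K.
  elim: n => [|n IH]; first by rewrite big_ord0.
  have [cn|cn] := boolP ((ts n < tau w) && (A n.+1 w <= K)).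
    have /andP[_ AK] := cn; apply: le_trans AK; apply: ler_sum => i _.
    rewrite /eta dotvZl dotvZr cE; case: (_ && _); rewrite ?mul1r// !mul0r.
    by rewrite mulr_ge0 ?dotv_ge0// subr_ge0 ts_nd.
  rewrite big_ord_recr/= /eta dotvZl cE (negPf cn) !mul0r addr0.
  exact: IH.
have idx r : exists j, r = u \/ r = T -> ts j = r.
  have [H|H] := pselect (r = u \/ r = T); last by exists 0%N => /H.
  have [|j Hj] := ts_l r; last by exists j.
  by rewrite !inE; case: H => ->; rewrite eqxx ?orbT.
have /choice[J HJ] := idx.
(* As the grid may repeat points, the chosen indices can come in the wrong order, but only when
   [u = T]; then one index serves both times. *)
have JuT : (J u <= J T)%N \/ ts (J u) = ts (J T).
  have [|TJ] := leqP (J u) (J T); [by left|right].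
  apply/le_anti; rewrite (ts_nd _ _ (ltnW TJ)) andbT.
  rewrite (HJ T (or_intror erefl)) HJ; [by case/andP: uT|by left].
have [J' [HJ' J'uT]] : exists J' : R -> nat,
    (forall r, r = u \/ r = T -> ts (J' r) = r) /\ (J' u <= J' T)%N.
  case: JuT => [h|h]; first by exists J.
  have uT' : u = T by rewrite -(HJ u (or_introl erefl)) h HJ//; right.
  by exists (fun=> J u); split=> // r; rewrite -uT' => -[]->; rewrite HJ//; left.
exists (fun r => grid_log B ts eta (J' r)); split.
- move=> W mW W0.
  apply: (expectation_grid_exp P_complete B_bm ts_nd ts_itv meta J'uT) => //.
  by rewrite HJ'//; left.
- move=> r rE; apply: (sigma_measurableW P_complete B_bm (t := ts (J' r))).
    by have /andP[] := ts_itv (J' r).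
  exact: (sigma_measurable_grid_log ts_nd ts_itv meta (leqnn _)).
- move=> r rE.
  exact: (expectation_grid_exp_sqr P_complete B_bm ts_nd ts_itv meta (etaK _)).
- move=> r rE w; set n := J' r.
  (* The least such index is where the integrand is switched off: below it [tau] has not been
     reached. *)
  have ex : exists i, (n <= i)%N || (tau w <= ts i) by exists n; rewrite leqnn.
  case: (ex_minnP ex) => n' Qn' n'min.
  have n'n : (n' <= n)%N by apply: n'min; rewrite leqnn.
  have taun' i : (i < n)%N -> (ts i < tau w) = (i < n')%N.
    move=> iltn; apply/idP/idP => [h|h].
      rewrite ltnNge; apply/negP => n'i; move: Qn'.
      rewrite leqNgt (leq_ltn_trans n'i iltn)/= => /(lt_le_trans h).
      by rewrite ltNge ts_nd.
    rewrite ltNge; apply/negP => h2; have := n'min i; rewrite h2 orbT.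
    by move=> /(_ isT); rewrite leqNgt h.
  have tsn : ts n = r by exact: HJ'.
  exists (ts n'); split; first exact: ts_itv.
    have lo : Num.min (tau w) r <= ts n'.
      case/orP: Qn' => h; last by rewrite ge_min h.
      have -> : n' = n by apply/eqP; rewrite eqn_leq n'n h.
      by rewrite tsn ge_min lexx orbT.
    rewrite lo/=.
    have mT : 0 <= Num.min (tau w) r <= T.
      rewrite le_min ge_min; have /andP[-> ->] := tauT w.
      by rewrite -tsn; have /andP[-> _] := ts_itv n.
    have [i ik /andP[xi ix]] := grid_approx k mT.
    apply: le_trans ix.
    have [|j tsj] := ts_l (i%:R * (T / k.+1%:R)).
      rewrite !inE mem_cat; apply/or4P/Or44; apply/mapP; exists i => //.
      by rewrite mem_iota.
    rewrite -tsj; have [n'j|jn'] := leqP n' j; first exact: ts_nd.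
    have jn : (j < n)%N by exact: leq_trans jn' n'n.
    have jtau : ts j < tau w by rewrite taun'.
    move: xi; rewrite -tsj ge_min leNgt jtau/= -tsn => h.
    by apply: le_trans h; exact: ts_nd.
  rewrite /bracket -/(ebracket _ _) /Rintegral.
  rewrite (simple_bracket_grid ts_nd n' w cS ts0) /= -/(A n' w) => AK.
  rewrite (simple_int_grid ts_nd B n' w cS ts0) /grid_log.
  transitivity (\sum_(i < n) if (i < n')%N then dotv (a i w) (B (ts i.+1) w - B (ts i) w)
    - 2^-1 * (dotv (a i w) (a i w) * (ts i.+1 - ts i)) else 0).
    apply: eq_bigr => i _; rewrite /eta cE taun'//.
    case: ifPn => [h|_]; last by rewrite scale0r !dotv0l mul0r mulr0 subrr.
    by rewrite (le_trans (And _ _ _ h) AK) scale1r.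
  rewrite -big_mkcond/= -(big_ord_widen _ (fun i => dotv (a i w) (B (ts i.+1) w - B (ts i) w)
    - 2^-1 * (dotv (a i w) (a i w) * (ts i.+1 - ts i))) n'n).
  by rewrite big_split/= sumrN -mulr_sumr.
Qed.

End stopped_simple.

(** * Stopped stochastic exponentials *)

Section diagonal_limits.
Context {R : realType}.

(** Uniform convergence moves [g_ k (v k)] to [g (v k)], and continuity moves this to [g x]. The
    moving argument will be the grid point that approximates a stopping time. *)
Lemma cvg_diagonal (T : R) (g_ : nat -> R -> R) (g : R -> R) (v : nat -> R) (x : R) :
  seq_continuous T g ->
  (forall e, 0 < e -> \forall k \near \oo, forall t, 0 <= t <= T ->
     `|g_ k t - g t| <= e) ->
  (forall k, 0 <= v k <= T) -> 0 <= x <= T -> v @ \oo --> x ->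
  (fun k => g_ k (v k)) @ \oo --> g x.
Proof.
move=> cg ug vT xT vx; apply/cvgrPdist_le => e e0.
have e20 : 0 < e / 2 by rewrite divr_gt0.
have /cvgrPdist_le/(_ _ e20) h1 := cg v x vT xT vx.
apply: filterS2 h1 (ug _ e20) => k h1 /(_ _ (vT k)) h2.
rewrite (splitr e) -(subrKA (g (v k))) (le_trans (ler_normD _ _))//.
by apply: lerD => //; rewrite distrC.
Qed.

Lemma cvg_harmonic_scale (T : R) : (fun k => T / k.+1%:R) @ \oo --> (0 : R).
Proof.
rewrite -(mulr0 T); apply: cvgM; first exact: cvg_cst.
exact: (@cvg_harmonic R).
Qed.

End diagonal_limits.

Section stopped_exponential.
Context d (Omega : measurableType d) (R : realType) (P : probability Omega R).
Hypothesis P_complete : measure_is_complete P.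
Context (m : nat) (T : R) (B : R -> Omega -> 'cV[R]_m).
Hypothesis B_bm : brownian_motion P T B.
Hypothesis T_gt0 : 0 < T.
Local Notation Ft := (augmented_filtration P B).
Implicit Type S : @simple_integrand _ Omega R m.

(** The almost sure form of the convergences in [ito_integral], available along a subsequence. Being
    pathwise, it passes to linear combinations and to random times. *)
Definition ito_approximation (H : R -> Omega -> 'cV[R]_m) (I : R -> Omega -> R)
    (S : nat -> @simple_integrand _ Omega R m) : Prop :=
  [/\ forall k, simple_wf P T B (S k),
      forall w, path_measurable T (H ^~ w),
      {ae P, forall w, (fun k =>
         ebracket (fun t => simple_val (S k) t w - H t w) T) @ \oo --> 0%E} &
      {ae P, forall w, forall e, 0 < e -> \forall k \near \oo,
         forall t, 0 <= t <= T -> `|simple_int B (S k) t w - I t w| <= e}].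

Lemma path_measurable_simple S w : path_measurable T (simple_val S ^~ w).
Proof. by move=> i; apply: measurable_funTS; exact: measurable_simple_val. Qed.

Lemma simple_grid S (l : seq R) : simple_wf P T B S ->
  (forall x, x \in l -> 0 <= x <= T) ->
  exists ts : nat -> R, [/\ {homo ts : i j / (i <= j)%N >-> i <= j},
    forall i, 0 <= ts i <= T, ts 0%N = 0, covers ts S &
    forall x, x \in l -> exists j, ts j = x].
Proof.
move=> wf lT; have [l' [l'T Sl]] := simple_wf_endpoints wf.
have T0 := ltW T_gt0.
have [ts [ts_nd ts_itv ts0 ts_l]] : exists ts : nat -> R,
    [/\ {homo ts : i j / (i <= j)%N >-> i <= j}, forall i, 0 <= ts i <= T,
    ts 0%N = 0 & forall x, x \in l ++ l' -> exists j, ts j = x].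
  apply: grid_exists => // x; rewrite mem_cat => /orP[/lT//|/l'T//].
exists ts; split=> //.
  move=> p /Sl[p0 pp pl pl']; split=> //; apply: ts_l.
    by rewrite mem_cat pl orbT.
  by rewrite mem_cat pl' orbT.
by move=> x xl; apply: ts_l; rewrite mem_cat xl.
Qed.

Lemma ebracket_simple_fin S w : simple_wf P T B S ->
  (ebracket (simple_val S ^~ w) T < +oo)%E.
Proof.
move=> wf; have [|ts [ts_nd _ ts0 cS tsl]] := @simple_grid S [:: T] wf.
  by move=> x; rewrite inE => /eqP ->; rewrite lexx ltW.
have [j jT] := tsl T (mem_head _ _).
by rewrite -jT /ebracket simple_bracket_grid// ltry.
Qed.

Lemma sigma_measurable_simple_bracket S t : simple_wf P T B S -> 0 <= t <= T ->
  sigma_measurable (Ft t) (fun w => bracket (simple_val S ^~ w) t).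
Proof.
move=> wf tT; have [|ts [ts_nd _ ts0 cS tsl]] := @simple_grid S [:: t] wf.
  by move=> x; rewrite inE => /eqP ->.
have [j jT] := tsl t (mem_head _ _).
apply: (@eq_sigma_measurable _ _ _ _ (fun w => \sum_(i < j)
   dotv (step_coef ts S i w) (step_coef ts S i w) * (ts i.+1 - ts i))) => [w|].
  by rewrite /bracket /Rintegral -jT simple_bracket_grid.
apply: sigma_measurable_sum => i.
apply: sigma_measurableM; last exact: sigma_measurable_cst.
have it : ts i <= t by rewrite -jT; exact/ts_nd/ltnW.
apply: sigma_measurable_dotv => k;
  apply: (@sigma_measurable_le _ _ _ P _ B (ts i)) => //;
  exact: (sigma_measurable_step_coef k wf).
Qed.

Section approximated.
Context (H : R -> Omega -> 'cV[R]_m) (I : R -> Omega -> R)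
  (S : nat -> @simple_integrand _ Omega R m).
Hypothesis HIS : ito_approximation H I S.

Lemma ae_bracket_cvg : {ae P, forall w,
  (ebracket (H ^~ w) T < +oo)%E /\
  forall e, 0 < e -> \forall k \near \oo, forall t, 0 <= t <= T ->
    `|bracket (simple_val (S k) ^~ w) t - bracket (H ^~ w) t| <= e}.
Proof.
have [wf mH cH _] := HIS; apply: filterS cH => w cw.
apply: bracket_cvg => //; first exact: ltW.
- by move=> k; exact: path_measurable_simple.
- by move=> k; exact: ebracket_simple_fin.
Qed.

(** At time [t] the bracket of a simple integrand is a finite sum of variables known at [t]; the
    almost sure limit stays in the augmented sigma-algebra. *)
Lemma sigma_measurable_bracket t : 0 <= t <= T ->
  sigma_measurable (Ft t) (fun w => bracket (H ^~ w) t).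
Proof.
move=> tT; have [wf _ _ _] := HIS.
apply: (@sigma_measurable_ae_cvg _ _ _ P _
   (fun k w => bracket (simple_val (S k) ^~ w) t)).
- by move=> N NN; exact: augmented_negligible.
- by move=> k; exact: sigma_measurable_simple_bracket.
- apply: filterS ae_bracket_cvg => w [_ cw].
  apply/cvgrPdist_le => e e0; apply: filterS (cw e e0) => k; rewrite distrC.
  exact.
Qed.

Hypothesis I_cont : as_continuous P T I.

(** The grid exponents converge almost surely to the stopped one, since their stopping points tend
    to [min(tau, r)] and the integrals and brackets converge uniformly in time. The bound in [L^2]
    lets the weighted expectations follow. *)
Lemma expectation_stopped_exponential (tau : Omega -> R) (K u : R) :
  stopping_time T Ft tau -> 0 <= K ->
  {ae P, forall w, bracket (H ^~ w) (tau w) <= K} -> 0 <= u <= T ->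
  let L r w := stochastic_exponential H I (Num.min (tau w) r) w in
  (forall r, r = u \/ r = T -> measurable_fun setT (L r) /\
     P.-integrable setT (EFin \o L r)) /\
  forall W C, sigma_measurable (Ft u) W -> (forall w, 0 <= W w <= C) ->
    \int[P]_w (W w * L T w) = \int[P]_w (W w * L u w).
Proof.
move=> tau_st K0 tauK uT L.
have [wf mH cH cI] := HIS.
(* The approximants are switched off at level [K + 1]. As the limit bracket is at most [K], the
   switch is eventually inactive on almost every path. *)
have K10 : 0 <= K + 1 by rewrite addr_ge0.
have /choice[X HX] : forall k, exists X : R -> Omega -> R, _ :=
  fun k => stopped_simple P_complete B_bm T_gt0 k (wf k) tau_st K10 uT.
pose U r w := I (Num.min (tau w) r) w - 2^-1 * bracket (H ^~ w) (Num.min (tau w) r).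
have LE r : L r = (fun w => expR (U r w)) by [].
have rT r : r = u \/ r = T -> 0 <= r <= T.
  by move=> [->//|->]; rewrite lexx ltW.
have cvgX r : r = u \/ r = T ->
    {ae P, forall w, (fun k => X k r w) @ \oo --> U r w}.
  move=> ruT.
  have cI' : {ae P, forall w, {within `[0, T], continuous (I ^~ w)}} := I_cont.
  apply: filterS (filterI (filterI cI cI') (filterI ae_bracket_cvg tauK)).
  move=> w [[cJ cIw] [[hfin cb] tK]].
  have /choice[v Hv] : forall k, exists v, [/\ 0 <= v <= T,
      Num.min (tau w) r <= v <= Num.min (tau w) r + T / k.+1%:R &
      (bracket (simple_val (S k) ^~ w) v <= K + 1 ->
         X k r w = simple_int B (S k) v w -
         2^-1 * bracket (simple_val (S k) ^~ w) v)].
    by move=> k; have [_ _ _ /(_ r ruT w)] := HX k.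
  have tauT : 0 <= tau w <= T by have [] := tau_st.
  have minT : 0 <= Num.min (tau w) r <= T.
    have /andP[r0 rT'] := rT r ruT; have /andP[t0 tT] := tauT.
    by rewrite le_min t0 r0 ge_min tT.
  have vT k : 0 <= v k <= T by have [] := Hv k.
  have vcvg : v @ \oo --> Num.min (tau w) r.
    apply: (@squeeze_cvgr _ _ _ _ (fun=> Num.min (tau w) r)
      (fun k => Num.min (tau w) r + T / k.+1%:R)).
    - by apply: nearW => k; have [] := Hv k.
    - exact: cvg_cst.
    - rewrite -[X in _ --> X]addr0; apply: cvgD; first exact: cvg_cst.
      exact: cvg_harmonic_scale.
  have bcvg : (fun k => bracket (simple_val (S k) ^~ w) (v k)) @ \oo -->
      bracket (H ^~ w) (Num.min (tau w) r).
    apply: (cvg_diagonal (T := T) _ cb) => //.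
    by apply: bracket_continuous => //; exact: ltW.
  have Jcvg : (fun k => simple_int B (S k) (v k) w) @ \oo -->
      I (Num.min (tau w) r) w.
    apply: (cvg_diagonal (T := T) (g := I ^~ w) (g_ := fun k t => simple_int B (S k) t w)) => //.
    exact: within_seq_continuous.
  have lim : (fun k => simple_int B (S k) (v k) w -
      2^-1 * bracket (simple_val (S k) ^~ w) (v k)) @ \oo --> U r w.
    by apply: cvgB => //; apply: cvgM => //; exact: cvg_cst.
  apply: cvg_trans lim; apply: near_eq_cvg.
  have bK : bracket (H ^~ w) (Num.min (tau w) r) <= K.
    apply: le_trans tK; apply: (@le_bracket _ _ T) => //.
      by rewrite ge_min lexx.
    by have /andP[] := tauT.
  have /cvgrPdist_le/(_ _ ltr01) := bcvg; apply: filterS => k bk.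
  apply/esym; have [_ _] := Hv k; apply.
  by have := ler_norm (bracket (simple_val (S k) ^~ w) (v k)
    - bracket (H ^~ w) (Num.min (tau w) r)); rewrite distrC; lra.
have mX k r : r = u \/ r = T -> measurable_fun setT (X k r).
  by move=> ruT; have [_ /(_ r ruT)] := HX k.
have mU r : r = u \/ r = T -> measurable_fun setT (U r).
  by move=> ruT; apply: (measurable_ae_cvg P_complete _ (cvgX r ruT)) => k; exact: mX.
have main r : r = u \/ r = T ->
    P.-integrable setT (EFin \o L r) /\
    forall (W : Omega -> R) C, measurable_fun setT W ->
    (forall w, 0 <= W w <= C) ->
    (fun k => \int[P]_w (W w * expR (X k r w))) @ \oo --> \int[P]_w (W w * L r w).
  move=> ruT; apply: (@cvg_expectation _ _ _ P (fun k w => expR (X k r w))).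
  - by move=> k; apply: measurableT_comp => //; exact: mX.
  - by rewrite LE; apply: measurableT_comp => //; exact: mU.
  - by move=> k w; exact: expR_ge0.
  - by move=> w; exact: expR_ge0.
  - apply: filterS (cvgX r ruT) => w cw.
    by apply: (cvg_comp _ expR cw); exact: continuous_expR.
  - apply: (@asymptotically_uniform_sqr _ _ _ P _ (expR (K + 1))).
    + by move=> k; apply: measurableT_comp => //; exact: mX.
    + by move=> k w; exact: expR_ge0.
    + by move=> k; have [_ _ /(_ r ruT)] := HX k.
split.
  move=> r ruT; split; last by have [] := main r ruT.
  by rewrite LE; apply: measurableT_comp => //; exact: mU.
move=> W C mW WC.
have mW' : measurable_fun setT W.
  by apply: (sigma_measurableW P_complete B_bm _ mW); case/andP: uT.
have [_ /(_ W C mW' WC) cT] := main T (or_intror erefl).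
have [_ /(_ W C mW' WC) cu] := main u (or_introl erefl).
apply: (cvg_unique _ cT); first exact: norm_hausdorff.
apply: cvg_trans cu; apply: near_eq_cvg; apply: nearW => k.
rewrite /Rintegral; congr fine; apply/esym.
have [/(_ W mW) + _ _ _] := HX k; apply.
by move=> w; have /andP[] := WC w.
Qed.

End approximated.

End stopped_exponential.

Section linear_combination.
Context d (Omega : measurableType d) (R : realType) (P : probability Omega R).
Context (m : nat) (T : R) (B : R -> Omega -> 'cV[R]_m).
Hypothesis T_gt0 : 0 < T.
Local Notation Ft := (augmented_filtration P B).
Implicit Type S : @simple_integrand _ Omega R m.

Definition simple_scale (a : R) S : @simple_integrand _ Omega R m :=
  [seq (p.1, fun w => a *: p.2 w) | p <- S].

Lemma simple_val_scale a S u w :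
  simple_val (simple_scale a S) u w = a *: simple_val S u w.
Proof.
rewrite /simple_val big_map scaler_sumr; apply: eq_bigr => p _ /=.
by case: ifP; rewrite ?scaler0.
Qed.

Lemma simple_int_scale a S u w :
  simple_int B (simple_scale a S) u w = a * simple_int B S u w.
Proof.
by rewrite /simple_int big_map mulr_sumr; apply: eq_bigr => p _; rewrite dotvZl.
Qed.

Lemma simple_wf_scale a S : simple_wf P T B S -> simple_wf P T B (simple_scale a S).
Proof.
move=> wf s t xi /List.in_map_iff[[[s' t'] xi'] [[<- <- <-] H]].
have [s0 st tT mxi [K xiK]] := wf _ _ _ H; split=> //.
  move=> i; apply: (@eq_sigma_measurable _ _ _ _ (fun w => a * xi' w i 0)) => [w|].
    by rewrite mxE.
  apply: (@sigma_measurableM _ _ _ _ (fun=> a) (fun w => xi' w i 0)) => //.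
    exact: sigma_measurable_cst.
exists (`|a| * K) => w; rewrite /enorm/= dotvZl dotvZr mulrA -expr2.
by rewrite sqrtrM ?sqr_ge0// sqrtr_sqr; apply: ler_wpM2l => //; exact: xiK.
Qed.

Lemma simple_val_cat S S' u w :
  simple_val (S ++ S') u w = simple_val S u w + simple_val S' u w.
Proof. by rewrite /simple_val big_cat. Qed.

Lemma simple_int_cat S S' u w :
  simple_int B (S ++ S') u w = simple_int B S u w + simple_int B S' u w.
Proof. by rewrite /simple_int big_cat. Qed.

Lemma simple_wf_cat S S' : simple_wf P T B S -> simple_wf P T B S' ->
  simple_wf P T B (S ++ S').
Proof. by move=> wf wf' s t xi /List.in_app_iff[/wf|/wf']. Qed.

Lemma ebracketZ a (h : R -> 'cV[R]_m) t : t <= T -> path_measurable T h ->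
  ebracket (fun u => a *: h u) t = ((a ^+ 2)%:E * ebracket h t)%E.
Proof.
move=> tT mh; rewrite -ge0_integralZl//.
- by apply: eq_integral => u _; rewrite !enorm_sqr dotvZl dotvZr mulrA -expr2 -EFinM.
- exact: measurable_sqr_path mh.
- by move=> u _; rewrite lee_fin sqr_ge0.
- by rewrite lee_fin sqr_ge0.
Qed.

(** Simple integrands are lists, so the sum is concatenation of the scaled lists; Young's inequality
    with [e = 1] controls the quadratic error. *)
Lemma ito_approximation_linear (a b : R) (H H' : R -> Omega -> 'cV[R]_m)
    (I I' : R -> Omega -> R) (S S' : nat -> @simple_integrand _ Omega R m) :
  ito_approximation P T B H I S -> ito_approximation P T B H' I' S' ->
  ito_approximation P T B (fun t w => a *: H t w + b *: H' t w)
    (fun t w => a * I t w + b * I' t w)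
    (fun k => simple_scale a (S k) ++ simple_scale b (S' k)).
Proof.
move=> [wf mH cH cI] [wf' mH' cH' cI']; split.
- by move=> k; apply: simple_wf_cat; exact: simple_wf_scale.
- by move=> w; apply: path_measurableD; exact: path_measurableZ.
- apply: filterS2 cH cH' => w cw cw'.
  pose U k t := simple_val (S k) t w - H t w.
  pose U' k t := simple_val (S' k) t w - H' t w.
  have mU k : path_measurable T (U k).
    by apply: path_measurableB => //; exact: path_measurable_simple.
  have mU' k : path_measurable T (U' k).
    by apply: path_measurableB => //; exact: path_measurable_simple.
  pose Z k : \bar R := ((2 * a ^+ 2)%:E * ebracket (U k) T
      + (2 * b ^+ 2)%:E * ebracket (U' k) T)%E.
  apply: (@squeeze_cvge _ _ _ _ (fun=> 0%E) _ Z).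
  + apply: nearW => k; rewrite ebracket_ge0/=.
    have -> : ebracket (fun t => simple_val (simple_scale a (S k) ++ simple_scale b (S' k)) t w
       - (a *: H t w + b *: H' t w)) T = ebracket (fun t => a *: U k t + b *: U' k t) T.
      apply: eq_integral => t _; congr (_%:E); congr (enorm _ ^+ 2).
      rewrite simple_val_cat !simple_val_scale !scalerBr opprD.
      by rewrite addrACA.
    have mZ := path_measurableZ a (mU k); have mZ' := path_measurableZ b (mU' k).
    have := ebracket_young ltr01 (lexx T) (path_measurableD mZ mZ') mZ'.
    have -> : ebracket (fun u => a *: U k u + b *: U' k u - b *: U' k u) T =
        ebracket (fun u => a *: U k u) T.
      by apply: eq_integral => u _; rewrite addrK.
    by rewrite !ebracketZ// !muleA -!EFinM invr1.
  + exact: cvg_cst.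
  + have cZ r (x : nat -> \bar R) : x @ \oo --> 0%E ->
      (fun k => r%:E * x k)%E @ \oo --> 0%E.
      by move=> cx; rewrite -[X in _ --> X](mule0 r%:E); exact: cvgeZl.
    by rewrite -[X in _ --> X]adde0; apply: cvgeD => //; [exact: cZ cw|exact: cZ cw'].
- apply: filterS2 cI cI' => w cw cw' e e0.
  pose c := `|a| + `|b| + 1.
  have c0 : 0 < c by rewrite ltr_wpDl// addr_ge0.
  have ec : 0 < e / c by rewrite divr_gt0.
  apply: filterS2 (cw _ ec) (cw' _ ec) => k h h' t tT.
  rewrite simple_int_cat !simple_int_scale.
  have -> : a * simple_int B (S k) t w + b * simple_int B (S' k) t w -
    (a * I t w + b * I' t w) = a * (simple_int B (S k) t w - I t w)
    + b * (simple_int B (S' k) t w - I' t w) by ring.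
  apply: le_trans (ler_normD _ _) _; rewrite !normrM.
  apply: (@le_trans _ _ (`|a| * (e / c) + `|b| * (e / c))).
    by apply: lerD; apply: ler_wpM2l => //; [exact: h|exact: h'].
  rewrite -mulrDl mulrCA -{2}[e]mulr1 ler_pM2l// ler_pdivrMr// mul1r.
  by rewrite lerDl.
Qed.

End linear_combination.

(** * Approximation of Ito integrals by simple integrands *)

Section convergence_in_probability.
Context d (Omega : measurableType d) (R : realType) (P : probability Omega R).

Lemma cvg_in_prob0_le (X : nat -> Omega -> \bar R) (e dl : R) :
  cvg_in_prob0 P X -> 0 < e -> 0 < dl ->
  \forall n \near \oo, (P [set w | (e%:E < X n w)%E] <= dl%:E)%E.
Proof.
move=> cX e0 dl0; have := cX e e0 => /fine_cvgP[fin /cvgrPdist_le/(_ _ dl0)].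
apply: filterS2 fin => n fn; rewrite sub0r normrN => h.
by rewrite -(fineK fn) lee_fin; exact: le_trans (ler_norm _) h.
Qed.

(** Borel-Cantelli with levels and probabilities [2^-(k+1)]. One subsequence serves both sequences
    because the bad events are united before being summed. *)
Lemma cvg_in_prob0_subsequence (X X' : nat -> Omega -> \bar R) :
  (forall n (e : R), 0 < e -> measurable [set w | (e%:E < X n w)%E]) ->
  (forall n (e : R), 0 < e -> measurable [set w | (e%:E < X' n w)%E]) ->
  cvg_in_prob0 P X -> cvg_in_prob0 P X' ->
  exists phi : nat -> nat, {ae P, forall w, forall e : R, 0 < e ->
    \forall k \near \oo, (X (phi k) w <= e%:E)%E /\ (X' (phi k) w <= e%:E)%E}.
Proof.
move=> mX mX' cX cX'.
pose dl (k : nat) : R := 1 / (2 ^ k.+1)%:R.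
have dl0 k : 0 < dl k by rewrite divr_gt0// ltr0n expn_gt0.
pose A n (e : R) := [set w | (e%:E < X n w)%E] `|` [set w | (e%:E < X' n w)%E].
have mA n e : 0 < e -> measurable (A n e) by move=> e0; apply: measurableU; auto.
have /choice[phi Hphi] : forall k, exists n, (P (A n (dl k)) <= (dl k)%:E)%E.
  move=> k; have d20 : 0 < dl k / 2 by rewrite divr_gt0.
  have [n [h h']] := filter_ex (filterI (cvg_in_prob0_le cX (dl0 k) d20)
    (cvg_in_prob0_le cX' (dl0 k) d20)).
  exists n; apply: le_trans (measureU2 P (mX n _ (dl0 k)) (mX' n _ (dl0 k))) _.
  by apply: le_trans (leeD h h') _; rewrite -EFinD -splitr.
exists phi; pose F k := A (phi k) (dl k).
have mF k : measurable (F k) by exact: mA.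
have F0 : P (lim_sup_set F) = 0%E.
  apply: lim_sup_set_cvg0 => //.
  apply: (@le_lt_trans _ _ (\sum_(k <oo) (dl k)%:E)%E).
    by apply: lee_nneseries => // k _; exact: Hphi.
  apply: le_lt_trans (epsilon_trick0 xpredT (ler01 : 0 <= (1:R))) _.
  exact: ltry.
exists (lim_sup_set F); split=> //.
  by apply: bigcap_measurable => // n _; apply: bigcup_measurable => k _; exact: mF.
move=> w /= Hw n _; apply: contrapT => nF; apply: Hw => e e0.
have dle : \forall k \near \oo, dl k <= e.
  have : dl @ \oo --> (0 : R).
    have -> : dl = (fun k => 2^-1 * (2^-1 : R) ^+ k).
      by apply/funext => k; rewrite /dl div1r natrX exprS invfM exprVn.
    have c : (fun k => 2^-1 * (2^-1 : R) ^+ k) @ \oo --> (2^-1 * 0 : R).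
      apply: cvgM; first exact: cvg_cst.
      by apply: cvg_expr; rewrite ger0_norm ?invr_ge0// invf_lt1// ltr1n.
    by rewrite mulr0 in c.
  move/cvgrPdist_le => /(_ e e0); apply: filterS => k; rewrite sub0r normrN.
  by apply: le_trans; exact: ler_norm.
near=> k.
have kn : (n <= k)%N by near: k; exact: nbhs_infty_ge.
have de : ((dl k)%:E <= e%:E)%E by rewrite lee_fin; near: k.
have nA : ~ F k w by move=> Fk; apply: nF; exists k.
split; apply: le_trans de; rewrite leNgt; apply/negP => h; apply: nA.
  by left.
by right.
Unshelve. all: by end_near. Qed.

End convergence_in_probability.

Lemma cvgn_sum (R : realType) (I : Type) (r : seq I) (f : I -> nat -> R)
    (l : I -> R) : (forall i, f i @ \oo --> l i) ->
  (fun n => \sum_(i <- r) f i n) @ \oo --> \sum_(i <- r) l i.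
Proof.
move=> fl; elim: r => [|i r IH].
  by rewrite big_nil; under eq_fun do rewrite big_nil; exact: cvg_cst.
by rewrite big_cons; under eq_fun do rewrite big_cons; exact: cvgD.
Qed.

Section predictable_processes.
Context d (Omega : measurableType d) (R : realType) (P : probability Omega R).
Hypothesis P_complete : measure_is_complete P.
Context (m : nat) (T : R) (B : R -> Omega -> 'cV[R]_m).
Hypothesis B_bm : brownian_motion P T B.
Hypothesis T_gt0 : 0 < T.
Local Notation Ft := (augmented_filtration P B).
Local Notation D := (`[0%R, T]%classic `*` [set: Omega]).

Lemma measurable_time_strip : measurable D.
Proof. by apply: measurableX. Qed.

Lemma predictable_sigma_sub : predictable_sigma T Ft `<=` measurable.
Proof.
apply: smallest_sub.
  split; first exact: measurable0.
    by move=> A mA; apply: measurableD => //; exact: measurable_time_strip.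
  by move=> A mA; exact: bigcup_measurable.
move=> E [[A FA ->]|[s [t [A [s0 st tT FA ->]]]]]; apply: measurableX => //.
  by apply: (augmented_sub P_complete B_bm _ FA); exact: ltW.
by apply: (augmented_sub P_complete B_bm _ FA); rewrite (le_trans (ltW st)).
Qed.

Lemma predictable_measurable (X : R -> Omega -> R) : predictable T Ft X ->
  measurable_fun D (fun x : R * Omega => X x.1 x.2).
Proof.
move=> pX _ A mA; rewrite (_ : _ `&` _ = [set x | 0 <= x.1 <= T /\ A (X x.1 x.2)]).
  by apply: predictable_sigma_sub; exact: pX.
apply/seteqP; split=> x /=; first by rewrite in_itv/= => -[[h _] h'].
by rewrite in_itv/= => -[h h'].
Qed.

Lemma predictable_path_measurable k (H : R -> Omega -> 'cV[R]_k) w :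
  predictable_mx T Ft H -> path_measurable T (H ^~ w).
Proof.
move=> pH i _ A mA; have mH := predictable_measurable (pH i 0).
have /(_ measurable_time_strip A mA) := mH.
move=> /(measurable_ysection w); congr (measurable _).
apply/seteqP; split=> t; rewrite ysectionE/=; first by move=> [[]].
by move=> [].
Qed.

(** The sets whose slice at time 0 lies in [Ft 0] form a sigma-algebra that contains the generators:
    a rectangle over []s, t]] with [s >= 0] has empty slice there. *)
Lemma predictable0 (X : R -> Omega -> R) : predictable T Ft X ->
  sigma_measurable (Ft 0) (X 0).
Proof.
move=> pX A mA; have := pX A mA.
pose Q := [set E : set (R * Omega) | Ft 0 [set w | E (0, w)]].
suff H : predictable_sigma T Ft `<=` Q.
  move=> /H; rewrite /Q/= lexx (ltW T_gt0); congr (Ft 0 _).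
  by apply/seteqP; split=> w /=; [case|].
have [F0 FC FU] : sigma_algebra setT (Ft 0) by exact: smallest_sigma_algebra.
apply: smallest_sub.
  split.
  - by rewrite /Q/=; have := F0; congr (Ft 0 _).
  - move=> E QE; rewrite /Q/=; have := FC _ QE; congr (Ft 0 _).
    apply/seteqP; split=> w /=; rewrite in_itv/= lexx (ltW T_gt0); last by case.
    by case=> _ h; split.
  - move=> E QE; rewrite /Q/=; have := FU _ QE; congr (Ft 0 _).
move=> E [[A' FA ->]|[s [t [A' [s0 st tT FA ->]]]]]; rewrite /Q/=.
  by move: FA; congr (Ft 0 _); apply/seteqP; split=> w /=; [split|case].
rewrite (_ : [set w | _] = set0)//; apply/seteqP; split=> w //= [].
by rewrite in_itv/= => /andP[/(le_lt_trans s0)]; rewrite ltxx.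
Qed.

Lemma measurable_time_integral (g : R * Omega -> \bar R) :
  measurable_fun D g -> (forall x, 0 <= g x)%E ->
  measurable_fun setT (fun w => \int[lebesgue_measure]_(t in `[0%R, T]) g (t, w))%E.
Proof.
move=> mg g0; have mgD : measurable_fun setT (g \_ D).
  by apply/(measurable_restrictT _ _).1 => //; exact: measurable_time_strip.
have : measurable_fun setT (fubini_G lebesgue_measure (g \_ D)).
  apply: measurable_fun_fubini_tonelli_G => // x.
  by apply: erestrict_ge0 => y _; exact: g0.
congr (measurable_fun _ _); apply/funext => w; rewrite /fubini_G/= [RHS]integral_mkcond.
apply: eq_integral => t _; rewrite !patchE.
suff -> : ((t, w) \in D) = (t \in `[0, T]%classic) by [].
by apply/idP/idP => /set_mem; [move=> [h _]; exact/mem_set|move=> h; apply/mem_set; split].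
Qed.

Lemma measurable_ae_set (E E' : set Omega) : measurable E' ->
  {ae P, forall w, E w <-> E' w} -> measurable E.
Proof.
move=> mE' EE'; set N := [set w | ~ (E w <-> E' w)].
have NN : P.-negligible N by [].
have -> : E = (E' `&` ~` N) `|` (E `&` N).
  apply/seteqP; split=> w.
    move=> Ew; have [Nw|nN] := pselect (N w); [by right|left; split=> //].
    by have /contrapT[h _] := nN; exact: h.
  by move=> [[E'w nN]|[]//]; have /contrapT[_ h] := nN; exact: h.
apply: measurableU.
  by apply: measurableI => //; apply: measurableC; exact: P_complete.
by apply: P_complete; apply: negligibleS NN => w [].
Qed.

(** Exceeding [e] is an open condition, so on a continuous path it already happens at one of
    countably many grid times. The paths without continuity form a null set, absorbed by
    completeness. *)
Lemma measurable_sup_path (Z : R -> Omega -> R) (e : R) :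
  (forall t, 0 <= t <= T -> measurable_fun setT (Z t)) ->
  {ae P, forall w, seq_continuous T (Z ^~ w)} ->
  measurable [set w | (e%:E < ereal_sup [set (`|Z t w|%R)%:E | t in `[0%R, T]%classic])%E].
Proof.
move=> mZ cZ.
pose q (k l : nat) : R := Num.min (l%:R * (T / k.+1%:R)) T.
have qT k l : 0 <= q k l <= T.
  rewrite le_min ge_min lexx orbT (ltW T_gt0) !andbT mulr_ge0//.
  by rewrite divr_ge0// ltW.
apply: (@measurable_ae_set _ (\bigcup_k \bigcup_l [set w | e < `|Z (q k l) w|])).
  apply: bigcup_measurable => k _; apply: bigcup_measurable => l _.
  have mn : measurable_fun setT (fun w => `|Z (q k l) w|).
    by apply: measurableT_comp => //; exact: mZ.
  have := mn measurableT _ (measurable_itv `]e, +oo[); rewrite setTI.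
  by congr (measurable _); apply/seteqP; split=> w /=; rewrite in_itv/= andbT.
apply: filterS cZ => w cw; split; last first.
  move=> [k _ [l _ /= h]]; apply: (@lt_le_trans _ _ `|Z (q k l) w|%:E).
    by rewrite lte_fin.
  by apply: ereal_sup_ubound; exists (q k l) => //=; rewrite in_itv/=.
move=> /= /ereal_sup_gt[_ [t /= tT <-]]; rewrite lte_fin => et.
rewrite in_itv/= in tT.
have /choice[l Hl] : forall k, exists l, t <= q k l <= t + T / k.+1%:R.
  move=> k; have [l lk /andP[h1 h2]] := grid_approx T_gt0 k tT.
  exists l; rewrite /q le_min h1 ge_min h2/= andbT.
  by case/andP: tT.
have qcvg : (fun k => q k (l k)) @ \oo --> t.
  apply: (@squeeze_cvgr _ _ _ _ (fun=> t) (fun k => t + T / k.+1%:R)).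
  - exact: nearW.
  - exact: cvg_cst.
  - rewrite -[X in _ --> X]addr0; apply: cvgD; first exact: cvg_cst.
    exact: cvg_harmonic_scale.
have /cvg_norm := cw _ t (fun k => qT k (l k)) tT qcvg.
move=> /cvgrPdist_lt/(_ (`|Z t w| - e)).
rewrite subr_gt0 => /(_ et) /filter_ex[k Hk]; exists k => //; exists (l k) => //=.
have := le_lt_trans (ler_norm _) Hk; lra.
Qed.

Lemma simple_int_seq_continuous (S : @simple_integrand _ Omega R m) w :
  simple_wf P T B S -> (forall i, seq_continuous T (fun t => B t w i 0)) ->
  seq_continuous T (fun t => simple_int B S t w).
Proof.
move=> wf cB v x vT xT vx.
have cmin b i : 0 <= b <= T ->
    (fun k => B (Num.min b (v k)) w i 0) @ \oo --> B (Num.min b x) w i 0.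
  move=> bT; have mT z : 0 <= z <= T -> 0 <= Num.min b z <= T.
    move=> /andP[z0 zT]; have /andP[b0 bT'] := bT.
    by rewrite le_min b0 z0 ge_min bT'.
  apply: (cB i (fun k => Num.min b (v k))).
  - by move=> k; exact: mT.
  - exact: mT.
  - by apply: cvgn_min => //; exact: cvg_cst.
elim: S wf => [|[[s t] xi] S IH] wf.
  rewrite /simple_int big_nil; under eq_fun do rewrite big_nil; exact: cvg_cst.
have [s0 st tT _ _] := wf s t xi (or_introl erefl).
rewrite /simple_int big_cons; under eq_fun do rewrite big_cons.
apply: cvgD; last by apply: IH => s' t' xi' H; apply: wf; right.
rewrite /= dotvE; under eq_fun do rewrite dotvE.
apply: cvgn_sum => i; apply: cvgM; first exact: cvg_cst.
rewrite !mxE; under eq_fun do rewrite !mxE.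
apply: cvgB; apply: cmin; first by rewrite tT (le_trans s0).
by rewrite s0 (le_trans st).
Qed.

Lemma measurable_simple_int (S : @simple_integrand _ Omega R m) t :
  simple_wf P T B S -> 0 <= t <= T -> measurable_fun setT (simple_int B S t).
Proof.
move=> + tT; elim: S => [|[[a b] xi] S IH] wf.
  rewrite (_ : simple_int _ _ _ = cst 0); first exact: measurable_cst.
  by apply/funext => w; rewrite /simple_int big_nil.
have [a0 ab bT mxi _] := wf a b xi (or_introl erefl).
rewrite (_ : simple_int _ _ _ = (fun w => dotv (xi w) (B (Num.min b t) w -
   B (Num.min a t) w)) \+ simple_int B S t); last first.
  by apply/funext => w; rewrite /simple_int big_cons.
apply: measurable_funD; last by apply: IH => s' t' xi' H; apply: wf; right.
have mB c i : 0 <= c <= T -> measurable_fun setT (fun w => B (Num.min c t) w i 0).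
  move=> /andP[c0 cT]; have [mB _ _ _ _] := B_bm; apply: mB.
  by have /andP[t0 tT'] := tT; rewrite le_min c0 t0 ge_min cT.
apply: measurable_dotv => i.
  by apply: (sigma_measurableW P_complete B_bm _ (mxi i)); exact: le_trans bT.
rewrite (_ : (fun w => _) = (fun w => B (Num.min b t) w i 0) \-
   (fun w => B (Num.min a t) w i 0)); last by apply/funext => w; rewrite !mxE.
apply: measurable_funB; apply: mB; first by rewrite bT (le_trans a0).
by rewrite a0 (le_trans ab).
Qed.

Lemma measurable_simple_val_joint (S : @simple_integrand _ Omega R m) i :
  simple_wf P T B S ->
  measurable_fun setT (fun x : R * Omega => simple_val S x.1 x.2 i 0).
Proof.
elim: S => [|[[a b] xi] S IH] wf.
  rewrite (_ : (fun x => _) = cst 0); first exact: measurable_cst.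
  by apply/funext => x; rewrite /simple_val big_nil mxE.
have [a0 ab bT mxi _] := wf a b xi (or_introl erefl).
rewrite (_ : (fun x => _) = (fun x : R * Omega => \1_(`]a, b]) x.1 * xi x.2 i 0) \+
    (fun x : R * Omega => simple_val S x.1 x.2 i 0)).
  apply: measurable_funD; last by apply: IH => s' t' xi' H; apply: wf; right.
  apply: measurable_funM.
    by apply: (measurableT_comp _ measurable_fst); exact: measurable_indic.
  apply: (@measurableT_comp _ _ _ _ _ _ (fun w => xi w i 0) _ snd); last first.
    exact: measurable_snd.
  by apply: (sigma_measurableW P_complete B_bm _ (mxi i)); exact: le_trans bT.
apply/funext => x /=; rewrite /simple_val big_cons mxE; congr (_ + _).
rewrite indicE mem_setE in_itv/=; case: ifP => _; first by rewrite mul1r.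
by rewrite mxE mul0r.
Qed.

(** The events in both convergences in probability are measurable, by Tonelli for the quadratic
    error and by path continuity for the supremum, which allows the extraction of a subsequence. *)
Lemma ito_integral_approximation (H : R -> Omega -> 'cV[R]_m) (I : R -> Omega -> R) :
  ito_integral P T B H I -> exists S, ito_approximation P T B H I S.
Proof.
move=> [pH aI cI [S [wf cH cJ]]].
pose X n w := ebracket (fun t => simple_val (S n) t w - H t w) T.
pose X' n w := ereal_sup [set `|simple_int B (S n) t w - I t w|%:E | t in `[0, T]].
have mX n e : 0 < e -> measurable [set w | (e%:E < X n w)%E].
  move=> _; have mX : measurable_fun setT (X n).
    apply: (@measurable_time_integral (fun x : R * Omega =>
       (enorm (simple_val (S n) x.1 x.2 - H x.1 x.2) ^+ 2)%:E)).
      apply/measurable_EFinP; apply: measurable_enorm_sqr => i.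
      rewrite (_ : (fun x => _) = (fun x : R * Omega => simple_val (S n) x.1 x.2 i 0)
         \- (fun x : R * Omega => H x.1 x.2 i 0)).
        apply: measurable_funB; last first.
          exact: (predictable_measurable (pH i 0)).
        by apply: measurable_funTS; exact: measurable_simple_val_joint.
      by apply/funext => x; rewrite !mxE.
    by move=> x; rewrite lee_fin sqr_ge0.
  by have := emeasurable_fun_o_infty measurableT mX e%:E; rewrite setTI.
have [mB _ cB _ _] := B_bm.
have mX' n e : 0 < e -> measurable [set w | (e%:E < X' n w)%E].
  move=> _; apply: (@measurable_sup_path (fun t w => simple_int B (S n) t w - I t w)).
    move=> t tT; apply: measurable_funB; first exact: measurable_simple_int.
    apply: (sigma_measurableW P_complete B_bm (t := t)); last exact: aI.
    by case/andP: tT.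
  have cI' : {ae P, forall w, {within `[0, T], continuous (I ^~ w)}} := cI.
  have cB' : {ae P, forall w, forall i, seq_continuous T (fun t => B t w i 0)}.
    (* The finitely many coordinates are indexed by natural numbers, in order to exchange the
       quantifier with the almost sure one. *)
    pose Q n w := if insub n is Some i then seq_continuous T (fun t => B t w i 0)
      else True.
    have : {ae P, forall w, forall n, Q n w}.
      apply/ae_foralln => j; rewrite /Q; case: insubP => [i _ _|_]; last exact: aeW.
      have := cB i; apply: filterS => w; exact: within_seq_continuous.
    by apply: filterS => w Qw i; have := Qw i; rewrite /Q valK.
  apply: filterS2 cI' cB' => w cIw cBw v x vT xT vx.
  apply: cvgB; first exact: simple_int_seq_continuous.
  exact: (within_seq_continuous cIw).
have [phi Hphi] := cvg_in_prob0_subsequence mX mX' cH cJ.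
exists (S \o phi); split.
- by move=> k; exact: wf.
- by move=> w; exact: predictable_path_measurable.
- apply: filterS Hphi => w Hw.
  apply/fine_cvgP; split.
    apply: filterS (Hw 1 ltr01) => k [h _]; rewrite ge0_fin_numE ?ebracket_ge0//.
    exact: le_lt_trans h (ltry _).
  apply/cvgrPdist_le => e e0; apply: filterS (Hw e e0) => k [h _].
  rewrite sub0r normrN ger0_norm; last by rewrite fine_ge0// ebracket_ge0.
  rewrite -lee_fin fineK// ge0_fin_numE ?ebracket_ge0//.
  exact: le_lt_trans h (ltry _).
- apply: filterS Hphi => w Hw e e0; apply: filterS (Hw e e0) => k [_ h] t tT.
  rewrite -lee_fin; apply: le_trans h.
  by apply: ereal_sup_ubound; exists t => //=; rewrite in_itv.
Qed.

End predictable_processes.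

Lemma ae_imply d (T : measurableType d) (R : realType)
    (mu : {measure set T -> \bar R}) (P Q : T -> Prop) :
  (forall x, P x -> Q x) -> {ae mu, forall x, P x} -> {ae mu, forall x, Q x}.
Proof. by move=> PQ; exact: filterS. Qed.

(** * One-sided additivity of lower integrals *)

Section lower_integral.
Context d (T : measurableType d) (R : realType) (mu : {measure set T -> \bar R}).
Import HBNNSimple.
Local Open Scope ereal_scope.
Implicit Types (g v : T -> \bar R) (A D : set T).

(* The library integral of a nonnegative function that is not measurable is its
   lower integral; the following comparisons hold without measurability of [g]. *)
Lemma ge0_le_lower_integral D g g' : (forall x, D x -> 0 <= g x) ->
  (forall x, D x -> g x <= g' x) ->
  \int[mu]_(x in D) g x <= \int[mu]_(x in D) g' x.
Proof.
move=> g0 gg'; rewrite !ge0_integralE//; last first.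
  by move=> x Dx; exact: le_trans (g0 x Dx) (gg' x Dx).
apply: ge_ereal_sup => _ [h hg <-]; apply: ereal_sup_ubound; exists h => //.
move=> x; apply: le_trans (hg x) _; rewrite !patchE; case: ifPn => // /set_mem.
exact: gg'.
Qed.

(** Every simple function below [g] on the union is itself measurable, so its integral splits; on
    [A'] it lies almost everywhere below [v]. *)
Lemma lower_integral_setU_le A A' g v : measurable A -> measurable A' ->
  [disjoint A & A'] -> (forall x, 0 <= g x) -> (forall x, 0 <= v x) ->
  measurable_fun A' v -> {ae mu, forall x, A' x -> g x <= v x} ->
  \int[mu]_(x in A `|` A') g x <= \int[mu]_(x in A) g x + \int[mu]_(x in A') v x.
Proof.
move=> mA mA' AA' g0 v0 mv gv.
rewrite [leLHS]ge0_integralE//; apply: ge_ereal_sup => _ [h hg <-].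
have mh E : measurable_fun E (fun x => (h x)%:E).
  by apply/measurable_EFinP; apply: measurable_funTS.
have h0 x : 0 <= (h x)%:E by rewrite lee_fin; exact: fun_ge0.
rewrite -integralT_nnsfun.
apply: (@le_trans _ _ (\int[mu]_(x in A `|` A') (h x)%:E)).
  rewrite [leRHS]integral_mkcond; apply: ge0_le_lower_integral => // x _.
  have := hg x; rewrite !patchE; case: ifPn => //.
rewrite ge0_integral_setU//; apply: leeD.
  apply: ge0_le_lower_integral => // x Ax; have := hg x.
  by rewrite patchE mem_set//; left.
apply: ae_ge0_le_integral => //.
apply: filterS gv => x gvx A'x; apply: le_trans (gvx A'x).
by have := hg x; rewrite patchE mem_set//; right.
Qed.

(** For a simple [h] below [g] on [A], the sum of [h] and of [v] restricted to [A'] minus a null set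
    is measurable and lies below [g] everywhere. Finiteness of the integral of [v] lets it change
    sides before the supremum over [h] is taken. *)
Lemma lower_integral_setU_ge A A' g v : measurable A -> measurable A' ->
  [disjoint A & A'] -> (forall x, 0 <= g x) -> (forall x, 0 <= v x) ->
  measurable_fun A' v -> {ae mu, forall x, A' x -> v x <= g x} ->
  \int[mu]_(x in A') v x \is a fin_num ->
  \int[mu]_(x in A) g x + \int[mu]_(x in A') v x <= \int[mu]_(x in A `|` A') g x.
Proof.
move=> mA mA' AA' g0 v0 mv [N [mN N0 vgN]] vfin.
rewrite -leeBrDr// [X in X <= _]ge0_integralE//.
apply: ge_ereal_sup => _ [h hg <-]; rewrite leeBrDr//.
rewrite (ge0_negligible_integral mN)//.
have mAN : measurable (A' `\` N) by exact: measurableD.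
have mh : measurable_fun setT (fun x => (h x)%:E) by exact/measurable_EFinP.
have h0 x : setT x -> 0 <= (h x)%:E by rewrite lee_fin => _; exact: fun_ge0.
have mvA : measurable_fun setT (v \_ (A' `\` N)).
  by apply/(measurable_restrictT _ _).1 => //; apply: measurable_funS mv.
have vA0 x : setT x -> 0 <= (v \_ (A' `\` N)) x.
  by move=> _; apply: erestrict_ge0.
rewrite -integralT_nnsfun [X in _ + X]integral_mkcond -ge0_integralD//.
rewrite [leRHS]integral_mkcond; apply: ge0_le_lower_integral.
  move=> x _; rewrite adde_ge0//; first by rewrite lee_fin; exact: fun_ge0.
  exact: erestrict_ge0.
move=> x _; have := hg x; rewrite !patchE.
case: (boolP (x \in A)) => [/set_mem Ax hx|nA hx].
  rewrite (_ : (x \in A' `\` N) = false) ?adde0.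
    by rewrite mem_set//; left.
  apply/negP => /set_mem[A'x _]; move: AA'; rewrite disj_set2E => /eqP AA'.
  by have : (A `&` A') x by []; rewrite AA'.
case: ifPn => [/set_mem[A'x nN]|_]; last first.
  rewrite adde0; apply: le_trans hx _; case: ifP => // _.
rewrite mem_set; last by right.
rewrite -[leRHS]add0e; apply: leeD => //.
by apply: contrapT => h1; apply: nN; apply: vgN => /= /(_ A'x).
Qed.

End lower_integral.

Section integral_split.
Context {R : realType}.
Local Notation mu := (@lebesgue_measure R).

(** Lower integrals are not additive, but the upper bound [u] is integrable. The positive part of
    [F] uses the inequality of splitting from above, the negative part the one from below, and both
    errors have the right sign in the difference. *)
Lemma Rintegral_split_le (T t : R) (F u : R -> R) : 0 <= t <= T ->
  (\int[mu]_(s in `[0%R, T]) `|F s|%:E < +oo)%E ->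
  mu.-integrable `[0, T] (EFin \o u) ->
  {ae mu, forall s, 0 <= s <= T -> F s <= u s} ->
  (\int[mu]_(s in `[0, T]) F s)%R - (\int[mu]_(s in `[t, T]) F s)%R
    <= (\int[mu]_(s in `[0, t]) u s)%R.
Proof.
move=> /andP[t0 tT] Ffin iu Fu.
pose A := `[t, T]%classic; pose A' := `[0, t[%classic : set R.
have AA' : `[0, T]%classic = A `|` A'.
  by rewrite setUC -itv_bndbnd_setU// bnd_simp.
have dis : [disjoint A & A'].
  rewrite disj_set2E; apply/eqP/seteqP; split=> // x [/=].
  by rewrite /A /A'/= !in_itv/= => /andP[h _] /andP[_]; rewrite ltNge h.
have mA : measurable A by exact: measurable_itv.
have mA' : measurable A' by exact: measurable_itv.
have subT E : E `<=` `[0, T] -> measurable E ->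
    (\int[mu]_(s in E) `|F s|%:E < +oo)%E.
  move=> ET mE; apply: le_lt_trans Ffin.
  rewrite integral_mkcond [leRHS]integral_mkcond.
  apply: ge0_le_lower_integral => [x _|x _]; rewrite !patchE; first by case: ifP.
  case: ifPn => [/set_mem Ex|_]; last first.
    by change (0 <= if x \in `[0%R, T]%classic then `|F x|%:E else 0)%E; case: ifP.
  by rewrite mem_set//; exact: ET.
have sA : A `<=` `[0, T] by rewrite AA'; exact: subsetUl.
have sA' : A' `<=` `[0, T] by rewrite AA'; exact: subsetUr.
pose Fp s := (EFin \o F)^\+%E s; pose Fm s := (EFin \o F)^\-%E s.
have Fp0 s : (0 <= Fp s)%E by exact: funepos_ge0.
have Fm0 s : (0 <= Fm s)%E by exact: funeneg_ge0.
have FpF s : (Fp s <= `|F s|%:E)%E.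
  by rewrite /Fp funeposE/= ge_max lee_fin ler_norm lee_fin normr_ge0.
have FmF s : (Fm s <= `|F s|%:E)%E.
  by rewrite /Fm funenegE/= ge_max lee_fin -normrN ler_norm lee_fin normr_ge0.
have finp E : E `<=` `[0, T] -> measurable E ->
    (\int[mu]_(s in E) Fp s)%E \is a fin_num.
  move=> ET mE; rewrite ge0_fin_numE; last exact: integral_ge0.
  by apply: le_lt_trans (subT E ET mE); exact: ge0_le_lower_integral.
have finm E : E `<=` `[0, T] -> measurable E ->
    (\int[mu]_(s in E) Fm s)%E \is a fin_num.
  move=> ET mE; rewrite ge0_fin_numE; last exact: integral_ge0.
  by apply: le_lt_trans (subT E ET mE); exact: ge0_le_lower_integral.
have RE E : E `<=` `[0, T] -> measurable E -> (\int[mu]_(s in E) F s)%R =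
    fine (\int[mu]_(s in E) Fp s)%E - fine (\int[mu]_(s in E) Fm s)%E.
  move=> ET mE; rewrite /Rintegral integralE fineB//; [exact: finp|exact: finm].
have iuA' : mu.-integrable A' (EFin \o u) by exact: integrableS iu.
have mu' : measurable_fun A' (EFin \o u) by case/integrableP : iuA'.
pose up s := (EFin \o u)^\+%E s; pose um s := (EFin \o u)^\-%E s.
have up_fin : (\int[mu]_(s in A') up s)%E \is a fin_num.
  by apply: integrable_pos_fin_num.
have um_fin : (\int[mu]_(s in A') um s)%E \is a fin_num.
  by apply: integrable_neg_fin_num.
have Fu' : {ae mu, forall s, A' s -> F s <= u s}.
  apply: ae_imply Fu => s + /sA'/=; rewrite in_itv/=; exact.
have Hp : (\int[mu]_(s in `[0%R, T]) Fp s <=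
    \int[mu]_(s in A) Fp s + \int[mu]_(s in A') up s)%E.
  rewrite AA'; apply: lower_integral_setU_le => //.
  - by move=> s; exact: funepos_ge0.
  - exact: measurable_funepos.
  - apply: ae_imply Fu' => s h A's; rewrite /Fp /up !funeposE/= ge_max.
    by rewrite !le_max lee_fin h//= lexx orbT.
have Hm : (\int[mu]_(s in A) Fm s + \int[mu]_(s in A') um s <=
    \int[mu]_(s in `[0%R, T]) Fm s)%E.
  rewrite AA'; apply: lower_integral_setU_ge => //.
  - by move=> s; exact: funeneg_ge0.
  - exact: measurable_funeneg.
  - apply: ae_imply Fu' => s h A's; rewrite /Fm /um !funenegE/= ge_max.
    by rewrite !le_max lee_fin lerN2 h//= lexx orbT.
have -> : (\int[mu]_(s in `[0, t]) u s)%R = (\int[mu]_(s in A') u s)%R.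
  apply/esym; apply: Rintegral_itv_bndo_bndc; exact: iuA'.
rewrite (RE `[0, T]%classic)// (RE A)//.
have -> : (\int[mu]_(s in A') u s)%R =
    fine (\int[mu]_(s in A') up s)%E - fine (\int[mu]_(s in A') um s)%E.
  by rewrite /Rintegral integralE fineB.
have fpA := finp A sA mA; have fmA := finm A sA mA.
have := finp `[0, T]%classic (@subset_refl _ _) (measurable_itv _).
have := finm `[0, T]%classic (@subset_refl _ _) (measurable_itv _).
move: Hp Hm.
rewrite -(fineK fpA) -(fineK fmA) -(fineK up_fin) -(fineK um_fin) -!EFinD.
move=> Hp Hm fmT fpT; move: Hp Hm; rewrite -(fineK fpT) -(fineK fmT) !lee_fin.
set a1 := fine _; set a2 := fine _; set a3 := fine _ => h1.
set a4 := fine _; set a5 := fine _; set a6 := fine _ => h2.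
by rewrite /=; lra.
Qed.

End integral_split.

(** * Bounds on the driver *)

Section generator_bound.
Context {R : realType} {d m : nat}.

Lemma dist_set_le (n : nat) (K : set 'cV[R]_n) (x : 'cV[R]_n) : K 0 ->
  0 <= dist_set K x <= enorm x.
Proof.
move=> K0; have lb0 : lbound [set enorm (x - y) | y in K] 0.
  by move=> _ [y _ <-]; exact: enorm_ge0.
apply/andP; split.
  by apply: lb_le_inf => //; exists (enorm (x - 0)), 0.
by apply: ge_inf; [exists 0|exists 0 => //; rewrite subr0].
Qed.

(** Replacing the distance by the norm, [alpha / 2 |z + theta / alpha|^2] expands to [alpha / 2
    |z|^2 + z.theta + |theta|^2 / (2 alpha)], and the driver subtracts exactly the last two
    terms. *)
Lemma generator_le (alpha : R) (C : set 'cV[R]_d) b (s : 'M[R]_(d, m)) z :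
  0 < alpha -> C 0 -> generator alpha C b s z <= alpha / 2 * dotv z z.
Proof.
move=> a0 C0; rewrite /generator; set th := market_price b s.
have /andP[d0 dle] := @dist_set_le m [set s^T *m c | c in C] (z + alpha^-1 *: th)
  (ex_intro2 _ _ 0 C0 (mulmx0 _ _)).
have d2 : dist_set [set s^T *m c | c in C] (z + alpha^-1 *: th) ^+ 2 <=
    dotv (z + alpha^-1 *: th) (z + alpha^-1 *: th).
  by rewrite -enorm_sqr ler_sqr// nnegrE// enorm_ge0.
have a20 : 0 < alpha / 2 by rewrite divr_gt0.
rewrite enorm_sqr; move: d2; rewrite -(ler_pM2l a20) => h.
rewrite -subr_ge0; apply: (@le_trans _ _ (alpha / 2 *
  (dotv (z + alpha^-1 *: th) (z + alpha^-1 *: th) -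
   dist_set [set s^T *m c | c in C] (z + alpha^-1 *: th) ^+ 2))).
  by rewrite mulrBr subr_ge0.
rewrite le_eqVlt; apply/orP; left; apply/eqP.
rewrite !(dotvDl, dotvDr, dotvZl, dotvZr) (dotvC th z); field.
by rewrite gt_eqF.
Qed.

(** The test point [q / alpha] maximizes [q.z' - alpha / 2 |z'|^2]: this is the conjugate of the
    quadratic majorant. *)
Lemma subdifferential_conjugate (alpha : R) (n : nat) (g : 'cV[R]_n -> R) z q :
  0 < alpha -> (forall z', g z' <= alpha / 2 * dotv z' z') ->
  subdifferential g z q -> g z <= dotv q z - (2 * alpha)^-1 * dotv q q.
Proof.
move=> a0 gle /(_ (alpha^-1 *: q)); have := gle (alpha^-1 *: q).
rewrite dotvBr !(dotvZl, dotvZr) => h1 h2.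
have E : alpha / 2 * (alpha^-1 * (alpha^-1 * dotv q q)) = (2 * alpha)^-1 * dotv q q.
  by field; rewrite gt_eqF.
have E' : alpha^-1 * dotv q q = 2 * ((2 * alpha)^-1 * dotv q q).
  by field; rewrite gt_eqF.
rewrite E in h1; rewrite E' in h2; lra.
Qed.

End generator_bound.

(** By Tonelli almost every section of a null set of the product is Lebesgue null. *)
Lemma ae_dtdP_path d (Omega : measurableType d) (R : realType)
    (P : probability Omega R) (T : R) (Q : R -> Omega -> Prop) : ae_dtdP P T Q ->
  {ae P, forall w, {ae (@lebesgue_measure R), forall t, 0 <= t <= T -> Q t w}}.
Proof.
move=> [N [mN N0 QN]].
have H : (\int[P]_w (lebesgue_measure (ysection N w)))%E = 0%E.
  have := indic_fubini_tonelli (@lebesgue_measure R) P mN.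
  rewrite indic_fubini_tonelli_GE// => <-; rewrite indic_fubini_tonelli_FE//.
have mG : measurable_fun setT (fun w => lebesgue_measure (ysection N w)).
  exact: measurable_fun_ysection.
have : (\int[P]_w `|lebesgue_measure (ysection N w)| = 0)%E.
  by under eq_integral do rewrite gee0_abs//.
move/(ae_eq_integral_abs _ measurableT mG); apply: filterS => w /(_ Logic.I) Nw0.
exists (ysection N w); split => //; first exact: measurable_ysection.
move=> t nQ; rewrite ysectionE/=; apply: QN => /= h; exact: nQ.
Qed.

(** * Stopping times *)

Section stopping_times.
Context d (Omega : measurableType d) (R : realType) (P : probability Omega R).
Hypothesis P_complete : measure_is_complete P.
Context (m : nat) (T : R) (B : R -> Omega -> 'cV[R]_m).
Hypothesis B_bm : brownian_motion P T B.
Hypothesis T_gt0 : 0 < T.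
Local Notation Ft := (augmented_filtration P B).

Lemma augmented_ae_set t (E E' : set Omega) : Ft t E' ->
  {ae P, forall w, E w <-> E' w} -> Ft t E.
Proof.
move=> FE' EE'; set N := [set w | ~ (E w <-> E' w)].
have NN : P.-negligible N by [].
have [F0 FC FU] : sigma_algebra setT (Ft t) by exact: smallest_sigma_algebra.
have -> : E = (E' `&` ~` N) `|` (E `&` N).
  apply/seteqP; split=> w.
    move=> Ew; have [Nw|nN] := pselect (N w); [by right|left; split=> //].
    by have /contrapT[h _] := nN; exact: h.
  by move=> [[E'w nN]|[]//]; have /contrapT[_ h] := nN; exact: h.
apply: (@measurableU _ (g_sigma_algebraType _)).
  apply: (@measurableI _ (g_sigma_algebraType _)) => //.
  by apply: sigma_algebraC; exact: augmented_negligible.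
by apply: augmented_negligible; apply: negligibleS NN => w [].
Qed.

Lemma stopping_time_min (tau rho : Omega -> R) : stopping_time T Ft tau ->
  stopping_time T Ft rho -> stopping_time T Ft (fun w => Num.min (tau w) (rho w)).
Proof.
move=> [tT tF] [rT rF]; split=> [w|t tT'].
  have /andP[t0 tT1] := tT w; have /andP[r0 _] := rT w.
  by rewrite le_min ge_min t0 r0 tT1.
rewrite (_ : [set w | _] = [set w | tau w <= t] `|` [set w | rho w <= t]).
  by apply: (@measurableU _ (g_sigma_algebraType _)); [exact: tF|exact: rF].
by apply/seteqP; split=> w /=; rewrite ge_min => /orP.
Qed.

Lemma stopping_time_cst c : 0 <= c <= T -> stopping_time T Ft (fun=> c).
Proof.
move=> cT; split=> // t tT; have [ct|tc] := leP c t.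
  rewrite (_ : [set w | _] = setT); last by apply/seteqP; split.
  exact: (@measurableT _ (g_sigma_algebraType _)).
rewrite (_ : [set w | _] = set0); last by apply/seteqP; split.
exact: (@measurable0 _ (g_sigma_algebraType _)).
Qed.

Lemma stopping_time_measurable (tau : Omega -> R) : stopping_time T Ft tau ->
  measurable_fun setT tau.
Proof.
move=> [tT tF]; apply: (measurability _ (RGenOInfty.measurableE R)) => //.
move=> _ [_ [x ->] <-]; rewrite setTI.
rewrite (_ : _ @^-1` _ = ~` [set w | tau w <= x]); last first.
  by apply/seteqP; split=> w /=; rewrite in_itv/= andbT ltNge => /negP.
apply: measurableC; have [x0|x0] := ltP x 0.
  rewrite (_ : [set w | _] = set0) //; apply/seteqP; split=> w //= h.
  by have /andP[] := tT w; rewrite leNgt (le_lt_trans h x0).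
have [xT|Tx] := leP x T.
  by apply: (augmented_sub P_complete B_bm xT); apply: tF; rewrite x0.
rewrite (_ : [set w | _] = setT) //; apply/seteqP; split=> w //= _.
by have /andP[_ h] := tT w; exact: le_trans h (ltW Tx).
Qed.

Lemma predictable_stopped_measurable (X : R -> Omega -> R) (tau : Omega -> R) :
  predictable T Ft X -> stopping_time T Ft tau ->
  measurable_fun setT (fun w => X (tau w) w).
Proof.
move=> pX tau_st; have [tT _] := tau_st.
have mX := predictable_measurable P_complete B_bm T_gt0 pX.
apply: (@measurable_comp _ _ _ _ _ _ (`[0%R, T]%classic `*` [set: Omega])
  (fun x : R * Omega => X x.1 x.2) setT (fun w => (tau w, w))) => //.
- exact: measurable_time_strip.
- by move=> _ [w _ <-]; split=> //=; rewrite in_itv/= tT.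
- by apply: measurable_fun_pair => //; exact: stopping_time_measurable.
Qed.

Section hitting.
Variable V : R -> Omega -> R.
Hypothesis V_adapted : forall t, 0 <= t <= T -> sigma_measurable (Ft t) (V t).

Definition increasing_path (v : R -> R) := [/\ seq_continuous T v, v 0 = 0 &
  forall s t, 0 <= s -> s <= t -> t <= T -> v s <= v t].

Hypothesis V_increasing : {ae P, forall w, increasing_path (V ^~ w)}.

(** Adding [T] keeps the set nonempty, so that a level never reached gives [T]. *)
Definition hitting (n : R) (w : Omega) : R :=
  inf ([set t | 0 <= t <= T /\ n <= V t w] `|` [set T]).

Let T0 : 0 <= T. Proof. exact: ltW. Qed.

Let hit_lbound n w : lbound ([set t | 0 <= t <= T /\ n <= V t w] `|` [set T]) 0.
Proof. by move=> t [[/andP[] //]|->]. Qed.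

Lemma hitting_itv n w : 0 <= hitting n w <= T.
Proof.
apply/andP; split; first by apply: lb_le_inf; [exists T; right|exact: hit_lbound].
by apply: ge_inf; [exists 0; exact: hit_lbound|right].
Qed.

Lemma hitting_le n w t : 0 <= t <= T -> n <= V t w -> hitting n w <= t.
Proof. by move=> tT nV; apply: ge_inf; [exists 0; exact: hit_lbound|left]. Qed.

Lemma le_hitting n w x : x <= T ->
  (forall t, 0 <= t <= T -> n <= V t w -> x <= t) -> x <= hitting n w.
Proof.
move=> xT H; apply: lb_le_inf; first by exists T; right.
by move=> t [[tT nV]|->//]; exact: H.
Qed.

(** If [V] is below [n] at [t < T], continuity keeps it below [n] up to a later time, so the hitting
    time exceeds [t]. The event is thus decided at time [t] itself, without looking to the right. *)
Lemma hitting_leP n w t : increasing_path (V ^~ w) -> 0 <= t < T ->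
  hitting n w <= t <-> n <= V t w.
Proof.
move=> [cV _ ndV] /andP[t0 tT]; split=> [ht|]; last first.
  by apply: hitting_le; rewrite t0 ltW.
rewrite leNgt; apply/negP => Vn.
pose v k := Num.min (t + T / k.+1%:R) T.
have dl0 k : 0 < T / k.+1%:R by rewrite divr_gt0.
have vT k : 0 <= v k <= T.
  by rewrite le_min ge_min lexx orbT T0 !andbT addr_ge0// ltW.
have vt : v @ \oo --> t.
  rewrite -[X in _ --> X](min_l (ltW tT)); apply: cvgn_min; last exact: cvg_cst.
  rewrite -[X in _ --> X]addr0; apply: cvgD; first exact: cvg_cst.
  exact: cvg_harmonic_scale.
have tT' : 0 <= t <= T by rewrite t0 ltW.
have /cvgrPdist_lt/(_ (n - V t w)) := cV v t vT tT' vt.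
rewrite subr_gt0 => /(_ Vn)/filter_ex[k].
rewrite distrC => /(le_lt_trans (ler_norm _)); rewrite ltrD2r => Vk.
have tv : t < v k by rewrite lt_min tT ltrDl dl0.
have : v k <= hitting n w.
  apply: le_hitting; first by case/andP: (vT k).
  move=> s /andP[s0 sT] nV; rewrite leNgt; apply/negP => sv.
  have := lt_le_trans Vk nV; rewrite ltNge ndV ?(ltW sv)//.
  by case/andP: (vT k).
by move=> /(lt_le_trans tv); rewrite ltNge ht.
Qed.

Lemma stopping_time_hitting n : stopping_time T Ft (hitting n).
Proof.
split=> [w|t /andP[t0 tT]]; first exact: hitting_itv.
have [tltT|Tt] := ltP t T; last first.
  rewrite (_ : [set w | _] = setT).
    exact: (@measurableT _ (g_sigma_algebraType _)).
  apply/seteqP; split=> w //= _; have /andP[_ h] := hitting_itv n w.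
  exact: le_trans h Tt.
apply: (@augmented_ae_set t _ (V t @^-1` `[n, +oo[)).
  by apply: V_adapted => //; rewrite t0 tT.
apply: filterS V_increasing => w Vw /=; rewrite in_itv/= andbT.
by apply: hitting_leP => //; rewrite t0.
Qed.

(** Were the value above [n], continuity would put an earlier time above [n] too; the start at 0
    rules out a hitting time equal to 0. *)
Lemma hitting_bound n w : increasing_path (V ^~ w) -> 0 <= n ->
  V (hitting n w) w <= n.
Proof.
move=> [cV V0 ndV] n0; rewrite leNgt; apply/negP => nV.
have /andP[h0 hT] := hitting_itv n w; set h := hitting n w in nV h0 hT *.
have hpos : 0 < h.
  rewrite lt_neqAle h0 andbT; apply/eqP => h00.
  by move: nV; rewrite -h00 V0 ltNge n0.
pose v k := Num.max (h - T / k.+1%:R) 0.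
have dl0 k : 0 < T / k.+1%:R by rewrite divr_gt0.
have vh k : v k < h by rewrite gt_max hpos andbT ltrBlDr ltrDl.
have vT k : 0 <= v k <= T.
  by rewrite le_max lexx orbT /= (le_trans (ltW (vh k)) hT).
have vcvg : v @ \oo --> h.
  rewrite -[X in _ --> X](max_l h0); apply: cvgn_max; last exact: cvg_cst.
  rewrite -[X in _ --> X]subr0; apply: cvgB; first exact: cvg_cst.
  exact: cvg_harmonic_scale.
have hT' : 0 <= h <= T by rewrite h0.
have /cvgrPdist_lt/(_ (V h w - n)) := cV v h vT hT' vcvg.
rewrite subr_gt0 => /(_ nV)/filter_ex[k] /(le_lt_trans (ler_norm _)).
rewrite ltrD2l ltrN2 => /ltW/(hitting_le (vT k)).
by rewrite leNgt vh.
Qed.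

Lemma hitting_eq n w : increasing_path (V ^~ w) -> V T w < n -> hitting n w = T.
Proof.
move=> [_ _ ndV] Vn; apply/le_anti; have /andP[_ ->] /= := hitting_itv n w.
apply: le_hitting => // t /andP[t0 tT] /(lt_le_trans Vn).
by rewrite ltNge ndV.
Qed.

End hitting.

End stopping_times.

Section stopped_unit.
Context d (Omega : measurableType d) (R : realType) (P : probability Omega R).
Hypothesis P_complete : measure_is_complete P.
Context (m : nat) (T : R) (B : R -> Omega -> 'cV[R]_m).
Hypothesis B_bm : brownian_motion P T B.
Hypothesis T_gt0 : 0 < T.
Local Notation Ft := (augmented_filtration P B).

Definition log_exponential (H : R -> Omega -> 'cV[R]_m) (I : R -> Omega -> R)
  (t : R) (w : Omega) : R := I t w - 2^-1 * bracket (H ^~ w) t.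

Lemma simple_int0 (S : @simple_integrand _ Omega R m) w : simple_wf P T B S ->
  simple_int B S 0 w = 0.
Proof.
elim: S => [|[[s t] xi] S IH] wf; first by rewrite /simple_int big_nil.
have [s0 st _ _ _] := wf s t xi (or_introl erefl).
rewrite /simple_int big_cons -/(simple_int B S 0 w) IH ?addr0/=.
  by rewrite !min_r// ?subrr ?dotv0r// (le_trans s0).
by move=> s' t' xi' H; apply: wf; right.
Qed.

Lemma ito_approximation0 H I S : ito_approximation P T B H I S ->
  {ae P, forall w, I 0 w = 0}.
Proof.
move=> [wf _ _ cI]; apply: filterS cI => w cw.
have T0 : 0 <= (0 : R) <= T by rewrite lexx ltW.
apply/eqP; rewrite -normr_le0; apply/ler_addgt0Pl => e e0; rewrite addr0.
have [k /(_ 0 T0)] := filter_ex (cw e e0).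
by rewrite simple_int0// sub0r normrN.
Qed.

Lemma ge0_integralD_EFin (f g : Omega -> R) : measurable_fun setT f ->
  measurable_fun setT g -> (forall w, 0 <= f w) -> (forall w, 0 <= g w) ->
  (\int[P]_w (f w + g w)%:E = \int[P]_w (f w)%:E + \int[P]_w (g w)%:E)%E.
Proof.
move=> mf mg f0 g0; under eq_integral do rewrite EFinD.
have mf' : measurable_fun setT (fun w => (f w)%:E) by exact/measurable_EFinP.
have mg' : measurable_fun setT (fun w => (g w)%:E) by exact/measurable_EFinP.
have f0' w : setT w -> (0 <= (f w)%:E)%E by rewrite lee_fin.
have g0' w : setT w -> (0 <= (g w)%:E)%E by rewrite lee_fin.
by rewrite ge0_integralD.
Qed.

Lemma ge0_integralZ_EFin (c : R) (f : Omega -> R) : measurable_fun setT f ->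
  0 <= c -> (forall w, 0 <= f w) ->
  (\int[P]_w (c * f w)%:E = c%:E * \int[P]_w (f w)%:E)%E.
Proof.
move=> mf c0 f0; under eq_integral do rewrite EFinM.
have mf' : measurable_fun setT (fun w => (f w)%:E) by exact/measurable_EFinP.
have f0' w : setT w -> (0 <= (f w)%:E)%E by rewrite lee_fin.
by rewrite ge0_integralZl.
Qed.

(** The comparison of times [T] and [u = 0], where the exponential is almost surely 1. The weight
    will be the negative part of [Y_0], which may be unbounded: truncation and Fatou give the
    inequality. *)
Lemma stopped_exponential_unit H I S (tau : Omega -> R) (K : R) :
  ito_approximation P T B H I S -> as_continuous P T I ->
  stopping_time T Ft tau -> 0 <= K ->
  {ae P, forall w, bracket (H ^~ w) (tau w) <= K} ->
  let U w := log_exponential H I (tau w) w in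
  [/\ measurable_fun setT U, (\int[P]_w (expR (U w))%:E = 1)%E &
      forall W, sigma_measurable (Ft 0) W -> (forall w, 0 <= W w) ->
      (\int[P]_w (W w * expR (U w))%:E <= \int[P]_w (W w)%:E)%E].
Proof.
move=> HIS cI tau_st K0 tauK U.
have [tauT _] := tau_st.
have z0T : 0 <= (0 : R) <= T by rewrite lexx ltW.
have [mL WL] := expectation_stopped_exponential P_complete B_bm T_gt0 HIS cI
  tau_st K0 tauK z0T.
have LT : (fun w => stochastic_exponential H I (Num.min (tau w) T) w) =
    (fun w => expR (U w)).
  apply/funext => w; rewrite min_l //; by have /andP[] := tauT w.
pose L0 w := stochastic_exponential H I (Num.min (tau w) 0) w.
have L0_1 : {ae P, forall w, L0 w = 1}.
  apply: filterS (ito_approximation0 HIS) => w I0.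
  rewrite /L0 min_r; last by have /andP[] := tauT w.
  by rewrite /stochastic_exponential I0 -/(bracket _ _) bracket0 mulr0 subr0 expR0.
have [mexp iexp] := mL T (or_intror erefl); rewrite LT in mexp iexp.
have [mL0 _] : measurable_fun setT L0 /\ P.-integrable setT (EFin \o L0).
  exact: (mL 0 (or_introl erefl)).
have WUL W C : sigma_measurable (Ft 0) W -> (forall w, 0 <= W w <= C) ->
    \int[P]_w (W w * expR (U w)) = \int[P]_w (W w * L0 w).
  move=> mW WC; apply: etrans (WL W C mW WC); apply: eq_Rintegral => w _.
  by apply: (congr1 (fun x => W w * x)); exact: esym (congr1 (@^~ w) LT).
clearbody U L0; clear mL WL LT.
(* Only [e^U] is known to be measurable so far; the logarithm recovers [U]. *)
have mU : measurable_fun setT U.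
  rewrite (_ : U = (@ln R) \o (fun w => expR (U w))).
    by apply: measurableT_comp => //; exact: measurable_ln.
  by apply/funext => w /=; rewrite expRK.
have WL' W C : sigma_measurable (Ft 0) W -> (forall w, 0 <= W w <= C) ->
    (\int[P]_w (W w * expR (U w))%:E = \int[P]_w (W w)%:E)%E.
  move=> mW WC; have := WUL W C mW WC.
  have mW' := sigma_measurableW P_complete B_bm (ltW T_gt0) mW.
  have W0 w : 0 <= W w by have /andP[] := WC w.
  have WleC w : `|W w| <= C by rewrite ger0_norm//; have /andP[] := WC w.
  have -> : \int[P]_w (W w * L0 w) = \int[P]_w (W w).
    rewrite /Rintegral; congr fine; apply: ae_eq_integral => //.
    - by apply/measurable_EFinP; exact: measurable_funM.
    - exact/measurable_EFinP.
    - by apply: filterS L0_1 => w -> _; rewrite mulr1.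
  have iW : P.-integrable setT (EFin \o W) by exact: integrable_bounded WleC.
  have iWe : P.-integrable setT (EFin \o (fun w => W w * expR (U w))).
    apply: (@le_integrable _ _ _ P setT measurableT _
        (fun w => C%:E * (EFin \o (fun w => expR (U w))) w)%E).
    - by apply/measurable_EFinP; exact: measurable_funM.
    - move=> w _ /=; rewrite lee_fin !normrM; apply: ler_wpM2r => //.
      by apply: le_trans (WleC w) _; exact: ler_norm.
    - exact: integrableZl.
  rewrite /Rintegral => h.
  rewrite -(fineK (integrable_fin_num measurableT iWe)).
  by rewrite -(fineK (integrable_fin_num measurableT iW)) h.
split=> //.
  have := WL' (cst 1) 1 (sigma_measurable_cst 1).
  under eq_integral do rewrite mul1r.
  move=> ->; last by move=> w; rewrite ler01 lexx.
  rewrite -[LHS]/(\int[P]_w (cst 1%E w))%E integral_cst// mul1e.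
  exact: probability_setT.
move=> W mW W0.
have mW' := sigma_measurableW P_complete B_bm (ltW T_gt0) mW.
pose Wk k w := Num.min (W w) k%:R.
have mWk k : sigma_measurable (Ft 0) (Wk k).
  apply: (@sigma_measurable_comp _ _ _ _ (fun x => Num.min x k%:R)) => //.
  by apply: (@measurable_minr _ _ _ _ idfun (cst _)) => //; exact: measurable_id.
have Wk0 k w : 0 <= Wk k w <= k%:R by rewrite le_min W0 ler0n ge_min lexx orbT.
have mWk' k := sigma_measurableW P_complete B_bm (ltW T_gt0) (mWk k).
apply: (@le_integral_ae_cvg _ _ _ P (fun k w => Wk k w * expR (U w))).
- by move=> k; exact: measurable_funM.
- exact: measurable_funM.
- by move=> k w; rewrite mulr_ge0 ?expR_ge0//; have /andP[] := Wk0 k w.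
- by move=> w; rewrite mulr_ge0 ?expR_ge0.
- apply: aeW => w; apply: cvgM; last exact: cvg_cst.
  apply: cvg_near_cst; near=> k; rewrite /Wk min_l//.
  by near: k; exact: nbhs_infty_ger.
- move=> k; rewrite (WL' (Wk k) k%:R)//; apply: ge0_le_integral => //.
  + by move=> w _; rewrite lee_fin; have /andP[] := Wk0 k w.
  + exact/measurable_EFinP.
  + exact/measurable_EFinP.
  + by move=> w _; rewrite lee_fin ge_min lexx.
Unshelve. all: by end_near. Qed.

End stopped_unit.

(** * The entropy estimate *)

Section path_inequalities.
Context {R : realType} {n : nat}.
Implicit Types (f g : R -> 'cV[R]_n).
Local Notation mu := (@lebesgue_measure R).

Lemma Rintegral_linear t (a b : R) (f g : R -> R) :
  mu.-integrable `[0, t] (EFin \o f) -> mu.-integrable `[0, t] (EFin \o g) ->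
  mu.-integrable `[0, t] (EFin \o (fun x => a * f x + b * g x)) /\
  \int[mu]_(x in `[0, t]) (a * f x + b * g x) =
    a * \int[mu]_(x in `[0, t]) f x + b * \int[mu]_(x in `[0, t]) g x.
Proof.
move=> intf intg.
have h (c : R) k : mu.-integrable `[0, t] (EFin \o k) ->
  mu.-integrable `[0, t] (EFin \o (fun x => c * k x)) by exact: integrableZl.
split; first exact: (integrableD _ (h a f intf) (h b g intg)).
by rewrite RintegralD ?RintegralZl//; exact: h.
Qed.

Lemma integrable_sqr_initial T t f : path_measurable T f ->
  (ebracket f T < +oo)%E -> t <= T ->
  mu.-integrable `[0, t] (EFin \o (fun u => enorm (f u) ^+ 2)).
Proof.
move=> mf ff tT; apply: integrableS (integrable_sqr_path mf ff) => //.
by move=> x; rewrite /= !in_itv/= => /andP[-> /le_trans ->].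
Qed.

Lemma bracket_linear_le T t (a b : R) f g : path_measurable T f ->
  path_measurable T g -> (ebracket f T < +oo)%E -> (ebracket g T < +oo)%E ->
  (ebracket (fun u => (a *: f u + b *: g u)%R) T < +oo)%E -> t <= T ->
  bracket (fun u => a *: f u + b *: g u) t
    <= 2 * a ^+ 2 * bracket f t + 2 * b ^+ 2 * bracket g t.
Proof.
move=> mf mg ff fg ffg tT.
have mfg : path_measurable T (fun u => a *: f u + b *: g u).
  by apply: path_measurableD; exact: path_measurableZ.
have [iS e] := Rintegral_linear (2 * a ^+ 2) (2 * b ^+ 2)
  (integrable_sqr_initial mf ff tT) (integrable_sqr_initial mg fg tT).
rewrite /bracket -e; apply: le_Rintegral => //.
  exact: integrable_sqr_initial mfg ffg tT.
move=> u _; rewrite !enorm_sqr; apply: le_trans (dotv_young2 _ _) _.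
by rewrite !dotvZl !dotvZr; lra.
Qed.

(* With [h = q - alpha Z], the identity
   [lam alpha (q.Z - |q|^2 / (2 alpha)) =
    (1 + lam) / 2 |q|^2 - |q + lam h|^2 / 2 + lam^2 / 2 |h|^2] turns the bound
   of the driver into a difference of brackets. *)
Lemma path_drift_le T t (alpha lam : R) (F : R -> R) (q Z : R -> 'cV[R]_n)
    (q2 := fun u => (1 + lam) *: q u + (- (lam * alpha)) *: Z u)
    (h := fun u => 1 *: q u + (- alpha) *: Z u) :
  0 < alpha -> 0 < lam -> 0 <= t <= T ->
  path_measurable T q -> path_measurable T Z -> (ebracket q T < +oo)%E ->
  (ebracket q2 T < +oo)%E -> (ebracket h T < +oo)%E ->
  (\int[mu]_(s in `[0%R, T]) `|F s|%:E < +oo)%E ->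
  {ae mu, forall s, 0 <= s <= T ->
     F s <= dotv (q s) (Z s) - (2 * alpha)^-1 * dotv (q s) (q s)} ->
  lam * alpha * ((\int[mu]_(s in `[0, T]) F s)%R - (\int[mu]_(s in `[t, T]) F s)%R)
    <= (2^-1 * lam + 2^-1) * bracket q t - 2^-1 * bracket q2 t
       + 2^-1 * lam ^+ 2 * bracket h t.
Proof.
move=> a0 l0 tT mq mZ fq fq2 fh iF Fle.
have tT' : t <= T by case/andP: tT.
have mq2 : path_measurable T q2.
  by apply: path_measurableD; exact: path_measurableZ.
have mh : path_measurable T h.
  by apply: path_measurableD; exact: path_measurableZ.
pose u1 s := (2^-1 * lam + 2^-1) * enorm (q s) ^+ 2 + (- 2^-1) * enorm (q2 s) ^+ 2.
pose u2 s := 1 * u1 s + (2^-1 * lam ^+ 2) * enorm (h s) ^+ 2.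
have split_u t' : t' <= T ->
    mu.-integrable `[0, t'] (EFin \o u2) /\
    \int[mu]_(s in `[0, t']) u2 s = (2^-1 * lam + 2^-1) * bracket q t'
      + (- 2^-1) * bracket q2 t' + (2^-1 * lam ^+ 2) * bracket h t'.
  move=> t'T.
  have [i1 e1] := Rintegral_linear (2^-1 * lam + 2^-1) (- 2^-1)
    (integrable_sqr_initial mq fq t'T)
    (integrable_sqr_initial mq2 fq2 t'T).
  have [i2 e2] := Rintegral_linear 1 (2^-1 * lam ^+ 2)
    i1 (integrable_sqr_initial mh fh t'T).
  by split=> //; rewrite e2 e1 mul1r.
have [iu _] := split_u T (lexx _).
have [iut eut] := split_u t tT'.
have la0 : 0 < lam * alpha by rewrite mulr_gt0.
have scaled c k : mu.-integrable `[0, T] (EFin \o k) ->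
  mu.-integrable `[0, T] (EFin \o (fun s => c * k s)) by exact: integrableZl.
have iu' := scaled (lam * alpha)^-1 u2 iu.
have /(Rintegral_split_le tT iF iu') : {ae mu, forall s, 0 <= s <= T ->
    F s <= (lam * alpha)^-1 * u2 s}.
  apply: ae_imply Fle => s Fs sT; apply: le_trans (Fs sT) _.
  rewrite /u2 /u1 !enorm_sqr /q2 /h !(dotvDl, dotvDr, dotvZl, dotvZr).
  rewrite (dotvC (Z s) (q s)) ler_pdivlMl//.
  set x := dotv (q s) (q s); set y := dotv (q s) (Z s); set z := dotv _ _.
  rewrite le_eqVlt; apply/orP; left; apply/eqP; field.
  exact: lt0r_neq0.
rewrite RintegralZl// eut => /(ler_wpM2l (ltW la0)).
by rewrite [X in _ <= X]mulrA mulfV ?gt_eqF// mul1r mulNr.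
Qed.

(** Here [r] is a bound for the bracket of [q - alpha Z]. Divided by [lam] and with [lam r <= 1],
    the quadratic error is at most [1 / 2], which is the origin of the last term [2^-1 * expR u]. *)
Lemma entropy_drift_le (u u2 y y0 alpha lam r : R) (p : nat) : 0 < alpha ->
  0 < lam -> (1 < p)%N -> lam * r <= 1 ->
  lam * (u - alpha * (y - y0)) <= u2 - u + 2^-1 * lam ^+ 2 * r ->
  2^-1 * (expR u * u + 1) + lam^-1 * expR u <=
    1 + expR (p%:R * alpha * Num.max y 0) + alpha * (Num.max (- y0) 0 * expR u)
    + lam^-1 * expR u2 + 2^-1 * expR u.
Proof.
move=> a0 l0 p1 lr H; set yp := Num.max y 0; set ym := Num.max _ 0.
have yp0 : 0 <= yp by rewrite le_max lexx orbT.
have yyp : y <= yp by rewrite le_max lexx.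
have y0m : - y0 <= ym by rewrite le_max lexx.
set E2 := expR (p%:R * _ * _); have e0 : 0 < expR u by exact: expR_gt0.
(* Young's inequality is applied to twice [alpha yp]: halving it absorbs only half of the entropy
   and leaves the other half on the left. The exponential moment of order [2 alpha] is covered
   because the integer [p] is at least 2. *)
have h1 := entropy_young u (2 * alpha * yp).
have h2 : expR (2 * alpha * yp) <= E2.
  rewrite ler_expR -!mulrA ler_wpM2r ?mulr_ge0 ?(ltW a0)//.
  by rewrite (ler_nat R 2 p).
have h3 : expR u * (u2 - u) <= expR u2 - expR u.
  have := expR_ge1Dx (u2 - u); rewrite -(ler_pM2l e0) -expRD subrKC.
  by rewrite mulrDr mulr1 lerBrDl.
have h4 : u <= alpha * yp + alpha * ym + lam^-1 * (u2 - u) + 2^-1.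
  have : u - alpha * (y - y0) <= lam^-1 * (u2 - u) + 2^-1 * (lam * r).
    rewrite -(ler_pM2l l0); apply: le_trans H _.
    by rewrite mulrDr mulVKf ?gt_eqF//; lra.
  have : alpha * y <= alpha * yp by rewrite ler_pM2l.
  have : alpha * (- y0) <= alpha * ym by rewrite ler_pM2l.
  lra.
have h5 : expR u * u <= expR u * (alpha * yp) + alpha * (ym * expR u)
    + lam^-1 * (expR u2 - expR u) + 2^-1 * expR u.
  apply: le_trans (ler_wpM2l (ltW e0) h4) _.
  have : lam^-1 * (expR u * (u2 - u)) <= lam^-1 * (expR u2 - expR u).
    by rewrite ler_pM2l ?invr_gt0.
  lra.
set k := lam^-1 in h5 *; set E1 := expR (2 * _ * _) in h1 h2.
have E2_0 : 0 <= E2 by exact: expR_ge0.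
 set e := expR u in e0 h1 h3 h5 *.
lra.
Qed.

End path_inequalities.

Lemma ae_and d (T : measurableType d) (R : realType)
    (mu : {measure set T -> \bar R}) (P Q : T -> Prop) :
  {ae mu, forall x, P x} -> {ae mu, forall x, Q x} ->
  {ae mu, forall x, P x /\ Q x}.
Proof. exact: filterI. Qed.

Section entropy_estimate.
Context d (Omega : measurableType d) (R : realType) (P : probability Omega R).

(** Both exponentials have mean 1, so [k] appears on each side as the same finite number and
    cancels, however large it is. An infinite entropy is excluded because the right-hand side is
    finite. *)
Lemma integral_entropy_le (U U2 E W : Omega -> R) (k a C1 C2 : R) :
  measurable_fun setT U -> measurable_fun setT U2 -> measurable_fun setT E ->
  measurable_fun setT W -> (forall w, 0 <= E w) -> (forall w, 0 <= W w) ->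
  0 <= k -> 0 <= a ->
  (\int[P]_w (expR (U w))%:E = 1)%E -> (\int[P]_w (expR (U2 w))%:E = 1)%E ->
  (\int[P]_w (E w)%:E <= C1%:E)%E ->
  (\int[P]_w (W w * expR (U w))%:E <= C2%:E)%E ->
  {ae P, forall w, 2^-1 * (expR (U w) * U w + 1) + k * expR (U w) <=
    1 + E w + a * (W w * expR (U w)) + k * expR (U2 w) + 2^-1 * expR (U w)} ->
  (\int[P]_w (expR (U w) * U w + 1)%:E <= (2 * (1 + C1 + a * C2 + 2^-1))%:E)%E.
Proof.
move=> mU mU2 mE mW E0 W0 k0 a0 U1 U21 EC WC H.
have meU : measurable_fun setT (fun w => expR (U w)) by exact: measurableT_comp.
have meU2 : measurable_fun setT (fun w => expR (U2 w)) by exact: measurableT_comp.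
have e0 (X : Omega -> R) w : 0 <= expR (X w) by exact: expR_ge0.
pose N w := expR (U w) * U w + 1.
have mN : measurable_fun setT N.
  by apply: measurable_funD => //; exact: measurable_funM.
have N0 w : 0 <= N w by exact: entropy1_ge0.
pose WU w := W w * expR (U w).
have mWU : measurable_fun setT WU by exact: measurable_funM.
have WU0 w : 0 <= WU w by rewrite mulr_ge0.
have scaled c (X : Omega -> R) : measurable_fun setT X -> (forall w, 0 <= X w) -> 0 <= c ->
    [/\ measurable_fun setT (fun w => c * X w), forall w, 0 <= c * X w &
      (\int[P]_w (c * X w)%:E = c%:E * \int[P]_w (X w)%:E)%E].
  move=> mX X0 c0; split; last exact: ge0_integralZ_EFin.
    by apply: measurable_funM.
  by move=> w; rewrite mulr_ge0.
have summed (X X' : Omega -> R) : measurable_fun setT X -> measurable_fun setT X' ->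
    (forall w, 0 <= X w) -> (forall w, 0 <= X' w) ->
    [/\ measurable_fun setT (fun w => X w + X' w), forall w, 0 <= X w + X' w &
      (\int[P]_w (X w + X' w)%:E = \int[P]_w (X w)%:E + \int[P]_w (X' w)%:E)%E].
  move=> mX mX' X0 X'0; split; last exact: ge0_integralD_EFin.
    exact: measurable_funD.
  by move=> w; rewrite addr_ge0.
have h0 : 0 <= 2^-1 :> R by lra.
have [m1 p1 i1] := scaled _ N mN N0 h0.
have [m2 p2 i2] := scaled _ _ meU (e0 U) k0.
have [ml pl il] := summed _ _ m1 m2 p1 p2.
have [m3 p3 i3] := scaled _ _ mWU WU0 a0.
have [m4 p4 i4] := scaled _ _ meU2 (e0 U2) k0.
have [m5 p5 i5] := scaled _ _ meU (e0 U) h0.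
have [m6 p6 i6] := summed (cst 1) E (measurable_cst _) mE (fun=> ler01) E0.
have [m7 p7 i7] := summed _ _ m6 m3 p6 p3.
have [m8 p8 i8] := summed _ _ m7 m4 p7 p4.
have [m9 p9 i9] := summed _ _ m8 m5 p8 p5.
have : (\int[P]_w (2^-1 * N w + k * expR (U w))%:E <=
    \int[P]_w (cst 1 w + E w + a * WU w + k * expR (U2 w) + 2^-1 * expR (U w))%:E)%E.
  apply: ae_ge0_le_integral => //.
  - by move=> w _; rewrite lee_fin.
  - exact/measurable_EFinP.
  - by move=> w _; rewrite lee_fin.
  - exact/measurable_EFinP.
  - by apply: ae_imply H => w Hw _; rewrite lee_fin.
have int1 : (\int[P]_w (cst (1 : R) w)%:E = 1)%E.
  rewrite -[LHS]/(\int[P]_w (cst 1%E w))%E integral_cst// mul1e.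
  exact: probability_setT.
rewrite il i1 i2 i9 i8 i7 i6 i3 i4 i5 U1 U21 int1 !mule1 => le.
have intN0 : (0 <= \int[P]_w (N w)%:E)%E by apply: integral_ge0 => w _; rewrite lee_fin.
have : (2^-1%:E * \int[P]_w (N w)%:E + k%:E <=
    1 + C1%:E + a%:E * C2%:E + k%:E + 2^-1%:E)%E.
  apply: (le_trans le); rewrite leeD2r// leeD2r// leeD//.
    by rewrite leeD2l.
  by rewrite lee_wpmul2l// lee_fin.
move: intN0; rewrite -/N; case: (\int[P]_w (N w)%:E)%E => [x||] //.
  by rewrite !lee_fin; lra.
by move=> _; rewrite mulry gtr0_sg ?mul1e// invr_gt0.
Qed.

End entropy_estimate.

Section bsde_entropy.
Context d (Omega : measurableType d) (R : realType) (P : probability Omega R).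
Hypothesis P_complete : measure_is_complete P.
Context (m : nat) (T : R) (B : R -> Omega -> 'cV[R]_m).
Hypothesis B_bm : brownian_motion P T B.
Hypothesis T_gt0 : 0 < T.
Local Notation Ft := (augmented_filtration P B).
Local Notation mu := (@lebesgue_measure R).

Lemma as_continuous_linear (a b : R) (X X' : R -> Omega -> R) :
  as_continuous P T X -> as_continuous P T X' ->
  as_continuous P T (fun t w => a * X t w + b * X' t w).
Proof.
move=> cX cX'; rewrite /as_continuous; near=> w.
have cXw : {within `[0, T], continuous (X ^~ w)} by near: w; exact: cX.
have cXw' : {within `[0, T], continuous (X' ^~ w)} by near: w; exact: cX'.
by move=> x; apply: cvgD; apply: cvgM; [exact: cvg_cst|exact: cXw|
  exact: cvg_cst|exact: cXw'].
Unshelve. all: by end_near. Qed.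

Variables (q Z : R -> Omega -> 'cV[R]_m) (I J : R -> Omega -> R)
  (SI SJ : nat -> @simple_integrand _ Omega R m).
Hypothesis qI : ito_approximation P T B q I SI.
Hypothesis ZJ : ito_approximation P T B Z J SJ.
Hypothesis I_cont : as_continuous P T I.
Hypothesis J_cont : as_continuous P T J.

(** A bound on the sum of the two brackets bounds the bracket of every linear combination of [q] and
    [Z], in particular of [q2] and of [q - alpha Z]. *)
Definition clock (t : R) (w : Omega) : R :=
  bracket (q ^~ w) t + bracket (Z ^~ w) t.

Lemma clock_adapted t : 0 <= t <= T -> sigma_measurable (Ft t) (clock t).
Proof.
move=> tT; apply: sigma_measurableD.
  exact: (sigma_measurable_bracket T_gt0 qI tT).
exact: (sigma_measurable_bracket T_gt0 ZJ tT).
Qed.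

Lemma ito_approximation_fin H I' S : ito_approximation P T B H I' S ->
  {ae P, forall w, (ebracket (H ^~ w) T < +oo)%E}.
Proof. by move=> HIS; apply: ae_imply (ae_bracket_cvg T_gt0 HIS) => w []. Qed.

Lemma bracket_increasing H I' S : ito_approximation P T B H I' S ->
  {ae P, forall w, increasing_path T (bracket (H ^~ w))}.
Proof.
move=> HIS; have [_ mH _ _] := HIS.
apply: ae_imply (ae_bracket_cvg T_gt0 HIS) => w [fH _]; split.
- exact: bracket_continuous (ltW T_gt0) (mH w) fH.
- exact: bracket0.
- by move=> s t s0 st tT; exact: le_bracket (mH w) st tT fH.
Qed.

Lemma clock_increasing : {ae P, forall w, increasing_path T (clock ^~ w)}.
Proof.
have [h1 h2] := (bracket_increasing qI, bracket_increasing ZJ).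
apply: filterS2 h1 h2 => w [c1 z1 n1] [c2 z2 n2]; split.
- by move=> v x vT xT vx; apply: cvgD; [exact: c1|exact: c2].
- by rewrite /clock bracket0 bracket0 addr0.
- by move=> s t s0 st tT; rewrite lerD ?n1 ?n2.
Qed.

Variables (alpha : R) (p : nat) (F : Omega -> R) (f Y : R -> Omega -> R).
Hypothesis alpha_gt0 : 0 < alpha.
Hypothesis p_gt1 : (1 < p)%N.
Hypothesis f_int : {ae P, forall w, (\int[mu]_(s in `[0%R, T]) `|f s w|%:E < +oo)%E}.
Hypothesis f_le : {ae P, forall w, {ae mu, forall s, 0 <= s <= T ->
  f s w <= dotv (q s w) (Z s w) - (2 * alpha)^-1 * dotv (q s w) (q s w)}}.
Hypothesis Y_pred : predictable T Ft Y.
Hypothesis Y_eq : {ae P, forall w, forall t : R, 0 <= t <= T ->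
  Y t w = F w + (\int[mu]_(s in `[t, T]) f s w)%R - (J T w - J t w)}.
Variables (C1 C2 : R).
Hypothesis Y_pos : forall tau, stopping_time T Ft tau ->
  (\int[P]_w (expR (p%:R * alpha * Num.max (Y (tau w) w) 0))%:E <= C1%:E)%E.
Hypothesis Y_neg : (\int[P]_w (Num.max (- Y 0 w) 0)%:E <= C2%:E)%E.

Local Notation U := (log_exponential q I).
Local Notation M := (2 * (1 + C1 + alpha * C2 + 2^-1)).

(** In [Y t w - Y 0 w] the terminal value and [J T w] cancel, which leaves [J] and the driver,
    bounded by [path_drift_le]. The factor [2 (1 + alpha^2)] comes from
    [<q - alpha Z> <= 2 <q> + 2 alpha^2 <Z>]. *)
Lemma tilted_path_le (lam : R)
    (q2 := fun t w => (1 + lam) *: q t w + (- (lam * alpha)) *: Z t w)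
    (I2 := fun t w => (1 + lam) * I t w + (- (lam * alpha)) * J t w) : 0 < lam ->
  {ae P, forall w, forall t, 0 <= t <= T ->
    lam * (U t w - alpha * (Y t w - Y 0 w)) <= log_exponential q2 I2 t w - U t w
      + 2^-1 * lam ^+ 2 * (2 * (1 + alpha ^+ 2) * clock t w)}.
Proof.
move=> l0.
have [_ mq _ _] := qI; have [_ mZ _ _] := ZJ.
pose h t w := 1 *: q t w + (- alpha) *: Z t w.
have qI2 : ito_approximation P T B q2 I2 _ :=
  ito_approximation_linear (1 + lam) (- (lam * alpha)) qI ZJ.
have qIh : ito_approximation P T B h _ _ :=
  ito_approximation_linear 1 (- alpha) qI ZJ.
have A1 := ito_approximation_fin qI; have A2 := ito_approximation_fin ZJ.
have A3 := ito_approximation_fin qI2; have A4 := ito_approximation_fin qIh.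
have A5 := ito_approximation0 T_gt0 ZJ.
apply: ae_imply (ae_and (ae_and (ae_and A1 A2) (ae_and A3 A4))
  (ae_and (ae_and A5 f_int) (ae_and f_le Y_eq))).
move=> w [[[fq fZ] [fq2 fh]] [[J0 fi] [fl Ye]]] t tT.
have z0T : 0 <= (0 : R) <= T by rewrite lexx ltW.
have := path_drift_le alpha_gt0 l0 tT (mq w) (mZ w) fq fq2 fh fi fl.
have tT' : t <= T by case/andP: tT.
have := bracket_linear_le (mq w) (mZ w) fq fZ fh tT'.
rewrite (Ye t tT) (Ye 0 z0T) J0 /log_exponential /clock /I2.
set bh := bracket _ t; set bq := bracket _ t; set bZ := bracket _ t.
rewrite -/(bracket _ _).
set b2 := bracket _ t; set f0 := \int[mu]_(s in `[0, T]) _; set ft := \int[mu]_(s in _) _.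
move=> hb hd.
have hb' : 2^-1 * lam ^+ 2 * bh
    <= 2^-1 * lam ^+ 2 * (2 * (1 + alpha ^+ 2) * (bq + bZ)).
  apply: ler_wpM2l; first by rewrite mulr_ge0 ?sqr_ge0// invr_ge0.
  apply: le_trans hb _.
  have bq0 : 0 <= bq by exact: bracket_ge0.
  have bZ0 : 0 <= bZ by exact: bracket_ge0.
  have abq : 0 <= alpha ^+ 2 * bq by rewrite mulr_ge0 ?sqr_ge0.
  have e : 0 <= 2 * (alpha ^+ 2 * bq) + 2 * bZ by rewrite addr_ge0// mulr_ge0.
  rewrite sqrrN -subr_ge0; apply: le_trans e _; rewrite le_eqVlt; apply/orP; left.
  by apply/eqP; ring.
have := le_trans hd (lerD (lexx _) hb'); rewrite -subr_ge0 => {}hd.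
rewrite -subr_ge0; apply: le_trans hd _; rewrite le_eqVlt; apply/orP; left.
by apply/eqP; ring.
Qed.

(** Boundedness of the clock serves to give both exponentials mean 1 and to choose [lam]; neither
    [n] nor [lam] survives in the bound. *)
Lemma local_entropy_le (tau : Omega -> R) (n : R) : stopping_time T Ft tau ->
  0 <= n -> {ae P, forall w, clock (tau w) w <= n} ->
  measurable_fun setT (fun w => U (tau w) w) /\
  (\int[P]_w (expR (U (tau w) w) * U (tau w) w + 1)%:E <= M%:E)%E.
Proof.
move=> tau_st n0 tau_n; have [tauT _] := tau_st.
have [_ mq _ _] := qI; have [_ mZ _ _] := ZJ.
pose c := 2 * (1 + alpha ^+ 2) * n.
have c0 : 0 <= c by rewrite !mulr_ge0// addr_ge0// sqr_ge0.
(* This makes [lam^2 / 2 <q - alpha Z> <= lam / 2] up to [tau]. *)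
pose lam := (c + 1)^-1.
have l0 : 0 < lam by rewrite invr_gt0 ltr_wpDl.
pose q2 t w := (1 + lam) *: q t w + (- (lam * alpha)) *: Z t w.
pose I2 t w := (1 + lam) * I t w + (- (lam * alpha)) * J t w.
have qI2 : ito_approximation P T B q2 I2 _ :=
  ito_approximation_linear (1 + lam) (- (lam * alpha)) qI ZJ.
have cI2 : as_continuous P T I2 by exact: as_continuous_linear.
have q_n : {ae P, forall w, bracket (q ^~ w) (tau w) <= n}.
  apply: ae_imply tau_n => w; apply: le_trans.
  by rewrite lerDl bracket_ge0.
(* Only finiteness of this bound on the bracket of [q2] matters: it ensures mean 1 and does not
   enter the estimate. *)
pose K := 2 * (1 + lam) ^+ 2 * n + 2 * (- (lam * alpha)) ^+ 2 * n.
have K0 : 0 <= K.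
  by apply: addr_ge0; apply: mulr_ge0 => //; apply: mulr_ge0 => //; exact: sqr_ge0.
have q2_K : {ae P, forall w, bracket (q2 ^~ w) (tau w) <= K}.
  have A1 := ito_approximation_fin qI; have A2 := ito_approximation_fin ZJ.
  have A3 := ito_approximation_fin qI2.
  apply: ae_imply (ae_and (ae_and A1 A2) (ae_and A3 tau_n)) => w [[fq fZ] [fq2 tn]].
  have /andP[_ tT] := tauT w.
  apply: le_trans (bracket_linear_le (mq w) (mZ w) fq fZ fq2 tT) _.
  have b1 := bracket_ge0 (q ^~ w) (tau w); have b2 := bracket_ge0 (Z ^~ w) (tau w).
  have tq : bracket (q ^~ w) (tau w) <= n by apply: le_trans tn; rewrite lerDl.
  have tZ : bracket (Z ^~ w) (tau w) <= n by apply: le_trans tn; rewrite lerDr.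
  by apply: lerD; apply: ler_wpM2l => //; apply: mulr_ge0 => //; exact: sqr_ge0.
have [mU eU WU] := stopped_exponential_unit P_complete B_bm T_gt0 qI I_cont
  tau_st n0 q_n.
have [mU2 eU2 _] := stopped_exponential_unit P_complete B_bm T_gt0 qI2 cI2
  tau_st K0 q2_K.
split; first exact: mU.
have mY := predictable_stopped_measurable P_complete B_bm T_gt0 Y_pred tau_st.
pose W w := Num.max (- Y 0 w) 0.
have mW0 : sigma_measurable (Ft 0) W.
  apply: (@sigma_measurable_comp _ _ _ _ (fun x => Num.max (- x) 0)).
    have mN : measurable_fun setT (fun x : R => - x) by exact: measurable_funN.
    by apply: measurable_maxr; first exact: mN.
  exact: predictable0 Y_pred.
have W0 w : 0 <= W w by rewrite le_max lexx orbT.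
have mW := sigma_measurableW P_complete B_bm (ltW T_gt0) mW0.
have WC : (\int[P]_w (W w * expR (U (tau w) w))%:E <= C2%:E)%E.
  exact: le_trans (WU W mW0 W0) Y_neg.
pose E w := expR (p%:R * alpha * Num.max (Y (tau w) w) 0).
have mE : measurable_fun setT E.
  apply: measurableT_comp => //; apply: measurable_funM => //.
  by apply: measurable_maxr; first exact: mY.
have E0 w : 0 <= E w by exact: expR_ge0.
apply: (integral_entropy_le mU mU2 mE mW E0 W0 _ _ eU eU2 (Y_pos tau_st) WC (k := lam^-1)).
- by rewrite invr_ge0 ltW.
- exact: ltW.
- have TP := tilted_path_le l0.
  apply: ae_imply (ae_and TP tau_n) => w [Hw tn].
  apply: (entropy_drift_le alpha_gt0 l0 p_gt1 _ (Hw _ (tauT w))).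
  have ck : 2 * (1 + alpha ^+ 2) * clock (tau w) w <= c.
    by rewrite ler_wpM2l// mulr_ge0// addr_ge0// sqr_ge0.
  apply: le_trans (ler_wpM2l (ltW l0) ck) _.
  by rewrite /lam mulrC ler_pdivrMr ?mul1r ?lerDl// ltr_wpDl.
Qed.

(** The clock of almost every path is finite at [T], so its hitting time of level [n] equals [T] for
    large [n] and the localization becomes stationary. *)
Lemma clock_localization (tau : Omega -> R) : stopping_time T Ft tau ->
  let rho n w := Num.min (tau w) (hitting T clock n%:R w) in
  [/\ forall n, stopping_time T Ft (rho n),
      forall n, {ae P, forall w, clock (rho n w) w <= n%:R} &
      {ae P, forall w, \forall n \near \oo, rho n w = tau w}].
Proof.
move=> tau_st rho; have [tauT _] := tau_st.
have hit_st n := stopping_time_hitting T_gt0 clock_adapted clock_increasing n.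
split=> [n|n|].
- exact: stopping_time_min.
- apply: ae_imply clock_increasing => w Vw; have [_ V0 ndV] := Vw.
  apply: le_trans (hitting_bound T_gt0 Vw (ler0n _ n)).
  have /andP[t0 tT] := tauT w.
  have /andP[h0 hT] := hitting_itv T_gt0 clock n%:R w.
  by apply: ndV => //; rewrite ?le_min ?t0 ?h0// ge_min lexx orbT.
- apply: ae_imply clock_increasing => w Vw.
  near=> n; rewrite /rho hitting_eq//; last first.
    by near: n; exact: nbhs_infty_gtr.
  by rewrite min_l//; have /andP[] := tauT w.
Unshelve. all: by end_near. Qed.

Lemma stopped_entropy_le (tau : Omega -> R) : stopping_time T Ft tau ->
  measurable_fun setT (fun w => U (tau w) w) /\
  (\int[P]_w (expR (U (tau w) w) * U (tau w) w + 1)%:E <= M%:E)%E.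
Proof.
move=> tau_st; have [rho_st rho_n rho_cvg] := clock_localization tau_st.
pose rho (n : nat) w := Num.min (tau w) (hitting T clock n%:R w).
have loc n := local_entropy_le (tau := rho n) (rho_st n) (ler0n _ n) (rho_n n).
have Ucvg : {ae P, forall w, (fun n => U (rho n w) w) @ \oo --> U (tau w) w}.
  apply: ae_imply rho_cvg => w rw; apply: cvg_near_cst.
  by apply: filterS rw => n; rewrite /rho => ->.
have mU : measurable_fun setT (fun w => U (tau w) w).
  by apply: (measurable_ae_cvg P_complete _ Ucvg) => n; have [] := loc n.
split=> //.
have mX (X : Omega -> R) : measurable_fun setT X ->
    measurable_fun setT (fun w => expR (X w) * X w + 1).
  move=> mX; apply: measurable_funD => //; apply: measurable_funM => //.
  exact: measurableT_comp.
apply: (@le_integral_ae_cvg _ _ _ P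
  (fun n w => expR (U (rho n w) w) * U (rho n w) w + 1)).
- by move=> n; apply: mX; have [] := loc n.
- exact: mX.
- by move=> n w; exact: entropy1_ge0.
- by move=> w; exact: entropy1_ge0.
- apply: ae_imply rho_cvg => w rw; apply: cvg_near_cst.
  by apply: filterS rw => n; rewrite /rho => ->.
- by move=> n; have [] := loc n.
Qed.

End bsde_entropy.

(** * Proof of the theorem *)

Lemma integral_indicator d (Omega : measurableType d) (R : realType)
    (P : {measure set Omega -> \bar R}) (A : set Omega) (X : Omega -> R) :
  measurable A -> P.-integrable setT (EFin \o X) ->
  (\int[P]_(w in A) (X w)%:E = (\int[P]_w (\1_A w * X w))%:E)%E.
Proof.
move=> mA iX.
have iA : P.-integrable A (EFin \o X) by exact: (integrableS measurableT mA).
rewrite -(fineK (integrable_fin_num mA iA)) /Rintegral; congr (_%:E); congr fine.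
rewrite integral_mkcond epatch_indic; apply: eq_integral => w _ /=.
by rewrite mulrC EFinM.
Qed.

Lemma integrable_entropy d (Omega : measurableType d) (R : realType)
    (P : probability Omega R) (u : Omega -> R) (M : R) : measurable_fun setT u ->
  (\int[P]_w (expR (u w) * u w + 1)%:E <= M%:E)%E ->
  P.-integrable setT (EFin \o (fun w => expR (u w) * u w)) /\
  P.-integrable setT (EFin \o (fun w => expR (u w))).
Proof.
move=> mU eU.
have me : measurable_fun setT (fun w => expR (u w)) by exact: measurableT_comp.
have mE : measurable_fun setT (fun w => expR (u w) * u w + 1).
  by apply: measurable_funD => //; exact: measurable_funM.
have [iE _] := integrable_ge0 mE (fun w => entropy1_ge0 (u w)) eU.
split.
  have i1 : P.-integrable setT (EFin \o (cst 1 : Omega -> R)).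
    by apply: (@integrable_bounded _ _ _ P _ 1) => // w; rewrite normr1.
  have := integrableB measurableT iE i1; apply: eq_integrable => // w _ /=.
  by rewrite -EFinD addrK.
have [] // := @integrable_ge0 _ _ _ P (fun w => expR (u w)) M me (fun w => expR_ge0 _).
apply: le_trans eU; apply: ge0_le_integral => //.
- exact/measurable_EFinP.
- exact/measurable_EFinP.
- by move=> w _; rewrite lee_fin; have := entropy_ge (u w); lra.
Qed.

Section entropy_martingale.
Context d (Omega : measurableType d) (R : realType) (P : probability Omega R).
Hypothesis P_complete : measure_is_complete P.
Context (m : nat) (T : R) (B : R -> Omega -> 'cV[R]_m).
Hypothesis B_bm : brownian_motion P T B.
Hypothesis T_gt0 : 0 < T.
Local Notation Ft := (augmented_filtration P B).
Variables (q : R -> Omega -> 'cV[R]_m) (I : R -> Omega -> R)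
  (SI : nat -> @simple_integrand _ Omega R m).
Hypothesis qI : ito_approximation P T B q I SI.
Hypothesis I_cont : as_continuous P T I.
Hypothesis I_adapted : adapted T Ft I.
Local Notation U := (log_exponential q I).
Local Notation L := (stochastic_exponential q I).
Variable M : R.
Hypothesis U_entropy : forall tau, stopping_time T Ft tau ->
  measurable_fun setT (fun w => U (tau w) w) /\
  (\int[P]_w (expR (U (tau w) w) * U (tau w) w + 1)%:E <= M%:E)%E.
Variable rho : R -> nat -> Omega -> R.
Hypothesis rho_st : forall t n, 0 <= t <= T -> stopping_time T Ft (rho t n).
Hypothesis rho_bracket : forall t n, 0 <= t <= T ->
  {ae P, forall w, bracket (q ^~ w) (rho t n w) <= n%:R}.
Hypothesis rho_cvg : forall t, 0 <= t <= T ->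
  {ae P, forall w, \forall n \near \oo, rho t n w = t}.

Let cst_st t : 0 <= t <= T -> stopping_time T Ft (fun=> t).
Proof. exact: stopping_time_cst. Qed.

Lemma stochastic_exponentialE t w : L t w = expR (U t w).
Proof. by []. Qed.

Lemma entropy_class_D : class_D P T Ft L.
Proof.
apply: (@uniformly_integrable_entropy _ _ _ P _ M) => _ [tau tau_st ->].
have [mU eU] := U_entropy tau_st.
by exists (fun w => U (tau w) w).
Qed.

Lemma entropy_finite : (\int[P]_w (L T w * ln (L T w))%:E < +oo)%E.
Proof.
have T_itv : 0 <= T <= T by rewrite lexx ltW.
have [mU eU] := U_entropy (cst_st T_itv).
have [+ _] := integrable_entropy mU eU; move=> /(integrable_fin_num measurableT).
rewrite fin_numElt => /andP[_].
by under [in X in _ -> X]eq_integral do rewrite stochastic_exponentialE expRK.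
Qed.

Lemma stopped_integrable tau : stopping_time T Ft tau ->
  P.-integrable setT (EFin \o (fun w => L (tau w) w)).
Proof. by move=> /U_entropy[mU eU]; have [] := integrable_entropy mU eU. Qed.

Lemma exponential_adapted : adapted T Ft L.
Proof.
move=> t tT; apply: (@sigma_measurable_comp _ _ _ _ expR) => //.
apply: sigma_measurableB; first exact: I_adapted.
apply: (@sigma_measurable_comp _ _ _ _ (fun x => 2^-1 * x)).
  exact: measurable_funM.
exact: (sigma_measurable_bracket T_gt0 qI tT).
Qed.

(** The common entropy bound at all stopping times gives uniform integrability, so that expectations
    pass to the limit along stationary sequences of stopping times. *)
Lemma stopped_expectation_cvg (tau : nat -> Omega -> R) (t : R) (W : Omega -> R) :
  (forall n, stopping_time T Ft (tau n)) -> 0 <= t <= T ->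
  {ae P, forall w, \forall n \near \oo, tau n w = t} ->
  measurable_fun setT W -> (forall w, 0 <= W w <= 1) ->
  (fun n => \int[P]_w (W w * L (tau n w) w)) @ \oo --> \int[P]_w (W w * L t w).
Proof.
move=> tau_st tT tau_cvg mW W1.
have t_st := cst_st tT.
have mL tau' : stopping_time T Ft tau' ->
    measurable_fun setT (fun w => L (tau' w) w).
  by move=> /U_entropy[mU _]; exact: measurableT_comp.
have Lcvg : {ae P, forall w, (fun n => L (tau n w) w) @ \oo --> L t w}.
  apply: ae_imply tau_cvg => w tw; apply: cvg_near_cst.
  by apply: filterS tw => n ->.
have Lunif : asymptotically_uniform P (fun n w => L (tau n w) w).
  apply: (@asymptotically_uniform_entropy _ _ _ P (fun n w => U (tau n w) w) M) => n.
    by have [] := U_entropy (tau_st n).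
  by have [] := U_entropy (tau_st n).
have [_ h] := @cvg_expectation _ _ _ P (fun n w => L (tau n w) w) (L t)
  (fun n => mL _ (tau_st n)) (mL _ t_st) (fun n w => expR_ge0 _) (fun w => expR_ge0 _)
  Lcvg Lunif.
exact: h mW W1.
Qed.

(** For each [n] the stopped exponential has bounded bracket, so its expectations on [A] at
    [rho t n] and at [sigma n] agree; these times become [t] and [s] as [n] grows. *)
Lemma exponential_martingale : martingale P T Ft L.
Proof.
split; first exact: exponential_adapted.
  by move=> t tT; exact: (stopped_integrable (cst_st tT)).
move=> s t s0 st tT A FA.
have sT : s <= T by exact: le_trans tT.
have t_itv : 0 <= t <= T by rewrite (le_trans s0 st).
have s_itv : 0 <= s <= T by rewrite s0.
have smA : sigma_measurable (Ft s) (\1_A : Omega -> R) by exact: sigma_measurable_indic.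
have mA1 := sigma_measurableW P_complete B_bm sT smA.
have mA : measurable A by exact: (augmented_sub P_complete B_bm sT).
have A1 w : 0 <= (\1_A w : R) <= 1 by rewrite indicE; case: (w \in A); rewrite ?lexx ?ler01.
pose sigma n w := Num.min (rho t n w) s.
have sigma_st n : stopping_time T Ft (sigma n).
  by apply: stopping_time_min; [exact: rho_st|exact: cst_st].
have sigma_cvg : {ae P, forall w, \forall n \near \oo, sigma n w = s}.
  apply: ae_imply (rho_cvg t_itv) => w; apply: filterS => n rt.
  by rewrite /sigma rt min_r.
have c1 := stopped_expectation_cvg (fun n => rho_st n t_itv) t_itv (rho_cvg t_itv)
  mA1 A1.
have c2 := stopped_expectation_cvg sigma_st s_itv sigma_cvg mA1 A1.
have e12 n : \int[P]_w (\1_A w * L (rho t n w) w) = \int[P]_w (\1_A w * L (sigma n w) w).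
  have [_ h] := expectation_stopped_exponential P_complete B_bm T_gt0 qI I_cont
    (rho_st n t_itv) (ler0n _ n) (rho_bracket n t_itv) s_itv.
  apply: etrans (h _ 1 smA A1); apply: eq_Rintegral => w _.
  have [rT _] := rho_st n t_itv.
  by rewrite min_l//; have /andP[] := rT w.
have {c1 c2} e : \int[P]_w (\1_A w * L t w) = \int[P]_w (\1_A w * L s w).
  have limit_unique (u v : nat -> R) (a b : R) : u =1 v -> u @ \oo --> a ->
    v @ \oo --> b -> a = b.
    by move=> /funext ->; exact: (cvg_unique (@norm_hausdorff _ R)).
  exact: limit_unique e12 c1 c2.
have LA u (u_itv : 0 <= u <= T) := integral_indicator mA
  (stopped_integrable (cst_st u_itv)).
exact: etrans (LA t t_itv) (etrans (congr1 EFin e) (esym (LA s s_itv))).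
Qed.

Lemma entropy_ui_martingale : ui_martingale P T Ft L.
Proof.
split; first exact: exponential_martingale.
apply: (@uniformly_integrable_entropy _ _ _ P _ M) => _ [t tT ->].
have [mU eU] := U_entropy (cst_st tT).
by exists (U t).
Qed.

End entropy_martingale.

Section solution_class.
Context d (Omega : measurableType d) (R : realType) (P : probability Omega R).
Variables (T alpha eps : R) (m p : nat).
Variables (Y : R -> Omega -> R) (Z : R -> Omega -> 'cV[R]_m).
Hypothesis alpha_gt0 : 0 < alpha.
Hypothesis eps_gt0 : 0 < eps.
Hypothesis YZ_class : in_solution_class P T alpha eps p Y Z.

(** One constant, the whole integral of the class, dominates both parts. Its integrand contains
    suprema over all times, so the comparison is the one for lower integrals; the second part uses
    [x <= e^x]. *)
Lemma solution_class_bound : exists C : R,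
  (forall tau : Omega -> R, (forall w, 0 <= tau w <= T) ->
     (\int[P]_w (expR (p%:R * alpha * Num.max (Y (tau w) w) 0))%:E <= C%:E)%E) /\
  (forall t : R, 0 <= t <= T ->
     (\int[P]_w (eps * Num.max (- Y t w) 0)%:E <= C%:E)%E).
Proof.
pose Ypos w := ereal_sup [set (Num.max (Y t w) 0)%:E | t in `[0, T]].
pose Yneg w := ereal_sup [set (Num.max (- Y t w) 0)%:E | t in `[0, T]].
pose G w := (expeR ((p%:R * alpha)%:E * Ypos w) + expeR (eps%:E * Yneg w)
     + \int[lebesgue_measure]_(t in `[0%R, T]) (enorm (Z t w) ^+ 2)%:E)%E.
have GT : (\int[P]_w G w < +oo)%E by [].
have Z0 w : (0 <= \int[lebesgue_measure]_(t in `[0%R, T]) (enorm (Z t w) ^+ 2)%:E)%E.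
  by apply: integral_ge0 => t _; rewrite lee_fin sqr_ge0.
have G0 w : (0 <= G w)%E.
  by apply: adde_ge0 => //; apply: adde_ge0; exact: expeR_ge0.
have GC : (\int[P]_w G w = (fine (\int[P]_w G w))%:E)%E.
  by rewrite fineK// ge0_fin_numE//; exact: integral_ge0.
exists (fine (\int[P]_w G w)); rewrite -GC; split=> [tau tauT|t tT].
  apply: ge0_le_lower_integral => [w _|w _]; first by rewrite lee_fin expR_ge0.
  have Yt : ((Num.max (Y (tau w) w) 0)%:E <= Ypos w)%E.
    by apply: ereal_sup_ubound; exists (tau w) => //=; rewrite in_itv/= tauT.
  apply: (@le_trans _ _ (expeR ((p%:R * alpha)%:E * Ypos w))).
    rewrite -[leLHS]/(expeR (p%:R * alpha * Num.max (Y (tau w) w) 0)%:E).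
    rewrite lee_expeR EFinM; apply: lee_wpmul2l => //.
    by rewrite lee_fin mulr_ge0// ltW.
  by rewrite /G -addeA leeDl// adde_ge0// expeR_ge0.
apply: ge0_le_lower_integral => [w _|w _].
  by rewrite lee_fin mulr_ge0 ?(ltW eps_gt0)// le_max lexx orbT.
have Yt : ((Num.max (- Y t w) 0)%:E <= Yneg w)%E.
  by apply: ereal_sup_ubound; exists t => //=; rewrite in_itv/= tT.
apply: (@le_trans _ _ (expeR (eps%:E * Yneg w))).
  apply: (@le_trans _ _ (expeR (eps * Num.max (- Y t w) 0)%:E)).
    by rewrite lee_fin; apply: le_trans (expR_ge1Dx _); rewrite lerDr.
  rewrite lee_expeR EFinM; apply: lee_wpmul2l => //.
  by rewrite lee_fin ltW.
by rewrite /G addeAC leeDr// adde_ge0// expeR_ge0.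
Qed.

End solution_class.

Theorem lemma4p3 (R : realType) (disp : measure_display)
  (Omega : measurableType disp) (P : probability Omega R)
  (P_complete : measure_is_complete P)
  (T alpha : R) (T_gt0 : 0 < T) (alpha_gt0 : 0 < alpha)
  (d m : nat) (d_gt0 : (0 < d)%N) (d_le_m : (d <= m)%N)
  (B : R -> Omega -> 'cV[R]_m) (B_bm : brownian_motion P T B)
  (b : R -> Omega -> 'cV[R]_d) (sigma : R -> Omega -> 'M[R]_(d, m))
  (b_pred : predictable_mx T (augmented_filtration P B) b)
  (b_bounded : bounded_mx P T b)
  (sigma_pred : predictable_mx T (augmented_filtration P B) sigma)
  (sigma_bounded : bounded_mx P T sigma)
  (sigma_inv : ae_dtdP P T (fun t w =>
     sigma t w *m (sigma t w)^T \in unitmx))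
  (theta_bounded : bounded_mx P T (fun t w =>
     market_price (b t w) (sigma t w)))
  (C : set 'cV[R]_d) (C_closed : closed C)
  (C_convex : convex_set (C : set (convex_lmodType 'cV[R]_d))) (C0 : C 0)
  (f := fun t w => generator alpha C (b t w) (sigma t w))
  (F : Omega -> R)
  (F_meas : sigma_measurable (augmented_filtration P B T) F)
  (p : nat) (p_gt1 : (1 < p)%N) (eps : R) (eps_gt0 : 0 < eps)
  (F_pos : (\int[P]_w (expR (p%:R * alpha * Num.max (F w) 0)%R)%:E < +oo)%E)
  (F_neg : (\int[P]_w (expR (eps * Num.max (- F w) 0)%R)%:E < +oo)%E)
  (Y : R -> Omega -> R) (Z : R -> Omega -> 'cV[R]_m)
  (YZ_sol : bsde_solution P T B F f Y Z)
  (YZ_class : in_solution_class P T alpha eps p Y Z)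
  (q : R -> Omega -> 'cV[R]_m)
  (q_pred : predictable_mx T (augmented_filtration P B) q)
  (q_subdiff : ae_dtdP P T (fun t w =>
     subdifferential (f t w) (Z t w) (q t w)))
  (I : R -> Omega -> R) (I_int : ito_integral P T B q I)
  (L := stochastic_exponential q I) :
  [/\ (\int[P]_w (L T w * ln (L T w))%:E < +oo)%E,
      class_D P T (augmented_filtration P B) L &
      ui_martingale P T (augmented_filtration P B) L].
Proof.
have [[Y_pred _] _ _ f_int [J ZJ_int Y_eq]] := YZ_sol.
have [_ I_adapted I_cont _] := I_int.
have [_ _ J_cont _] := ZJ_int.
have [SI qI] := ito_integral_approximation P_complete B_bm T_gt0 I_int.
have [SJ ZJ] := ito_integral_approximation P_complete B_bm T_gt0 ZJ_int.
(* The subgradient inclusion, given almost everywhere in time and chance, is first turned into one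
   for almost every path. *)
have f_le : {ae P, forall w, {ae (@lebesgue_measure R), forall s, 0 <= s <= T ->
    f s w (Z s w) <= dotv (q s w) (Z s w)
      - (2 * alpha)^-1 * dotv (q s w) (q s w)}}.
  apply: ae_imply (ae_dtdP_path q_subdiff) => w; apply: ae_imply => s qs sT.
  apply: subdifferential_conjugate (qs sT) => // z'.
  exact: generator_le.
have [C1 [Y_pos Y_neg]] := solution_class_bound alpha_gt0 eps_gt0 YZ_class.
have zero_itv : 0 <= (0 : R) <= T by rewrite lexx ltW.
(* The class controls [eps] times the negative part of [Y 0]; dividing by [eps] gives the constant
   [C2] of the entropy estimate. *)
have Y_neg0 : (\int[P]_w (Num.max (- Y 0 w) 0)%:E <= (eps^-1 * C1)%:E)%E.
  have mY0 : measurable_fun setT (Y 0).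
    exact: (sigma_measurableW P_complete B_bm (ltW T_gt0) (predictable0 T_gt0 Y_pred)).
  have mYn : measurable_fun setT (fun w => eps * Num.max (- Y 0 w) 0).
    apply: measurable_funM => //; apply: measurable_maxr => //.
    exact: measurable_funN.
  have Yn0 w : 0 <= eps * Num.max (- Y 0 w) 0.
    by rewrite mulr_ge0 ?(ltW eps_gt0)// le_max lexx orbT.
  have einv0 : 0 <= eps^-1 by rewrite invr_ge0 ltW.
  have := ge0_integralZ_EFin P mYn einv0 Yn0.
  under eq_integral do rewrite mulKf ?gt_eqF//.
  move=> ->; rewrite EFinM lee_wpmul2l ?lee_fin//.
  exact: Y_neg.
have entropy := stopped_entropy_le P_complete B_bm T_gt0 qI ZJ I_cont J_cont
  alpha_gt0 p_gt1 f_int f_le Y_pred Y_eq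
  (fun tau tau_st => Y_pos tau (proj1 tau_st)) Y_neg0.
(* The localization of the constant stopping time [t]; bounding the clock bounds in particular the
   bracket of [q]. *)
pose rho t n w := Num.min t (hitting T (clock q Z) n%:R w).
have loc t (tT : 0 <= t <= T) := clock_localization T_gt0 qI ZJ
  (@stopping_time_cst _ _ _ P _ _ B _ tT).
have rho_st t n (tT : 0 <= t <= T) : stopping_time T (augmented_filtration P B) (rho t n).
  by have [h _ _] := loc t tT; exact: h.
have rho_bracket t n (tT : 0 <= t <= T) :
    {ae P, forall w, bracket (q ^~ w) (rho t n w) <= n%:R}.
  have [_ + _] := loc t tT; move=> /(_ n); apply: ae_imply => w; apply: le_trans.
  by rewrite lerDl bracket_ge0.
have rho_cvg t (tT : 0 <= t <= T) :
    {ae P, forall w, \forall n \near \oo, rho t n w = t}.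
  by have [] := loc t tT.
split.
- exact: entropy_finite entropy.
- exact: entropy_class_D entropy.
- exact: (entropy_ui_martingale P_complete B_bm T_gt0 qI I_cont I_adapted entropy
    rho_st rho_bracket rho_cvg).
Qed.
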